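(* Let $a,b,c>0$ be constants with $a-c<1$. For each $d$, let the training data be i.i.d. generated from an $(a,b,c)$-imbalanced two-component sub-gaussian mixture model, let $\hat f(x)=\langle x,\hat\beta\rangle+\hat\beta_0$ be the margin-rebalanced SVM classifier trained with hyperparameter $\tau=\tau_d>0$, and let $\mathrm{Err}_+,\mathrm{Err}_-,\mathrm{Err}_{\rm b}$ be its minority, majority and balanced test errors (see context). Then, as $d\to\infty$: 1. (High signal) If $a-c<b$ and $1\le\tau_d\ll d^{b/2}$, then $\mathrm{Err}_+=o(1)$ and $\mathrm{Err}_-=o(1)$. 2. (Moderate signal) Suppose $b<a-c<2b$. If $d^{a-b-c}\ll\tau_d\ll d^{(a-c)/2}$, then $\mathrm{Err}_+=o(1)$ and $\mathrm{Err}_-=o(1)$. However, if $\tau_d\asymp1$, then $\mathrm{Err}_+=1-o(1)$ and $\mathrm{Err}_-=o(1)$. 3. (Low signal) If $a-c>2b$, then for any choice of $\tau_d$, $\mathrm{Err}_{\rm b}\ge\frac12-o(1)$.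
   Context: A dataset $(x_i,y_i)_{i=1}^n$ is i.i.d. from a two-component sub-gaussian mixture model (2-subGMM) if $\mathbb P(y_i=+1)=1-\mathbb P(y_i=-1)=\pi$ and $x_i=y_i\mu+z_i$, where $z_i\in\mathbb R^d$ is independent of $y_i$ and has independent coordinates $z_{ij}$ with $\mathbb E z_{ij}=0$, $\mathrm{Var}(z_{ij})=1$ and $\|z_{ij}\|_{\psi_2}:=\inf\{K>0:\mathbb E\exp(z_{ij}^2/K^2)\le2\}\le C$ for all $j$, with $C$ an absolute constant. It is $(a,b,c)$-imbalanced if $\pi\propto d^{-a}$, $\|\mu\|_2^2\propto d^b$, $n\propto d^{c+1}$, where $u_d\propto v_d$ means $u_d=\mathrm{const}\cdot v_d$ for all $d$ with a fixed positive constant (up to integer rounding for $n$). Margin-rebalanced SVM with hyperparameter $\tau$: $(\hat\beta,\hat\beta_0,\hat\kappa)$ maximizes $\kappa$ over $\|\beta\|_2\le1$, $\beta_0\in\mathbb R$, $\kappa\in\mathbb R$ subject to $y_i(\langle x_i,\beta\rangle+\beta_0)\ge\tau\kappa$ for all $i$ with $y_i=+1$ and $y_i(\langle x_i,\beta\rangle+\beta_0)\ge\kappa$ for all $i$ with $y_i=-1$. (One-class samples are disregarded; they have vanishing probability and the classifier may be set arbitrarily there.) For a test point $(x_{\rm test},y_{\rm test})$ from the same distribution, independent of the training data: $\mathrm{Err}_+=\mathbb P(\hat f(x_{\rm test})\le0\mid y_{\rm test}=+1)$, $\mathrm{Err}_-=\mathbb P(\hat f(x_{\rm test})>0\mid y_{\rm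 test}=-1)$ (probability over both training data and test point), $\mathrm{Err}_{\rm b}=\frac12\mathrm{Err}_++\frac12\mathrm{Err}_-$. $u_d\ll v_d$ means $u_d=o(v_d)$; $u_d\asymp v_d$ means $u_d=O(v_d)$ and $v_d=O(u_d)$. *)

(* Defs.v *)
From HB Require Import structures.
From mathcomp Require Import all_boot all_order all_algebra.
From mathcomp Require Import all_classical all_reals all_analysis.

Set Implicit Arguments.
Unset Strict Implicit.
Unset Printing Implicit Defensive.

Import Order.TTheory GRing.Theory Num.Theory.
Import numFieldNormedType.Exports.

Local Open Scope classical_set_scope.
Local Open Scope ring_scope.

(* Vectors of R^d are tuples: [d.-tuple R] carries the product sigma-algebra,
   whereas the library gives no measurable structure to ['rV[R]_d], and its
   norm on ['rV[R]_d] is the sup norm. *)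
Section Euclidean.
Context {R : realType}.

Definition dotp d (u v : d.-tuple R) : R := \sum_(j < d) tnth u j * tnth v j.

Definition norm2 d (u : d.-tuple R) : R := Num.sqrt (dotp u u).

End Euclidean.

Section Independence.
Context d (T : measurableType d) {R : realType} (P : probability T R).

Definition mutually_independent (I : finType) d' (T' : measurableType d')
    (X : I -> T -> T') : Prop :=
  forall (J : {set I}) (A : I -> set T'), (forall i, measurable (A i)) ->
    P (\bigcap_(i in [set` J]) (X i @^-1` A i))
      = (\prod_(i in J) P (X i @^-1` A i))%E.

Definition independent d1 d2 (T1 : measurableType d1) (T2 : measurableType d2)
    (X : T -> T1) (Y : T -> T2) : Prop :=
  forall A B, measurable A -> measurable B ->
    P (X @^-1` A `&` Y @^-1` B) = (P (X @^-1` A) * P (Y @^-1` B))%E.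

Definition has_law d' (T' : measurableType d') (X : T -> T')
    (Q : probability T' R) : Prop :=
  forall A, measurable A -> P (X @^-1` A) = Q A.

(* The infimum is taken in \bar R so that it is +oo, rather than 0, when no K
   is admissible. *)
Definition psi2_norm (X : T -> R) : \bar R :=
  ereal_inf [set K%:E | K in
    [set K : R | 0 < K /\ ('E_P[fun w => expR (X w ^+ 2 / K ^+ 2)] <= 2%:E)%E]].

Definition cond_prob (A B : set T) : R := fine (P (A `&` B)) / fine (P B).

End Independence.

Section Model.
Context {R : realType}.

Definition noise d (mu : d.-tuple R) (s : d.-tuple R * R) : d.-tuple R :=
  [tuple tnth s.1 j - s.2 * tnth mu j | j < d].

(* [Q] is the law of one labelled point of the 2-subGMM, seen as a probability
   on R^d * R whose coordinate maps are x and y = 1 or -1; then z = x - y mu. *)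
Record is_2subGMM d (pi : R) (mu : d.-tuple R) (C : R)
    (Q : probability (d.-tuple R * R)%type R) : Prop := {
  gmm_label_pos : Q [set s | s.2 = 1] = pi%:E ;
  gmm_label_neg : Q [set s | s.2 = -1] = (1 - pi)%:E ;
  gmm_noise_label : independent Q (noise mu) snd ;
  gmm_noise_coord :
    mutually_independent Q (fun (j : 'I_d) s => tnth (noise mu s) j) ;
  gmm_noise_mean : forall j, ('E_Q[fun s => tnth (noise mu s) j] = 0)%E ;
  gmm_noise_var : forall j, ('V_Q[fun s => tnth (noise mu s) j] = 1)%E ;
  gmm_noise_psi2 : forall j,
    (psi2_norm Q (fun s => tnth (noise mu s) j) <= C%:E)%E }.

Definition iid_with_law d (T : measurableType d) (P : probability T R)
    n d' (T' : measurableType d') (X : T -> n.-tuple T')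
    (Q : probability T' R) : Prop :=
  mutually_independent P (fun (i : 'I_n) w => tnth (X w) i) /\
  forall i : 'I_n, has_law P (fun w => tnth (X w) i) Q.

Definition propto (u v : nat -> R) : Prop :=
  exists2 k : R, 0 < k & forall d, (0 < d)%N -> u d = k * v d.

(* Proportionality up to rounding to an integer. *)
Definition propto_nat (u : nat -> nat) (v : nat -> R) : Prop :=
  exists2 k : R, 0 < k & forall d, (0 < d)%N -> `|(u d)%:R - k * v d| < 1.

Definition imbalanced (a b c : R) (pi : nat -> R) (mu : forall d, d.-tuple R)
    (n : nat -> nat) : Prop :=
  [/\ propto pi (fun d => d%:R `^ (- a)),
      propto (fun d => norm2 (mu d) ^+ 2) (fun d => d%:R `^ b) &
      propto_nat n (fun d => d%:R `^ (c + 1))].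

End Model.

Section SVM.
Context {R : realType}.

(* Value at x of the affine function with parameters [f] = (beta, beta0). *)
Definition score d (f : d.-tuple R * R) (x : d.-tuple R) : R :=
  dotp x f.1 + f.2.

Definition svm_feasible d n (tau : R) (D : n.-tuple (d.-tuple R * R))
    (f : d.-tuple R * R) (kappa : R) : Prop :=
  norm2 f.1 <= 1 /\
  forall i : 'I_n, let: (x, y) := tnth D i in
    (y = 1 -> tau * kappa <= y * score f x) /\
    (y = -1 -> kappa <= y * score f x).

Definition svm_solution d n (tau : R) (D : n.-tuple (d.-tuple R * R))
    (f : d.-tuple R * R) (kappa : R) : Prop :=
  svm_feasible tau D f kappa /\
  forall f' kappa', svm_feasible tau D f' kappa' -> kappa' <= kappa.

Definition two_class d n (D : n.-tuple (d.-tuple R * R)) : Prop :=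
  (exists i, (tnth D i).2 = 1) /\ (exists i, (tnth D i).2 = -1).

(* Nothing is required on one-class samples. If the maximizer is not unique,
   any choice is allowed. *)
Definition is_svm d n (tau : R)
    (train : n.-tuple (d.-tuple R * R) -> d.-tuple R * R) : Prop :=
  forall D, two_class D -> exists kappa, svm_solution tau D (train D) kappa.

End SVM.

Section Errors.
Context d (T : measurableType d) {R : realType} (P : probability T R).
Context (p : nat) (f test : T -> p.-tuple R * R).

Definition err_pos : R :=
  cond_prob P [set w | score (f w) (test w).1 <= 0] [set w | (test w).2 = 1].

Definition err_neg : R :=
  cond_prob P [set w | 0 < score (f w) (test w).1] [set w | (test w).2 = -1].

Definition err_bal : R := 2^-1 * err_pos + 2^-1 * err_neg.

End Errors.

(* Main.v *)
(* Write the noise of point i as z_i, let p and q be the mean noise of the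
   minority and of the majority class, rho = (d / (n pi))^(1/2), and let
   delta = d^eps be a slack absorbing all deviations. On an event of
   probability 1 - o(1) one has |p| ~ rho, |q| = O(delta d^(-c/2)) = o(1),
   <z_i, p> = d/n_+ + O(delta^2 rho) for minority points, and
   <z_i, p> = O(delta rho) for majority points.

   Averaging the margin constraints over each class gives
     <mu,beta> + beta0 >= tau kappa - <p,beta>  and
     <mu,beta> - beta0 >= kappa + <q,beta>,
   and, since given x the score is y<mu,beta> + beta0 + <z,beta> with
   |beta| <= 1, Chebyshev's inequality reduces the test errors to bounds on
   <mu,beta> +- beta0.

   High signal: testing optimality against mu/|mu| gives
   (1 + tau) kappa >= 2|mu| - 2 delta, which dominates |p| and |q|.

   Otherwise |mu| = o(rho) and optimality is tested against w/|w| with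
   w = 2 mu + p: all margins agree up to O(delta^2), so
   (1 + tau) kappa = |w| up to that error, and as (1 + tau) kappa is at most
   <w,beta> + o(1), beta is within O(delta rho^(-1/2)) of w/|w|. Hence
   <mu,beta> ~ 2|mu|^2/|w|, of order |mu|^2/rho, which diverges exactly in the
   moderate regime; the size of tau then decides the sign of the scores.

   Low signal: <mu,beta> = o(1), and the errors could only be unbalanced if
   <z,beta> had mass near -beta0. It has none, because p/|w|, the main part of
   beta, has small coordinates, so that the characteristic function of
   <z,p>/|w| decays. *)

Require Import Defs.
From HB Require Import structures.
From mathcomp Require Import all_boot all_order all_algebra.
From mathcomp Require Import all_classical all_reals all_analysis.
From mathcomp Require Import measurable_realfun ring lra.

Set Implicit Arguments.
Unset Strict Implicit.
Unset Printing Implicit Defensive.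

Import Order.TTheory GRing.Theory Num.Theory.
Import numFieldNormedType.Exports.

Local Open Scope classical_set_scope.
Local Open Scope ring_scope.

(** * Independence *)

(** Two dependences shape the proof. The mean [p] contains the very noise it is tested against:
    splitting off the diagonal term [dot (z i) (z i)], of size [d], leaves a sum that is independent
    of [z i]. The trained direction depends on all the data but not on the test point, so every
    error is estimated for one frozen data set outside a bad event. The size of [tau] does not
    influence the direction. The intercept can balance any two class margins, hence optimality
    speaks of [(1 + tau) * kap] only, and this quantity alone pins [beta] near [w/|w|]. For the same
    reason the small-ball estimate has to hold around an arbitrary centre. That estimate must come
    from the number of coordinates: the noise need not have a density, and [mu] may sit on a single
    coordinate, so only the part of [beta] along [p] is used. Exponential tails serve the union
    bounds over points and coordinates; moments suffice for the counts, the class sums and the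
    norms. At the level [d^eps] an exponential tail already beats every power of [d], so no Gaussian
    tail is sought. *)

Section Independence.
Context d (T : measurableType d) (R : realType) (P : probability T R).
Context d1 d2 (T1 : measurableType d1) (T2 : measurableType d2).
Variables (X : T -> T1) (Y : T -> T2).
Hypotheses (mX : measurable_fun [set: T] X) (mY : measurable_fun [set: T] Y).
Hypothesis XY : independent P X Y.

Let X' : {mfun T >-> T1} := HB.pack X (isMeasurableFun.Build _ _ _ _ X mX).
Let Y' : {mfun T >-> T2} := HB.pack Y (isMeasurableFun.Build _ _ _ _ Y mY).
Let mZ : measurable_fun [set: T] (fun w => (X w, Y w)).
Proof. exact: measurable_fun_pair. Qed.
Let Z : {mfun T >-> (T1 * T2)%type} :=
  HB.pack (fun w => (X w, Y w)) (isMeasurableFun.Build _ _ _ _ _ mZ).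
Let m1 : probability T1 R := distribution P X'.
Let m2 : probability T2 R := distribution P Y'.

Lemma independent_lawE (S : set (T1 * T2)) : measurable S -> (m1 \x m2)%E S = distribution P Z S.
Proof.
by move=> mS; exact: product_measure_unique.
Qed.

Lemma independent_xsection (S : set (T1 * T2)) : measurable S ->
  P [set w | S (X w, Y w)] = (\int[P]_w P (Y @^-1` xsection S (X w)))%E.
Proof.
move=> mS; transitivity ((m1 \x m2)%E S); first by rewrite independent_lawE.
apply: (@ge0_integral_distribution _ _ _ _ _ P X' (m2 \o xsection S)) => //.
exact: measurable_fun_xsection.
Qed.

(** Fubini on the product law. In this form independence lets a data-dependent vector be treated as
    a constant: the bound is proved for each frozen value of [X]. *)
Lemma independent_le (S : set (T1 * T2)) (e : \bar R) : measurable S ->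
  (forall x, (P (Y @^-1` xsection S x) <= e)%E) ->
  (P [set w | S (X w, Y w)] <= e)%E.
Proof.
move=> mS Se; rewrite independent_xsection//.
have -> : e = (\int[P]_w e)%E by rewrite integral_cst//= probability_setT mule1.
apply: ge0_le_integral => //.
- rewrite (_ : (fun x => _) = (m2 \o xsection S) \o X)//.
  by apply: measurableT_comp => //; exact: measurable_fun_xsection.
Qed.

Lemma independent_integral (f : T1 -> R) (g : T2 -> R) :
  measurable_fun setT f -> measurable_fun setT g ->
  P.-integrable setT (EFin \o (f \o X)) ->
  P.-integrable setT (EFin \o (g \o Y)) ->
  P.-integrable setT (fun w => (f (X w) * g (Y w))%:E) /\
  (\int[P]_w (f (X w) * g (Y w))%:E =
   (\int[P]_w (f (X w))%:E) * (\int[P]_w (g (Y w))%:E))%E.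
Proof.
move=> mf mg if_ ig_.
have mf' : measurable_fun setT (EFin \o f) by exact/measurable_EFinP.
have mg' : measurable_fun setT (EFin \o g) by exact/measurable_EFinP.
have if1 : m1.-integrable setT (EFin \o f).
  apply/integrableP; split => //.
  have /integrableP[_] := if_.
  by rewrite -(@ge0_integral_distribution _ _ _ _ _ P X' (fun x => `|(f x)%:E|%E))//;
    exact: measurableT_comp.
have ig1 : m2.-integrable setT (EFin \o g).
  apply/integrableP; split => //.
  have /integrableP[_] := ig_.
  by rewrite -(@ge0_integral_distribution _ _ _ _ _ P Y' (fun x => `|(g x)%:E|%E))//;
    exact: measurableT_comp.
pose h := fun z : T1 * T2 => (f z.1 * g z.2)%:E.
have mh : measurable_fun setT h.
  apply/measurable_EFinP; apply: measurable_funM.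
    exact: (measurableT_comp mf).
  exact: (measurableT_comp mg).
have ih : (m1 \x m2)%E.-integrable setT h.
  apply/integrable12ltyP => //.
  pose c := (\int[m2]_y `|(g y)%:E|)%E.
  rewrite (_ : (\int[m1]_x _)%E = (\int[m1]_x (`|(f x)%:E| * c))%E); last first.
    apply: eq_integral => x _; rewrite /c -ge0_integralZl//=; last first.
      by apply/measurable_EFinP; exact: measurableT_comp.
    by apply: eq_integral => y _; rewrite /h /= normrM EFinM.
  rewrite ge0_integralZr//=; last 2 first.
  - by apply/measurable_EFinP; exact: measurableT_comp.
  - exact: integral_ge0.
  apply: lte_mul_pinfty => //; first exact: integral_ge0.
  - rewrite ge0_fin_numE ?integral_ge0//.
    by have /integrableP[_] := if1.
  - by have /integrableP[_] := ig1.
have ihZ : (distribution P Z).-integrable setT h.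
  apply/integrableP; split => //.
  have /integrableP[_] := ih.
  rewrite (eq_measure_integral (distribution P Z))// => A mA _.
  exact: independent_lawE.
have ihP : P.-integrable setT (h \o Z).
  apply/integrableP; split.
    exact: (measurableT_comp mh mZ).
  have /integrableP[_] := ihZ.
  rewrite (@ge0_integral_distribution _ _ _ _ _ P Z)//.
  exact: measurableT_comp.
split=> //.
have -> : (\int[P]_w (f (X w) * g (Y w))%:E = \int[distribution P Z]_z h z)%E.
  by rewrite (@integral_distribution _ _ _ _ _ P Z).
rewrite (eq_measure_integral (m1 \x m2)%E); last first.
  by move=> A mA _; apply/esym; exact: independent_lawE.
rewrite -(integral12_prod_meas1 ih).
pose c := fine (\int[m2]_y (g y)%:E)%E.
have cE : (\int[m2]_y (g y)%:E)%E = c%:E by rewrite fineK//; exact: integrable_fin_num.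
have -> : (\int[m1]_x fubini_F m2 h x = \int[m1]_x ((f x)%:E * c%:E))%E.
  by apply: eq_integral => x _; rewrite -cE -integralZl.
rewrite integralZr//= -cE.
rewrite (@integral_distribution _ _ _ _ _ P X' (EFin \o f))//.
by rewrite (@integral_distribution _ _ _ _ _ P Y' (EFin \o g)).
Qed.

End Independence.

Section LeaveOneOut.
Context d (T : measurableType d) (R : realType) (P : probability T R).
Context d' (T' : measurableType d') (n : nat).
Variable X : 'I_n -> T -> T'.
Hypotheses (mX : forall i, measurable_fun [set: T] (X i)).
Hypothesis indX : mutually_independent P X.

(** Point [i] is overwritten by a constant instead of being deleted, so that the remaining points
    keep their indices and their type. *)
Definition replace (i : 'I_n) (x0 : T') (t : n.-tuple T') : n.-tuple T' :=
  [tuple if j == i then x0 else tnth t j | j < n].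

Lemma measurable_replace i x0 : measurable_fun [set: n.-tuple T'] (replace i x0).
Proof.
apply/measurable_fun_tnthP => j /=.
rewrite (_ : _ \o _ = fun t : n.-tuple T' => if j == i then x0 else tnth t j).
  by case: (j == i) => //; exact: measurable_tnth.
by apply/funext => t /=; rewrite tnth_mktuple.
Qed.

Lemma measurable_mktuple : measurable_fun [set: T] (fun w => [tuple X j w | j < n]).
Proof.
apply/measurable_fun_tnthP => j /=.
rewrite (_ : _ \o _ = X j)//.
by apply/funext => t /=; rewrite tnth_mktuple.
Qed.

Let rect (A : 'I_n -> set T') : set (n.-tuple T') := [set t | forall j, A j (tnth t j)].

Let rectE A : rect A = \bigcap_(j in [set: 'I_n]) ((fun t => tnth t j) @^-1` A j).
Proof. by apply/seteqP; split => t /= h j => [_|]; exact: h. Qed.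

Let measurable_rect A : (forall j, measurable (A j)) -> measurable (rect A).
Proof.
move=> mA; rewrite rectE; apply: fin_bigcap_measurable => // j _.
by rewrite -[X in measurable X]setTI; exact: measurable_tnth.
Qed.

Let prob_capE (J : {set 'I_n}) (A : 'I_n -> set T') (S : set T) : (forall j, measurable (A j)) ->
  (forall w, S w <-> forall j, j \in J -> A j (X j w)) ->
  P S = (\prod_(j in J) P (X j @^-1` A j))%E.
Proof.
move=> mA SA; rewrite -indX//; congr (P _); apply/seteqP; split => w /=.
  by move=> /SA h j /=; apply: h.
by move=> h; apply/SA => j; exact: h.
Qed.

(** Two measures on tuples are compared: the law of the overwritten sample restricted to the event
    that [X i] lies in [B], and the full law scaled by the probability of that event. They agree on
    rectangles, a generating class closed under intersection. *)
Lemma leave_one_out (i : 'I_n) (x0 : T') :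
  independent P (fun w => replace i x0 [tuple X j w | j < n]) (X i).
Proof.
move=> A B mA mB.
set Z := fun w => _.
have mZ : measurable_fun setT Z.
  exact: (measurableT_comp (measurable_replace i x0) measurable_mktuple).
pose Z' : {mfun T >-> n.-tuple T'} := HB.pack Z (isMeasurableFun.Build _ _ _ _ Z mZ).
have mXB : measurable (X i @^-1` B) by rewrite -[X in measurable X]setTI; exact: mX.
pose c := fine (P (X i @^-1` B)).
have cE : P (X i @^-1` B) = c%:E by rewrite fineK// fin_num_measure.
have c0 : 0 <= c by rewrite fine_ge0.
pose m1 : {measure set (n.-tuple T') -> \bar R} :=
  measure_function_pushforward__canonical__measure_function_Measure (mrestr P mXB) mZ.
pose m2 : {measure set (n.-tuple T') -> \bar R} := mscale (NngNum c0) (distribution P Z').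
suff : m1 A = m2 A.
  rewrite /m1 /m2 /= /mrestr /mscale /= /pushforward /= => ->.
  by rewrite muleC cE.
pose G : set (set (n.-tuple T')) := [set rect C | C in [set C | forall j, measurable (C j)]].
apply: (@measure_unique _ _ _ G (fun=> setT)) => //.
- apply/seteqP; split.
    apply: smallest_sub; first exact: smallest_sigma_algebra.
    move=> S; rewrite -bigcup_seq => -[j _ /= [C mC <-]].
    apply: sub_sigma_algebra; exists (fun k => if k == j then C else setT).
      by move=> k /=; case: ifP.
    rewrite setTI; apply/seteqP; split=> t /=.
      by move=> /(_ j); rewrite eqxx.
    by move=> tC k; case: eqP => // ->.
  apply: smallest_sub; first exact: sigma_algebra_measurable.
  by move=> S [C mC <-]; exact: measurable_rect.
- move=> S S' [C mC <-] [C' mC' <-]; exists (fun j => C j `&` C' j).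
    by move=> j; exact: measurableI.
  by apply/seteqP; split => t /= => [h|[h h'] j]; [split=> j; have [] := h j|split].
- by move=> _; exists (fun=> setT) => //; apply/seteqP; split.
- by rewrite bigcup_const//; exists 0%N.
- move=> S [C mC <-]; rewrite /m1 /m2 /= /mrestr /mscale /= /pushforward /= -cE /distribution /pushforward /=.
  (* Coordinate [i] is the constant [x0]: it either empties the rectangle or imposes nothing. *)
  have [x0C|x0C] := pselect (C i x0); last first.
    have -> : Z @^-1` rect C = set0.
      apply/seteqP; split => w //= /(_ i).
      by rewrite !tnth_mktuple eqxx.
    by rewrite set0I !measure0 mule0.
  have ZE w : (Z @^-1` rect C) w <-> forall j, j \in (~: [set i])%SET -> C j (X j w).
    rewrite /Z /=; split=> [h j|h j].
      by rewrite !inE => /negbTE ji; have := h j; rewrite !tnth_mktuple ji.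
    rewrite !tnth_mktuple; case: eqP => [->//|/eqP ji].
    by apply: h; rewrite !inE.
  rewrite (prob_capE mC ZE).
  (* [B] takes the free slot [i], so that mutual independence applies to all coordinates at once. *)
  pose C' j := if j == i then B else C j.
  have mC' j : measurable (C' j) by rewrite /C'; case: ifP.
  rewrite (@prob_capE [set: 'I_n]%SET C')//; last first.
    move=> w; split=> [[/ZE h Bi] j _|h].
      rewrite /C'; case: eqP => [->//|/eqP ji]; apply: h.
      by rewrite !inE.
    split; last by have := h i; rewrite inE /C' eqxx; exact.
    apply/ZE => j; rewrite !inE => /negbTE ji.
    by have := h j; rewrite inE /C' ji; exact.
  rewrite (bigD1 i) ?inE//= {1}/C' eqxx; congr (_ * _)%E.
  apply: eq_big => [j|j]; first by rewrite !inE.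
  by rewrite /C' => /andP[_ /negbTE ->].
- move=> _; rewrite /m1 /= /pushforward /mrestr /= preimage_setT setTI.
  by rewrite cE ltry.
Qed.
End LeaveOneOut.

(** * Real-valued expectations and their transfer along laws *)

Section MeasurableSets.
Context d (T : measurableType d) (R : realType).
Implicit Types f g : T -> R.

Lemma measurable_bool_set (b : T -> bool) :
  measurable_fun setT b -> measurable [set w | b w].
Proof.
move=> mb; rewrite (_ : [set w | b w] = b @^-1` [set true]).
  by rewrite -[X in measurable X]setTI; exact: mb.
by apply/seteqP; split => w /=.
Qed.

Lemma measurable_le_set f g : measurable_fun setT f -> measurable_fun setT g ->
  measurable [set w | f w <= g w].
Proof. by move=> mf mg; apply: measurable_bool_set; exact: measurable_fun_ler. Qed.

Lemma measurable_lt_set f g : measurable_fun setT f -> measurable_fun setT g ->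
  measurable [set w | f w < g w].
Proof. by move=> mf mg; apply: measurable_bool_set; exact: measurable_fun_ltr. Qed.

Lemma measurable_eq_set f (k : R) : measurable_fun setT f -> measurable [set w | f w = k].
Proof.
move=> mf; rewrite (_ : [set w | f w = k] = f @^-1` [set k])//.
by rewrite -[X in measurable X]setTI; exact: mf.
Qed.

End MeasurableSets.

Section Expectation.
Context d (T : measurableType d) (R : realType) (P : probability T R).

Implicit Types f g : T -> R.

Definition L1 (f : T -> R) : Prop := P.-integrable setT (EFin \o f).

(** The value passes through [fine], so it is informative only next to [L1]; the moment lemmas
    therefore return both facts together. *)
Definition Ex (f : T -> R) : R := \int[P]_w f w.

Lemma L1_measurable f : L1 f -> measurable_fun setT f.
Proof. by move=> /measurable_int /measurable_EFinP. Qed.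

Lemma L1_integral f : L1 f -> (\int[P]_w (f w)%:E)%E = (Ex f)%:E.
Proof. by move=> f1; rewrite /Ex /Rintegral fineK//; exact: integrable_fin_num. Qed.

Lemma L1_cst k : L1 (fun=> k).
Proof. exact: finite_measure_integrable_cst. Qed.

Lemma Ex_cst k : Ex (fun=> k) = k.
Proof. by rewrite /Ex Rintegral_cst//= probability_setT mulr1. Qed.

Lemma L1D f g : L1 f -> L1 g -> L1 (fun w => f w + g w).
Proof. by move=> f1 g1; apply: eq_integrable (integrableD measurableT f1 g1). Qed.

Lemma ExD f g : L1 f -> L1 g -> Ex (fun w => f w + g w) = Ex f + Ex g.
Proof. by move=> f1 g1; rewrite /Ex RintegralD. Qed.

Lemma L1Z k f : L1 f -> L1 (fun w => k * f w).
Proof. by move=> f1; apply: eq_integrable (integrableZl measurableT k f1). Qed.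

Lemma ExZ k f : L1 f -> Ex (fun w => k * f w) = k * Ex f.
Proof. by move=> f1; rewrite /Ex RintegralZl. Qed.

Lemma eq_Ex f g : f =1 g -> Ex f = Ex g.
Proof. by move=> /funext ->. Qed.

Lemma eq_L1 f g : f =1 g -> L1 f -> L1 g.
Proof. by move=> /funext ->. Qed.

Lemma L1B f g : L1 f -> L1 g -> L1 (fun w => f w - g w).
Proof. by move=> f1 g1; apply: eq_integrable (integrableB measurableT f1 g1). Qed.

Lemma ExB f g : L1 f -> L1 g -> Ex (fun w => f w - g w) = Ex f - Ex g.
Proof. by move=> f1 g1; rewrite /Ex RintegralB. Qed.

Lemma L1_sum (I : Type) (s : seq I) (Q : pred I) (F : I -> T -> R) :
  (forall i, L1 (F i)) -> L1 (fun w => \sum_(i <- s | Q i) F i w).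
Proof.
move=> F1; elim: s => [|i s IH].
  by apply: eq_L1 (L1_cst 0) => w; rewrite big_nil.
case Qi : (Q i); last by apply: eq_L1 IH => w; rewrite big_cons Qi.
by apply: eq_L1 (L1D (F1 i) IH) => w; rewrite big_cons Qi.
Qed.

Lemma Ex_sum (I : Type) (s : seq I) (Q : pred I) (F : I -> T -> R) :
  (forall i, L1 (F i)) ->
  Ex (fun w => \sum_(i <- s | Q i) F i w) = \sum_(i <- s | Q i) Ex (F i).
Proof.
move=> F1; elim: s => [|i s IH].
  by rewrite big_nil -[RHS](Ex_cst 0); apply: eq_Ex => w; rewrite big_nil.
rewrite big_cons; case Qi : (Q i); rewrite -IH; last first.
  by apply: eq_Ex => w; rewrite big_cons Qi.
rewrite -ExD//; first by apply: eq_Ex => w; rewrite big_cons Qi.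
exact: L1_sum.
Qed.

Lemma L1_le f g : measurable_fun setT f -> (forall w, `|f w| <= g w) -> L1 g -> L1 f.
Proof.
move=> mf fg; apply: le_integrable => //; first exact/measurable_EFinP.
by move=> w _; rewrite lee_fin; apply: le_trans (fg w) (ler_norm _).
Qed.

Lemma L1_bounded f k : measurable_fun setT f -> (forall w, `|f w| <= k) -> L1 f.
Proof. by move=> mf fk; apply: L1_le mf fk (L1_cst k). Qed.

Lemma Ex_le f g : L1 f -> L1 g -> (forall w, f w <= g w) -> Ex f <= Ex g.
Proof. by move=> f1 g1 fg; apply: le_Rintegral. Qed.

Lemma Ex_ge0 f : (forall w, 0 <= f w) -> 0 <= Ex f.
Proof. by move=> f0; apply: Rintegral_ge0. Qed.

Lemma ge0_L1 f (k : R) : measurable_fun setT f -> (forall w, 0 <= f w) ->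
  (\int[P]_w (f w)%:E <= k%:E)%E -> L1 f /\ Ex f <= k.
Proof.
move=> mf f0 fk.
have f1 : L1 f.
  apply/integrableP; split; first exact/measurable_EFinP.
  rewrite (_ : (\int[P]_w _)%E = (\int[P]_w (f w)%:E)%E).
    by apply: le_lt_trans fk _; rewrite ltry.
  by apply: eq_integral => w _ /=; rewrite ger0_norm.
by split=> //; rewrite -lee_fin -L1_integral.
Qed.

Lemma Ex_indic A : measurable A -> P A = (Ex \1_A)%:E.
Proof.
by move=> mA; rewrite -L1_integral ?integral_indic ?setIT//; exact: integrable_indic.
Qed.

Lemma L1_indic A : measurable A -> L1 \1_A.
Proof. by move=> mA; exact: integrable_indic. Qed.

Lemma prob_finite A : measurable A -> P A = (fine (P A))%:E.
Proof. by move=> mA; rewrite fineK// fin_num_measure. Qed.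

Lemma prob_le A (f : T -> R) : measurable A -> L1 f -> (forall w, 0 <= f w) ->
  (forall w, A w -> 1 <= f w) -> (P A <= (Ex f)%:E)%E.
Proof.
move=> mA f1 f0 fA; rewrite Ex_indic// lee_fin; apply: Ex_le => //.
  exact: L1_indic.
by move=> w; rewrite indicE; case: (boolP (w \in A)) => [/set_mem /fA|].
Qed.

Lemma markov_ge f t : L1 f -> (forall w, 0 <= f w) -> 0 < t ->
  (P [set w | (t <= f w)%R] <= (Ex f / t)%:E)%E.
Proof.
move=> f1 f0 t0; rewrite mulrC -ExZ//; apply: prob_le.
- by apply: measurable_le_set => //; exact: L1_measurable.
- exact: L1Z.
- by move=> w; rewrite mulr_ge0// invr_ge0 ltW.
- by move=> w /= tf; rewrite mulrC ler_pdivlMr// mul1r.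
Qed.

End Expectation.

Section Transfer.
Context d (T : measurableType d) (R : realType) (P : probability T R).
Context d' (T' : measurableType d') (X : T -> T') (Q : probability T' R).
Hypotheses (mX : measurable_fun setT X) (XQ : has_law P X Q).

Let X' : {mfun T >-> T'} := HB.pack X (isMeasurableFun.Build _ _ _ _ X mX).

Lemma has_law_ge0_integral (f : T' -> \bar R) : measurable_fun setT f -> (forall x, 0 <= f x)%E ->
  (\int[P]_w f (X w) = \int[Q]_x f x)%E.
Proof.
move=> mf f0; rewrite -(@ge0_integral_distribution _ _ _ _ _ P X' f)//.
by apply: eq_measure_integral => A mA _; exact: XQ.
Qed.

Lemma has_law_L1 (f : T' -> R) : L1 Q f -> L1 P (f \o X).
Proof.
move=> f1; have mf := L1_measurable f1; apply/integrableP; split.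
  by apply/measurable_EFinP; exact: measurableT_comp.
rewrite (@has_law_ge0_integral (fun x => `|(f x)%:E|%E))//.
  by have /integrableP[] := f1.
by apply/measurable_EFinP; exact: measurableT_comp.
Qed.

Lemma has_law_Ex (f : T' -> R) : L1 Q f -> Ex P (f \o X) = Ex Q f.
Proof.
move=> f1; have mf := L1_measurable f1.
rewrite /Ex /Rintegral; congr fine.
rewrite -(@integral_distribution _ _ _ _ _ P X' (EFin \o f))//.
- by apply: eq_measure_integral => A mA _; exact: XQ.
- exact/measurable_EFinP.
- exact: has_law_L1.
Qed.

End Transfer.

Section Uncorrelated.
Context d (T : measurableType d) (R : realType) (P : probability T R).

Lemma indep_L1M d1 d2 (T1 : measurableType d1) (T2 : measurableType d2)
    (X : T -> T1) (Y : T -> T2) (f : T1 -> R) (g : T2 -> R) :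
  measurable_fun setT X -> measurable_fun setT Y -> independent P X Y ->
  measurable_fun setT f -> measurable_fun setT g ->
  L1 P (f \o X) -> L1 P (g \o Y) ->
  L1 P (fun w => f (X w) * g (Y w)) /\
  Ex P (fun w => f (X w) * g (Y w)) = Ex P (f \o X) * Ex P (g \o Y).
Proof.
move=> mX mY XY mf mg f1 g1.
have [fg1 fgE] := independent_integral mX mY XY mf mg f1 g1.
split=> //; rewrite /Ex /Rintegral fgE fineM//; exact: integrable_fin_num.
Qed.

Lemma Ex_sqr_sum (I : finType) (Y : I -> T -> R) :
  (forall i, L1 P (fun w => Y i w ^+ 2)) ->
  (forall i j, i != j -> L1 P (fun w => Y i w * Y j w)) ->
  (forall i j, i != j -> Ex P (fun w => Y i w * Y j w) = 0) ->
  L1 P (fun w => (\sum_i Y i w) ^+ 2) /\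
  Ex P (fun w => (\sum_i Y i w) ^+ 2) = \sum_i Ex P (fun w => Y i w ^+ 2).
Proof.
move=> Y2 YY1 YY0.
have YYL i j : L1 P (fun w => Y i w * Y j w).
  by have [->|] := eqVneq i j; [apply: eq_L1 (Y2 j) => w; rewrite expr2|exact: YY1].
have E w : (\sum_i Y i w) ^+ 2 = \sum_i \sum_j Y i w * Y j w.
  by rewrite expr2 mulr_suml; apply: eq_bigr => i _; rewrite mulr_sumr.
split.
  have : L1 P (fun w => \sum_i \sum_j Y i w * Y j w).
    by apply: L1_sum => i; exact: L1_sum.
  by apply: eq_L1 => w; rewrite E.
rewrite (eq_Ex _ E) Ex_sum; last by move=> i; exact: L1_sum.
apply: eq_bigr => i _; rewrite Ex_sum// (bigD1 i)//= big1 ?addr0.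
  by apply: eq_Ex => w; rewrite expr2.
by move=> j ji; apply: YY0; rewrite eq_sym.
Qed.

End Uncorrelated.

(** * Subgaussian linear forms *)

Section ExpBounds.
Context {R : realType}.
Implicit Types x y s : R.

(** Convexity between [0] and [y]. The tangent at [s * y] is evaluated at [y] and at [0]; with
    weights [s] and [1 - s] the linear terms cancel. *)
Lemma expR_convex01 s y : 0 <= s -> s <= 1 -> expR (s * y) <= 1 + s * (expR y - 1).
Proof.
move=> s0 s1.
have e0 := expR_gt0 (s * y).
have h1 : expR (s * y) * (1 + (1 - s) * y) <= expR y.
  have -> : expR y = expR (s * y) * expR ((1 - s) * y).
    by rewrite -expRD; congr expR; ring.
  by rewrite ler_pM2l// expR_ge1Dx.
have h2 : expR (s * y) * (1 - s * y) <= 1.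
  have h : expR (s * y) * expR (- (s * y)) = 1 by rewrite -expRD subrr expR0.
  by rewrite -[leRHS]h ler_pM2l// expR_ge1Dx.
have h3 := ler_wpM2l s0 h1.
have h4 : (1 - s) * (expR (s * y) * (1 - s * y)) <= (1 - s) * 1.
  by apply: ler_wpM2l => //; rewrite subr_ge0.
nra.
Qed.

(** Splits off a term that vanishes in expectation for centred variables and leaves a square
    exponential, which the psi_2 norm controls. The factor 4 gives two easy cases: [x <= 4 * x ^+ 2]
    beyond 1/4, and [1 / (1 - x) <= 1 + x + 4 * x ^+ 2] below. *)
Lemma expR_le_id_sqr x : expR x <= x + expR (4 * x ^+ 2).
Proof.
have [x4|x4] := leP x 4^-1; last first.
  apply: (@le_trans _ _ (expR (4 * x ^+ 2))).
    by rewrite ler_expR; nra.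
  by rewrite lerDr; lra.
have h1 := expR_ge1Dx (4 * x ^+ 2).
have h2 := expR_ge1Dx (- x).
have h3 : expR x * expR (- x) = 1 by rewrite -expRD subrr expR0.
have h4 := expR_gt0 x.
suff h6 : expR x <= 1 + x + 4 * x ^+ 2 by lra.
have h5 : expR x * (1 - x) <= 1 by rewrite -[leRHS]h3 ler_pM2l.
have x1 : 0 < 1 - x by lra.
rewrite -(ler_pM2r x1); apply: (le_trans h5).
by have := sqr_ge0 x; nra.
Qed.

Lemma sqr_le_expR x : x <= expR x.
Proof. by have := expR_ge1Dx x; lra. Qed.

Lemma sqr2_le_expR x : 0 <= x -> x ^+ 2 <= 4 * expR x.
Proof.
move=> x0; have h := expR_ge1Dx (x / 2).
have -> : expR x = expR (x / 2) ^+ 2.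
  by rewrite expr2 -expRD; congr expR; field.
nra.
Qed.

End ExpBounds.

Section Subgaussian.
Context d (T : measurableType d) (R : realType) (P : probability T R).

Lemma psi2_norm_exp_sqr (Z : T -> R) (C : R) : measurable_fun setT Z ->
  (psi2_norm P Z <= C%:E)%E ->
  L1 P (fun w => expR (Z w ^+ 2 / (`|C| + 1) ^+ 2)) /\
  Ex P (fun w => expR (Z w ^+ 2 / (`|C| + 1) ^+ 2)) <= 2.
Proof.
move=> mZ ZC.
have CK : C < `|C| + 1 by rewrite (le_lt_trans (ler_norm C))// ltrDl.
have : (psi2_norm P Z < (`|C| + 1)%:E)%E by rewrite (le_lt_trans ZC)// lte_fin.
move=> /ereal_inf_lt[_ [K [K0 KE] <-]]; rewrite lte_fin => KC.
apply: ge0_L1.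
- apply: measurableT_comp => //; apply: measurable_funM => //.
  exact: measurable_funX.
- by move=> w; exact: expR_ge0.
- move: KE; rewrite unlock => KE; apply: le_trans KE.
  apply: ge0_le_integral => //.
  + apply/measurable_EFinP; apply: measurableT_comp => //.
    by apply: measurable_funM => //; exact: measurable_funX.
  + apply/measurable_EFinP; apply: measurableT_comp => //.
    by apply: measurable_funM => //; exact: measurable_funX.
  + move=> w _; rewrite lee_fin ler_expR ler_wpM2l ?sqr_ge0//.
    rewrite lef_pV2 ?posrE ?exprn_gt0 ?(lt_trans K0 KC)//.
    by rewrite lerXn2r ?nnegrE ?ltW// (lt_trans K0 KC).
Qed.

Variables (Z : T -> R) (K : R).
Hypotheses (K0 : 0 < K) (mZ : measurable_fun setT Z).
Hypotheses (Z1 : L1 P (fun w => expR (Z w ^+ 2 / K ^+ 2))).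
Hypotheses (Z2 : Ex P (fun w => expR (Z w ^+ 2 / K ^+ 2)) <= 2).

Let E w := expR (Z w ^+ 2 / K ^+ 2).

Let Z2E w : Z w ^+ 2 <= K ^+ 2 * E w.
Proof.
rewrite -ler_pdivrMl ?exprn_gt0// mulrC.
exact: sqr_le_expR.
Qed.

Let Z4E w : Z w ^+ 4 <= (4 * K ^+ 4) * E w.
Proof.
have := @sqr2_le_expR R (Z w ^+ 2 / K ^+ 2); rewrite divr_ge0 ?sqr_ge0// => /(_ isT).
rewrite expr_div_n -!exprM ler_pdivrMr ?exprn_gt0// => /le_trans; apply.
by rewrite mulrAC.
Qed.

Lemma subgaussian_L1_sqr : L1 P (fun w => Z w ^+ 2).
Proof.
apply: L1_le (L1Z (K ^+ 2) Z1); first exact: measurable_funX.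
by move=> w; rewrite ger0_norm ?sqr_ge0//; exact: Z2E.
Qed.

Lemma subgaussian_L1_pow4 : L1 P (fun w => Z w ^+ 4).
Proof.
apply: L1_le (L1Z (4 * K ^+ 4) Z1); first exact: measurable_funX.
by move=> w; rewrite ger0_norm ?Z4E// (_ : 4 = 2 * 2)%N// exprM sqr_ge0.
Qed.

Lemma subgaussian_Ex_pow4 : Ex P (fun w => Z w ^+ 4) <= 8 * K ^+ 4.
Proof.
apply: (@le_trans _ _ (Ex P (fun w => (4 * K ^+ 4) * E w))).
  by apply: Ex_le => //; [exact: subgaussian_L1_pow4|exact: L1Z].
rewrite ExZ//; have := exprn_ge0 4 (ltW K0); rewrite -/(E _) => k4.
have : (4 * K ^+ 4) * Ex P E <= (4 * K ^+ 4) * 2.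
  by apply: ler_wpM2l => //; rewrite mulr_ge0.
by move=> /le_trans; apply; lra.
Qed.

Lemma subgaussian_L1 : L1 P Z.
Proof.
apply: L1_le (L1D (L1_cst P 1) subgaussian_L1_sqr) => // w.
by rewrite ler_norml; apply/andP; split; nra.
Qed.

(** By [expR_le_id_sqr] the linear term integrates to 0 and [expR (s * (Z ^+ 2 / K ^+ 2))] remains,
    with [s = (2 * l * K) ^+ 2]. As [s <= 1], convexity bounds its mean by [1 + s], hence by
    [expR s]. *)
Lemma subgaussian_mgf (l : R) : Ex P Z = 0 -> (2 * l * K) ^+ 2 <= 1 ->
  L1 P (fun w => expR (l * Z w)) /\
  Ex P (fun w => expR (l * Z w)) <= expR ((2 * l * K) ^+ 2).
Proof.
move=> Z0; set s := _ ^+ 2 => s1.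
have s0 : 0 <= s by exact: sqr_ge0.
pose g w := l * Z w + (1 + s * (E w - 1)).
have g1 : L1 P g.
  apply: L1D; first by apply: L1Z; exact: subgaussian_L1.
  apply: L1D; first exact: L1_cst.
  by apply: L1Z; apply: L1B => //; exact: L1_cst.
have fg w : expR (l * Z w) <= g w.
  apply: (le_trans (expR_le_id_sqr _)); rewrite /g lerD2l.
  rewrite (_ : 4 * _ = s * (Z w ^+ 2 / K ^+ 2)); last first.
    by rewrite /s; field; rewrite gt_eqF.
  exact: expR_convex01.
have f1 : L1 P (fun w => expR (l * Z w)).
  apply: L1_le g1 => [|w]; last by rewrite ger0_norm ?expR_ge0.
  by apply: measurableT_comp => //; exact: measurable_funM.
split=> //; apply: (le_trans (Ex_le f1 g1 fg)).
have e1 : L1 P (fun w => s * (E w - 1)).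
  by apply: L1Z; apply: L1B => //; exact: L1_cst.
rewrite /g ExD//; last 2 first.
- by apply: L1Z; exact: subgaussian_L1.
- by apply: L1D => //; exact: L1_cst.
rewrite ExZ; last exact: subgaussian_L1.
rewrite Z0 mulr0 add0r ExD//; last exact: L1_cst.
rewrite Ex_cst ExZ; last by apply: L1B => //; exact: L1_cst.
rewrite ExB//; last exact: L1_cst.
rewrite Ex_cst.
apply: le_trans (expR_ge1Dx s); rewrite lerD2l -[leRHS]mulr1 ler_wpM2l//.
by rewrite lerBlDr; exact: Z2.
Qed.

End Subgaussian.

Section IndependentComp.
Context d (T : measurableType d) (R : realType) (P : probability T R).

Lemma independent_comp d1 d2 d3 d4 (T1 : measurableType d1) (T2 : measurableType d2)
    (T3 : measurableType d3) (T4 : measurableType d4)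
    (X : T -> T1) (Y : T -> T2) (f : T1 -> T3) (g : T2 -> T4) :
  measurable_fun setT f -> measurable_fun setT g ->
  independent P X Y -> independent P (f \o X) (g \o Y).
Proof.
move=> mf mg XY A B mA mB; apply: (XY (f @^-1` A) (g @^-1` B)).
- by rewrite -[X in measurable X]setTI; exact: mf.
- by rewrite -[X in measurable X]setTI; exact: mg.
Qed.

End IndependentComp.

Lemma measurable_sum_cond d (T : measurableType d) (R : realType) (I : Type)
    (s : seq I) (Q : pred I) (F : I -> T -> R) :
  (forall i, measurable_fun setT (F i)) ->
  measurable_fun setT (fun w => \sum_(i <- s | Q i) F i w).
Proof.
move=> mF; under eq_fun do rewrite big_mkcond.
by apply: measurable_sum => i; case: (Q i).
Qed.

Section IndependentFamily.
Context d (T : measurableType d) (R : realType) (P : probability T R).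
Context d' (T' : measurableType d') (n : nat).
Variable X : 'I_n -> T -> T'.
Hypotheses (mX : forall i, measurable_fun [set: T] (X i)).
Hypothesis indX : mutually_independent P X.

Lemma independent_pair i j : i != j -> independent P (X i) (X j).
Proof.
move=> ij A B mA mB.
have -> : P (X i @^-1` A `&` X j @^-1` B) =
    P (\bigcap_(k in [set` [set i; j]%SET]) (X k @^-1` (if k == i then A else B))).
  congr (P _); apply/seteqP; split => w /=.
    move=> [XA XB] k /=; rewrite !inE => /orP[|] /eqP ->; first by rewrite eqxx.
    by rewrite eq_sym (negbTE ij).
  move=> h; split; first by have := h i; rewrite /= !inE eqxx; exact.
  by have := h j; rewrite /= !inE eqxx orbT eq_sym (negbTE ij); exact.
rewrite indX; last by move=> k; case: ifP.
rewrite (bigD1 i) ?inE ?eqxx//= (big_pred1 j) ?eqxx//=.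
  by rewrite eq_sym (negbTE ij).
move=> k /=; rewrite !inE; have [->|ki] := eqVneq k i; last by rewrite andbT.
by rewrite /= (negbTE ij).
Qed.

(** The prefix never reads coordinate [i], so it is a function of the sample with that coordinate
    overwritten. *)
Lemma independent_prefix (f : 'I_n -> T' -> R) (i : 'I_n) :
  (forall j, measurable_fun setT (f j)) ->
  independent P (fun w => \sum_(j < n | (j < i)%N) f j (X j w)) (X i).
Proof.
move=> mf.
have [x0 _] : [set: T'] !=set0 by exists point.
pose g (t : n.-tuple T') := \sum_(j < n | (j < i)%N) f j (tnth t j).
have -> : (fun w => \sum_(j < n | (j < i)%N) f j (X j w)) =
          g \o (fun w => replace i x0 [tuple X j w | j < n]).
  apply/funext => w /=; apply: eq_bigr => j ji.
  by rewrite !tnth_mktuple; case: eqP ji => // ->; rewrite ltnn.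
apply: (@independent_comp _ _ _ _ _ _ _ _ _ _ _ _ _ _ g (fun x => x)) => //.
  apply: measurable_sum_cond => j.
  by apply: measurableT_comp => //; exact: measurable_tnth.
exact: leave_one_out.
Qed.

End IndependentFamily.

(** Prefixes are filtered sums over the whole of ['I_n]; an induction on their length then leaves
    the index type alone. *)
Lemma prefix_sum_recr (R : nmodType) (n : nat) (F : 'I_n -> R) (i : 'I_n) :
  \sum_(j < n | (j < i.+1)%N) F j = \sum_(j < n | (j < i)%N) F j + F i.
Proof.
rewrite (bigD1 i)//= addrC; congr (_ + _); apply: eq_bigl => j.
by rewrite ltnS ltn_neqAle andbC.
Qed.

Section LinearForms.
Context d (T : measurableType d) (R : realType) (P : probability T R) (n : nat).
Variables (X : 'I_n -> T -> R) (K : R).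
Hypotheses (mX : forall i, measurable_fun [set: T] (X i)).
Hypothesis indX : mutually_independent P X.
Hypothesis K0 : 0 < K.
Hypothesis X1 : forall i, L1 P (fun w => expR (X i w ^+ 2 / K ^+ 2)).
Hypothesis X2 : forall i, Ex P (fun w => expR (X i w ^+ 2 / K ^+ 2)) <= 2.
Hypothesis EX : forall i, Ex P (X i) = 0.
Hypothesis VX : forall i, Ex P (fun w => X i w ^+ 2) = 1.

Let XL i : L1 P (X i).
Proof. exact: (subgaussian_L1 K0 (mX i) (X1 i)). Qed.

Let X2L i : L1 P (fun w => X i w ^+ 2).
Proof. exact: (subgaussian_L1_sqr K0 (mX i) (X1 i)). Qed.

Let X4L i : L1 P (fun w => X i w ^+ 4).
Proof. exact: (subgaussian_L1_pow4 K0 (mX i) (X1 i)). Qed.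

Lemma Ex_linear_sqr (u : 'I_n -> R) :
  L1 P (fun w => (\sum_i u i * X i w) ^+ 2) /\
  Ex P (fun w => (\sum_i u i * X i w) ^+ 2) = \sum_i u i ^+ 2.
Proof.
have h i j : i != j -> L1 P (fun w => (u i * X i w) * (u j * X j w)) /\
     Ex P (fun w => (u i * X i w) * (u j * X j w)) = 0.
  move=> ij; have := @indep_L1M _ _ _ _ _ _ _ _ (X i) (X j) ( *%R (u i)) ( *%R (u j)) (mX i) (mX j)
    (independent_pair indX ij).
  case; [exact: measurable_funM|exact: measurable_funM|exact: L1Z|exact: L1Z|].
  by move=> ? ->; split=> //=; rewrite ExZ// EX mulr0 mul0r.
have [| | |h1 h2] := @Ex_sqr_sum _ _ _ P _ (fun i w => u i * X i w).
- by move=> i; apply: eq_L1 (L1Z (u i ^+ 2) (X2L i)) => w; rewrite exprMn.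
- by move=> i j /h[].
- by move=> i j /h[].
split=> //; rewrite h2; apply: eq_bigr => i _.
rewrite -[RHS]mulr1 -(VX i) -ExZ//; apply: eq_Ex => w; exact: exprMn.
Qed.

(** The variables [X i ^+ 2 - 1] are centred and pairwise independent, and each has variance at most
    the fourth moment of [X i]. *)
Lemma Ex_norm_sqr_dev :
  L1 P (fun w => (\sum_i X i w ^+ 2 - n%:R) ^+ 2) /\
  Ex P (fun w => (\sum_i X i w ^+ 2 - n%:R) ^+ 2) <= 8 * K ^+ 4 * n%:R.
Proof.
pose f (x : R) := x ^+ 2 - 1.
have mf : measurable_fun setT f.
  by apply: measurable_funB => //; exact: measurable_funX.
have fL i : L1 P (f \o X i) by apply: L1B => //; exact: L1_cst.
have f0 i : Ex P (f \o X i) = 0.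
  by rewrite /f /comp ExB ?VX ?Ex_cst ?subrr//; exact: L1_cst.
have h i j : i != j -> L1 P (fun w => f (X i w) * f (X j w)) /\
     Ex P (fun w => f (X i w) * f (X j w)) = 0.
  move=> ij; have [] := indep_L1M (mX i) (mX j) (independent_pair indX ij) mf mf (fL i) (fL j).
  by move=> ? ->; split=> //=; rewrite f0 mul0r.
have f2E i w : f (X i w) ^+ 2 = X i w ^+ 4 - 2 * X i w ^+ 2 + 1.
  by rewrite /f; ring.
have f2L i : L1 P (fun w => f (X i w) ^+ 2).
  suff : L1 P (fun w => X i w ^+ 4 - 2 * X i w ^+ 2 + 1).
    by apply: eq_L1 => w; rewrite f2E.
  by apply: L1D; [apply: L1B => //; exact: L1Z|exact: L1_cst].
have [//| | |h1 h2] := @Ex_sqr_sum _ _ _ P _ (fun i w => f (X i w)).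
- by move=> i j /h[].
- by move=> i j /h[].
have E w : \sum_i X i w ^+ 2 - n%:R = \sum_i f (X i w).
  by rewrite sumrB; congr (_ - _); rewrite sumr_const card_ord.
have -> : (fun w => (\sum_i X i w ^+ 2 - n%:R) ^+ 2) = (fun w => (\sum_i f (X i w)) ^+ 2).
  by apply/funext => w; rewrite E.
split=> //; rewrite h2.
apply: (@le_trans _ _ (\sum_(i < n) (8 * K ^+ 4))); last first.
  by rewrite sumr_const card_ord mulr_natr.
apply: ler_sum => i _; rewrite (eq_Ex _ (f2E i)) ExD; last 2 first.
- by apply: L1B => //; exact: L1Z.
- exact: L1_cst.
rewrite ExB//; last exact: L1Z.
rewrite ExZ// VX Ex_cst.
have := subgaussian_Ex_pow4 K0 (mX i) (X1 i) (X2 i).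
lra.
Qed.

Lemma linear_mgf (u : 'I_n -> R) (l : R) :
  (2 * l * K) ^+ 2 * \sum_i u i ^+ 2 <= 1 ->
  L1 P (fun w => expR (l * \sum_i u i * X i w)) /\
  Ex P (fun w => expR (l * \sum_i u i * X i w)) <= expR ((2 * l * K) ^+ 2 * \sum_i u i ^+ 2).
Proof.
move=> lu.
pose f i x := (l * u i) * x.
have mf i : measurable_fun setT (f i) by exact: measurable_funM.
(* The budget for the whole vector covers each coordinate, so the one-variable bound is available at
   every stage of the induction. *)
have lui i : (2 * (l * u i) * K) ^+ 2 <= 1.
  apply: le_trans lu; rewrite (_ : _ ^+ 2 = (2 * l * K) ^+ 2 * u i ^+ 2); last by ring.
  apply: ler_wpM2l; first exact: sqr_ge0.
  by rewrite (bigD1 i)//= lerDl sumr_ge0// => j _; exact: sqr_ge0.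
suff H (k : nat) : (k <= n)%N ->
  L1 P (fun w => expR (\sum_(j < n | (j < k)%N) f j (X j w))) /\
  Ex P (fun w => expR (\sum_(j < n | (j < k)%N) f j (X j w))) <=
    expR ((2 * l * K) ^+ 2 * \sum_(j < n | (j < k)%N) u j ^+ 2).
  have := H n (leqnn n).
  have -> : (fun w => expR (\sum_(j < n | (j < n)%N) f j (X j w))) =
            (fun w => expR (l * (\sum_i u i * X i w))).
    apply/funext => w; congr expR; rewrite mulr_sumr; apply: eq_big => j.
      by rewrite ltn_ord.
    by rewrite /f mulrA.
  by rewrite (eq_bigl _ _ (fun j => ltn_ord j)).
elim: k => [_|k IH kn].
  split.
    by apply: eq_L1 (L1_cst P 1) => w; rewrite big_pred0// expR0.
  rewrite [X in expR X](_ : _ = 0) ?expR0; last by rewrite big_pred0// mulr0.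
  by rewrite -[leRHS](Ex_cst P 1) le_eqVlt; apply/orP; left; apply/eqP/eq_Ex => w;
    rewrite big_pred0// expR0.
have [IH1 IH2] := IH (ltnW kn).
pose i := Ordinal kn.
have [mg1 mg2] := subgaussian_mgf K0 (mX i) (X1 i) (X2 i) (EX i) (lui i).
have ind := @independent_prefix _ _ _ _ _ _ _ _ mX indX f i mf.
have mS : measurable_fun setT (fun w => \sum_(j < n | (j < i)%N) f j (X j w)).
  by apply: measurable_sum_cond => j; exact: measurableT_comp.
have [] := @indep_L1M _ _ _ P _ _ _ _ _ _ expR (fun x => expR ((l * u i) * x)) mS (mX i) ind.
- exact: measurable_expR.
- by apply: measurableT_comp => //; exact: measurable_funM.
- exact: IH1.
- exact: mg1.
have -> : (fun w => expR (\sum_(j < n | (j < k.+1)%N) f j (X j w))) =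
  (fun w => expR (\sum_(j < n | (j < i)%N) f j (X j w)) * expR (l * u i * X i w)).
  by apply/funext => w; rewrite -expRD -(prefix_sum_recr _ i).
move=> L E; split=> //; rewrite E.
rewrite (prefix_sum_recr _ i) mulrDr expRD ler_pM//.
- by apply: Ex_ge0 => w; exact: expR_ge0.
- by apply: Ex_ge0 => w; exact: expR_ge0.
- apply: (le_trans mg2); rewrite ler_expR le_eqVlt; apply/orP; left; apply/eqP; ring.
Qed.

End LinearForms.

Section LinearTail.
Context d (T : measurableType d) (R : realType) (P : probability T R) (n : nat).
Variables (X : 'I_n -> T -> R) (K : R).
Hypotheses (mX : forall i, measurable_fun [set: T] (X i)).
Hypothesis indX : mutually_independent P X.
Hypothesis K0 : 0 < K.
Hypothesis X1 : forall i, L1 P (fun w => expR (X i w ^+ 2 / K ^+ 2)).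
Hypothesis X2 : forall i, Ex P (fun w => expR (X i w ^+ 2 / K ^+ 2)) <= 2.
Hypothesis EX : forall i, Ex P (X i) = 0.

(** Chernoff's method at a single exponent, the largest that [linear_mgf] admits; there the
    generating function is at most [expR 1], whence the additive 1 in the tail. *)
Let tail1 (u : 'I_n -> R) (t : R) : 0 < \sum_i u i ^+ 2 ->
  (P [set w | (t * Num.sqrt (\sum_i u i ^+ 2) <= \sum_i u i * X i w)%R] <=
   (expR (1 - t / (2 * K)))%:E)%E.
Proof.
move=> u0; set r := Num.sqrt _.
have r0 : 0 < r by rewrite sqrtr_gt0.
have r2 : \sum_i u i ^+ 2 = r ^+ 2 by rewrite sqr_sqrtr// ltW.
pose l := (2 * K * r)^-1.
have l0 : 0 < l by rewrite invr_gt0 !mulr_gt0.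
have lu : (2 * l * K) ^+ 2 * \sum_i u i ^+ 2 = 1.
  by rewrite r2 /l; field; rewrite !gt_eqF.
have [] := linear_mgf mX indX K0 X1 X2 EX (u := u) (l := l); first by rewrite lu.
rewrite lu => L1l El.
apply: (@le_trans _ _ (P [set w | (expR (t / (2 * K)) <= expR (l * \sum_i u i * X i w))%R])).
  apply: le_measure; rewrite ?inE.
  - apply: measurable_le_set => //; apply: measurable_sum_cond => i.
    exact: measurable_funM.
  - by apply: measurable_le_set => //; exact: L1_measurable L1l.
  - move=> w /= h; rewrite ler_expR (_ : t / (2 * K) = l * (t * r)); last first.
      by rewrite /l; field; rewrite !gt_eqF.
    by rewrite ler_pM2l.
apply: (le_trans (markov_ge L1l _ _)) => [w||]; rewrite ?expR_gt0 ?expR_ge0//.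
rewrite lee_fin -expRN expRD ler_pM2r ?expR_gt0//.
Qed.

Lemma linear_tail (u : 'I_n -> R) (t : R) :
  (P [set w | (t * Num.sqrt (\sum_i u i ^+ 2) < `|\sum_i u i * X i w|)%R] <=
   (2 * expR (1 - t / (2 * K)))%:E)%E.
Proof.
have mS (v : 'I_n -> R) : measurable_fun setT (fun w => \sum_i v i * X i w).
  by apply: measurable_sum_cond => i; exact: measurable_funM.
(* The strict inequality in the event makes it empty for the zero vector. *)
have [u0|] := eqVneq (\sum_i u i ^+ 2) 0.
  have u00 i : u i = 0.
    move: u0 => /eqP; rewrite psumr_eq0; last by move=> j _; exact: sqr_ge0.
    by move=> /allP /(_ i (mem_index_enum i)); rewrite sqrf_eq0 => /eqP.
  rewrite (_ : [set w | _] = set0) ?measure0 ?lee_fin ?mulr_ge0 ?expR_ge0//.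
  apply/seteqP; split => w //=; rewrite u0 sqrtr0 mulr0 big1 ?normr0 ?ltxx//.
  by move=> i _; rewrite u00 mul0r.
rewrite neq_lt ltNge sumr_ge0/=; last by move=> i _; exact: sqr_ge0.
move=> u0.
have uN : \sum_i (- u i) ^+ 2 = \sum_i u i ^+ 2 by apply: eq_bigr => i _; rewrite sqrrN.
have u0N : 0 < \sum_i (- u i) ^+ 2 by rewrite uN.
have A := tail1 t u0; have B := tail1 t u0N.
rewrite uN in B.
rewrite mulrDl mul1r EFinD; apply: le_trans (leeD A B).
apply: le_trans (measureU2 _ _ _); last 2 first.
- exact: measurable_le_set.
- exact: measurable_le_set.
apply: le_measure; rewrite ?inE.
- apply: measurable_lt_set => //; exact: measurableT_comp.
- by apply: measurableU; exact: measurable_le_set.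
- move=> w /= /ltW; rewrite ler_normr => /orP[|h]; [by left|right].
  apply: (le_trans h); rewrite -sumrN le_eqVlt; apply/orP; left; apply/eqP.
  by apply: eq_bigr => i _; rewrite mulNr.
Qed.

End LinearTail.

(** * Taylor bounds for sine and cosine *)

Section TrigBounds.
Context {R : realType}.
Implicit Types x y : R.

Let mean_value0 (f df : R -> R) x : (forall y, is_derive y (1 : R) f (df y)) ->
  exists2 c, `|c| <= `|x| & f x - f 0 = df c * x.
Proof.
move=> fdf.
have fc (a b : R) : {within `[a, b], continuous f}.
  by apply: derivable_within_continuous => y _; have [] := fdf y.
have [x0|x0] := leP 0 x.
  have [c] := MVT_segment x0 (fun y _ => fdf y) (fc 0 x).
  rewrite in_itv /= => /andP[c0 cx] ->; exists c; last by rewrite subr0.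
  by rewrite !ger0_norm.
have [c] := MVT_segment (ltW x0) (fun y _ => fdf y) (fc x 0).
rewrite in_itv /= => /andP[cx c0] E; exists c.
  by rewrite !ler0_norm ?lerN2// ltW.
by rewrite -opprB E sub0r mulrN opprK.
Qed.

Lemma norm_sin_le x : `|sin x| <= `|x|.
Proof.
have [c _] := mean_value0 x (fun y => is_derive_sin y).
rewrite sin0 subr0 => ->; rewrite normrM -[leRHS]mul1r ler_wpM2r//.
exact: cos_max.
Qed.

Lemma norm_cosB1_le x : `|cos x - 1| <= `|x|.
Proof.
have [c _] := mean_value0 x (fun y => is_derive_cos y).
rewrite cos0 => ->; rewrite normrM -[leRHS]mul1r ler_wpM2r// normrN.
exact: sin_max.
Qed.

Lemma norm_sinB_le x : `|sin x - x| <= x ^+ 2.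
Proof.
have D y : is_derive y (1 : R) (sin \- id) (cos y - 1) by exact: is_deriveB.
have [c cx] := mean_value0 x D.
rewrite /= sin0 !subr0 => ->; rewrite normrM -(real_normK (num_real x)) expr2.
by apply: ler_wpM2r => //; exact: le_trans (norm_cosB1_le c) cx.
Qed.

Lemma cos_ge x : 1 - x ^+ 2 / 2 <= cos x.
Proof.
have -> : cos x = 1 - 2 * sin (x / 2) ^+ 2.
  rewrite {1}(_ : x = x / 2 + x / 2); last by field.
  by rewrite cosD; have := cos2Dsin2 (x / 2); rewrite !expr2; lra.
have := norm_sin_le (x / 2); rewrite -ler_sqr ?nnegrE// !real_normK ?num_real//.
by rewrite expr_div_n; lra.
Qed.

(** The half-angle formula reduces this to [|sin y| >= |y| - y ^+ 2]. The quadratic coefficient is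
    exact because the decay of the characteristic function comes from it; the cubic remainder can be
    crude. *)
Lemma cos_le x : cos x <= 1 - x ^+ 2 / 2 + `|x| ^+ 3 / 2.
Proof.
have -> : cos x = 1 - 2 * sin (x / 2) ^+ 2.
  rewrite {1}(_ : x = x / 2 + x / 2); last by field.
  by rewrite cosD; have := cos2Dsin2 (x / 2); rewrite !expr2; lra.
set y := x / 2.
have -> : x = 2 * y by rewrite /y; field.
have h := norm_sinB_le y.
have y1 : `|y| - y ^+ 2 <= `|sin y|.
  by have := ler_normB (sin y) (sin y - y); rewrite subKr; lra.
rewrite normrM ger0_norm//.
have y0 := normr_ge0 y; have s0 := normr_ge0 (sin y).
have sE : sin y ^+ 2 = `|sin y| ^+ 2 by rewrite real_normK ?num_real.
have yE : y ^+ 2 = `|y| ^+ 2 by rewrite real_normK ?num_real.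
rewrite sE exprMn yE; rewrite yE in y1.
move: y0 s0 y1; set a := `|y|; set b := `|sin y| => a0 b0 ab.
suff : a ^+ 2 - 2 * a ^+ 3 <= b ^+ 2 by rewrite !exprS expr0; lra.
have [a1|a1] := leP a 1; last by nra.
have : (a - a ^+ 2) ^+ 2 <= b ^+ 2 by rewrite ler_sqr ?nnegrE//; nra.
apply: le_trans; rewrite !exprS expr0; nra.
Qed.

End TrigBounds.

(** * Anti-concentration *)

Section CharacteristicFunction.
Context d (T : measurableType d) (R : realType) (P : probability T R).

Definition mean_cos (S : T -> R) : R := Ex P (fun w => cos (S w)).
Definition mean_sin (S : T -> R) : R := Ex P (fun w => sin (S w)).
(* Squared modulus of the characteristic function of S at 1. *)
Definition cf_sqr (S : T -> R) : R := mean_cos S ^+ 2 + mean_sin S ^+ 2.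

Lemma measurable_cos_comp (S : T -> R) : measurable_fun setT S ->
  measurable_fun setT (fun w => cos (S w)).
Proof.
move=> mS; apply: (measurableT_comp (f := @cos R)) => //.
by apply: continuous_measurable_fun; exact: continuous_cos.
Qed.

Lemma measurable_sin_comp (S : T -> R) : measurable_fun setT S ->
  measurable_fun setT (fun w => sin (S w)).
Proof.
move=> mS; apply: (measurableT_comp (f := @sin R)) => //.
by apply: continuous_measurable_fun; exact: continuous_sin.
Qed.

Lemma L1_cos (S : T -> R) : measurable_fun setT S -> L1 P (fun w => cos (S w)).
Proof.
move=> mS; apply: (@L1_bounded _ _ _ _ _ 1) => [|w]; last exact: cos_max.
exact: measurable_cos_comp.
Qed.

Lemma L1_sin (S : T -> R) : measurable_fun setT S -> L1 P (fun w => sin (S w)).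
Proof.
move=> mS; apply: (@L1_bounded _ _ _ _ _ 1) => [|w]; last exact: sin_max.
exact: measurable_sin_comp.
Qed.

(** Multiplicativity of the characteristic function without complex numbers: independence factors
    the four mixed trigonometric moments, and the two-square identity recombines them. *)
Lemma cf_sqrD (S Z : T -> R) : measurable_fun setT S -> measurable_fun setT Z ->
  independent P S Z -> cf_sqr (fun w => S w + Z w) = cf_sqr S * cf_sqr Z.
Proof.
move=> mS mZ SZ.
have mc : measurable_fun setT (@cos R) by apply: continuous_measurable_fun; exact: continuous_cos.
have ms : measurable_fun setT (@sin R) by apply: continuous_measurable_fun; exact: continuous_sin.
have [cc1 cc2] := indep_L1M mS mZ SZ mc mc (L1_cos mS) (L1_cos mZ).
have [cs1 cs2] := indep_L1M mS mZ SZ mc ms (L1_cos mS) (L1_sin mZ).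
have [sc1 sc2] := indep_L1M mS mZ SZ ms mc (L1_sin mS) (L1_cos mZ).
have [ss1 ss2] := indep_L1M mS mZ SZ ms ms (L1_sin mS) (L1_sin mZ).
have -> : cf_sqr (fun w => S w + Z w) =
   (mean_cos S * mean_cos Z - mean_sin S * mean_sin Z) ^+ 2 + (mean_sin S * mean_cos Z + mean_cos S * mean_sin Z) ^+ 2.
  rewrite /cf_sqr; congr (_ ^+ 2 + _ ^+ 2).
    rewrite /mean_cos /mean_sin -cc2 -ss2 -ExB//.
    by apply: eq_Ex => w; rewrite cosD.
  rewrite /mean_cos /mean_sin -sc2 -cs2 -ExD//.
  by apply: eq_Ex => w; rewrite sinD.
by rewrite /cf_sqr; ring.
Qed.

(** The mean cosine is [1 - u^2/2] up to a cubic term, where [|Z|^3 <= Z^2 + Z^4]. The mean sine is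
    [O(u^2)] because [Z] is centred, so its square is of fourth order. For small [u] both errors
    together stay below [u^2/4]. *)
Lemma cf_sqr_small (Z : T -> R) (M4 u : R) : measurable_fun setT Z -> L1 P Z ->
  L1 P (fun w => Z w ^+ 2) -> L1 P (fun w => Z w ^+ 4) ->
  Ex P Z = 0 -> Ex P (fun w => Z w ^+ 2) = 1 -> Ex P (fun w => Z w ^+ 4) <= M4 ->
  `|u| * (8 * (1 + M4)) <= 1 ->
  cf_sqr (fun w => u * Z w) <= expR (- (u ^+ 2 / 4)).
Proof.
move=> mZ Z1 Z2 Z4 EZ EZ2 EZ4 u8.
have muZ : measurable_fun setT (fun w => u * Z w) by exact: measurable_funM.
have M0 : 0 <= M4.
  by apply: le_trans EZ4; apply: Ex_ge0 => w; rewrite (_ : 4 = 2 * 2)%N// exprM sqr_ge0.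
have u0 := normr_ge0 u.
have uE : u ^+ 2 = `|u| ^+ 2 by rewrite real_normK ?num_real.
have c1 : mean_cos (fun w => u * Z w) <= 1 - u ^+ 2 / 2 + `|u| ^+ 3 * (1 + M4) / 2.
  have h w : cos (u * Z w) <= 1 - u ^+ 2 / 2 * Z w ^+ 2 + `|u| ^+ 3 / 2 * (Z w ^+ 2 + Z w ^+ 4).
    apply: (le_trans (cos_le _)); rewrite exprMn normrM exprMn.
    have : `|Z w| ^+ 3 <= Z w ^+ 2 + Z w ^+ 4.
      rewrite -(real_normK (num_real (Z w))).
      rewrite (_ : Z w ^+ 4 = `|Z w| ^+ 4); last first.
        by rewrite (_ : 4 = 2 * 2)%N// !exprM real_normK ?num_real.
      have := normr_ge0 (Z w); set a := `|Z w| => a0.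
      have h : 0 <= a ^+ 2 * (a ^+ 2 - a + 1) by apply: mulr_ge0; nra.
      by lra.
    have u3 : 0 <= `|u| ^+ 3 by exact: exprn_ge0.
    by move=> /(ler_wpM2l u3); lra.
  have L24 : L1 P (fun w => Z w ^+ 2 + Z w ^+ 4) by exact: L1D.
  have La : L1 P (fun w => 1 - u ^+ 2 / 2 * Z w ^+ 2).
    by apply: L1B; [exact: L1_cst|exact: L1Z].
  apply: (le_trans (Ex_le (L1_cos muZ) _ h)); first by apply: L1D => //; exact: L1Z.
  rewrite ExD//; last exact: L1Z.
  rewrite ExB//; [|exact: L1_cst|exact: L1Z].
  rewrite Ex_cst !ExZ// ExD// EZ2.
  have u3 : 0 <= `|u| ^+ 3 by exact: exprn_ge0.
  by have := ler_wpM2l u3 EZ4; lra.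
have c0 : 1 - u ^+ 2 / 2 <= mean_cos (fun w => u * Z w).
  have La : L1 P (fun w => 1 - u ^+ 2 / 2 * Z w ^+ 2).
    by apply: L1B; [exact: L1_cst|exact: L1Z].
  have := Ex_le La (L1_cos muZ); rewrite ExB ?ExZ ?EZ2 ?Ex_cst ?mulr1//; last first.
  - exact: L1Z.
  - exact: L1_cst.
  by apply => w; have := cos_ge (u * Z w); rewrite exprMn; lra.
have c2 : mean_cos (fun w => u * Z w) <= 1.
  by rewrite -(Ex_cst P 1); apply: Ex_le; [exact: L1_cos|exact: L1_cst|move=> w; exact: cos_le1].
have s1 : `|mean_sin (fun w => u * Z w)| <= u ^+ 2.
  have E : mean_sin (fun w => u * Z w) = Ex P (fun w => sin (u * Z w) - u * Z w).
    by rewrite ExB//; [rewrite ExZ// EZ mulr0 subr0|exact: L1_sin|exact: L1Z].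
  rewrite E /Ex; apply: (le_trans (le_normr_Rintegral _ _)) => //.
    by apply: L1B; [exact: L1_sin|exact: L1Z].
  rewrite -[leRHS]mulr1 -EZ2 -ExZ//; apply: Ex_le.
  - apply: integrable_norm; apply: L1B; [exact: L1_sin|exact: L1Z].
  - exact: L1Z.
  - by move=> w; rewrite -exprMn; exact: norm_sinB_le.
have s2 : mean_sin (fun w => u * Z w) ^+ 2 <= u ^+ 4.
  rewrite (_ : 4 = 2 * 2)%N// exprM -[leLHS]real_normK ?num_real//.
  by rewrite ler_sqr ?nnegrE ?sqr_ge0.
apply: le_trans (expR_ge1Dx _).
rewrite /cf_sqr.
move: c0 c1 c2 s2 u8 u0; rewrite (_ : u ^+ 4 = `|u| ^+ 4); last first.
  by rewrite (_ : 4 = 2 * 2)%N// !exprM real_normK ?num_real.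
rewrite uE; set c := mean_cos _; set s := mean_sin _ ^+ 2; set v := `|u| => c0 c1 c2 s2 u8 v0.
have v1 : 8 * v <= 1 by nra.
have v2 : v ^+ 2 <= 1 by nra.
have cc : c ^+ 2 <= c by nra.
have v3 : v ^+ 3 * (1 + M4) / 2 <= v ^+ 2 / 16.
  have h := ler_wpM2l (sqr_ge0 v) u8; lra.
have v4 : v ^+ 4 <= v ^+ 2 / 8.
  have : v ^+ 2 <= 8^-1 by nra.
  by move=> /(ler_wpM2l (sqr_ge0 v)) h; lra.
lra.
Qed.

End CharacteristicFunction.

Section AntiConcentration.
Context d (T : measurableType d) (R : realType) (P : probability T R) (n : nat).
Variables (X : 'I_n -> T -> R) (K : R).
Hypotheses (mX : forall i, measurable_fun [set: T] (X i)).
Hypothesis indX : mutually_independent P X.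
Hypothesis K0 : 0 < K.
Hypothesis X1 : forall i, L1 P (fun w => expR (X i w ^+ 2 / K ^+ 2)).
Hypothesis X2 : forall i, Ex P (fun w => expR (X i w ^+ 2 / K ^+ 2)) <= 2.
Hypothesis EX : forall i, Ex P (X i) = 0.
Hypothesis VX : forall i, Ex P (fun w => X i w ^+ 2) = 1.

Let c8 := 8 * (1 + 8 * K ^+ 4).

Lemma cf_sqr_linear (u : 'I_n -> R) :
  (forall i, `|u i| * c8 <= 1) ->
  cf_sqr P (fun w => \sum_i u i * X i w) <= expR (- ((\sum_i u i ^+ 2) / 4)).
Proof.
move=> u8.
pose f i x := u i * x.
have mf i : measurable_fun setT (f i) by exact: measurable_funM.
suff H (k : nat) : (k <= n)%N ->
  cf_sqr P (fun w => \sum_(j < n | (j < k)%N) f j (X j w)) <=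
    expR (- ((\sum_(j < n | (j < k)%N) u j ^+ 2) / 4)).
  have := H n (leqnn n).
  have -> : (fun w => \sum_(j < n | (j < n)%N) f j (X j w)) =
            (fun w => \sum_i u i * X i w).
    by apply/funext => w; apply: eq_bigl => j; rewrite ltn_ord.
  by rewrite (eq_bigl _ _ (fun j => ltn_ord j)).
elim: k => [_|k IH kn].
  rewrite [X in expR X](_ : _ = 0) ?expR0; last by rewrite big_pred0// mul0r oppr0.
  have -> : (fun w => \sum_(j < n | (j < 0)%N) f j (X j w)) = (fun=> 0).
    by apply/funext => w; rewrite big_pred0.
  by rewrite /cf_sqr /mean_cos /mean_sin !Ex_cst cos0 sin0 expr1n expr0n addr0.
pose i := Ordinal kn.
have ind := @independent_prefix _ _ _ _ _ _ _ _ mX indX f i mf.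
have mS : measurable_fun setT (fun w => \sum_(j < n | (j < i)%N) f j (X j w)).
  by apply: measurable_sum_cond => j; exact: measurableT_comp.
have ind' : independent P (fun w => \sum_(j < n | (j < i)%N) f j (X j w)) (fun w => f i (X i w)).
  exact: (@independent_comp _ _ _ _ _ _ _ _ _ _ _ _ _ _ (fun x => x) (f i)).
have -> : (fun w => \sum_(j < n | (j < k.+1)%N) f j (X j w)) =
  (fun w => \sum_(j < n | (j < i)%N) f j (X j w) + f i (X i w)).
  by apply/funext => w; rewrite -(prefix_sum_recr _ i).
rewrite cf_sqrD//; last exact: measurableT_comp.
rewrite [X in expR (- (X / _))](prefix_sum_recr _ i) [X in expR (- X)]mulrDl opprD expRD ler_pM//.
- by rewrite addr_ge0 ?sqr_ge0.
- by rewrite addr_ge0 ?sqr_ge0.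
- exact: IH (ltnW kn).
- apply: cf_sqr_small (EX i) (VX i) _ (u8 i) => //.
  + exact: (subgaussian_L1 K0 (mX i) (X1 i)).
  + exact: (subgaussian_L1_sqr K0 (mX i) (X1 i)).
  + exact: (subgaussian_L1_pow4 K0 (mX i) (X1 i)).
  + exact: (subgaussian_Ex_pow4 K0 (mX i) (X1 i)).
Qed.

End AntiConcentration.

Section AntiConcentration.
Context d (T : measurableType d) (R : realType) (P : probability T R) (n : nat).
Variables (X : 'I_n -> T -> R) (K : R).
Hypotheses (mX : forall i, measurable_fun [set: T] (X i)).
Hypothesis indX : mutually_independent P X.
Hypothesis K0 : 0 < K.
Hypothesis X1 : forall i, L1 P (fun w => expR (X i w ^+ 2 / K ^+ 2)).
Hypothesis X2 : forall i, Ex P (fun w => expR (X i w ^+ 2 / K ^+ 2)) <= 2.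
Hypothesis EX : forall i, Ex P (X i) = 0.
Hypothesis VX : forall i, Ex P (fun w => X i w ^+ 2) = 1.

(* The second moment of the exponential sum [\sum_(k < M) e^(i k H (S - s))]
   is at least M^2/4 on the event, and its off-diagonal terms are values of
   the characteristic function of S at nonzero multiples of H. *)
Lemma anti_concentration (v : 'I_n -> R) (H s : R) (M : nat) :
  0 < H -> (0 < M)%N ->
  (forall i, `|v i| * (M%:R * H) * (8 * (1 + 8 * K ^+ 4)) <= 1) ->
  (P [set w | (`|\sum_i v i * X i w - s| <= (2 * M%:R * H)^-1)%R] <=
   (4 / M%:R + 4 * expR (- (H ^+ 2 * (\sum_i v i ^+ 2) / 8)))%:E)%E.
Proof.
move=> H0 M0 vM.
have M0' : (0 : R) < M%:R by rewrite ltr0n.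
set e := expR _.
pose S w := \sum_i v i * X i w.
have mS : measurable_fun setT S.
  by apply: measurable_sum_cond => i; exact: measurable_funM.
pose th w := H * (S w - s).
have mth : measurable_fun setT th.
  by apply: measurable_funM => //; exact: measurable_funB.
pose A w := \sum_(k < M) cos (k%:R * th w).
pose B w := \sum_(k < M) sin (k%:R * th w).
pose D (k l : 'I_M) w := cos ((k%:R - l%:R) * th w).
have mD k l : measurable_fun setT (fun w => (k%:R - l%:R : R) * th w).
  exact: measurable_funM.
have ABE w : A w ^+ 2 + B w ^+ 2 = \sum_(k < M) \sum_(l < M) D k l w.
  rewrite !expr2 /A /B !mulr_suml -big_split; apply: eq_bigr => k _.
  rewrite /= !mulr_sumr -big_split; apply: eq_bigr => l _ /=.
  by rewrite /D mulrBl cosB.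
have L1D' k l : L1 P (D k l) by exact: L1_cos.
have L1AB : L1 P (fun w => A w ^+ 2 + B w ^+ 2).
  have : L1 P (fun w => \sum_(k < M) \sum_(l < M) D k l w).
    by apply: L1_sum => k; exact: L1_sum.
  by apply: eq_L1 => w; rewrite ABE.
have ED (k l : 'I_M) : Ex P (D k l) <= (k == l)%:R + e.
  have [->|kl] := eqVneq k l.
    apply: (@le_trans _ _ 1); last by rewrite lerDl expR_ge0.
    by rewrite -(Ex_cst P 1); apply: Ex_le => //; [exact: L1_cst|move=> w; exact: cos_le1].
  rewrite add0r.
  pose t : R := (k%:R - l%:R) * H.
  have t2 : H ^+ 2 <= t ^+ 2.
    rewrite /t exprMn -[leLHS]mul1r; apply: ler_wpM2r; first exact: sqr_ge0.
    have : (1 : R) <= `|k%:R - l%:R|.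
      case: (ltngtP k l) => [h|h|/val_inj h]; last by rewrite h eqxx in kl.
        by rewrite distrC ger0_norm ?subr_ge0 ?ler_nat ?(ltnW h)// -natrB ?(ltnW h)// ler1n subn_gt0.
      by rewrite ger0_norm ?subr_ge0 ?ler_nat ?(ltnW h)// -natrB ?(ltnW h)// ler1n subn_gt0.
    by move=> h; rewrite -(real_normK (num_real (k%:R - l%:R : R))) exprn_ege1.
  have tM : `|t| <= M%:R * H.
    rewrite /t normrM (gtr0_norm H0) ler_pM2r//.
    have := ltn_ord k; have := ltn_ord l; rewrite -!(ltr_nat R) => l1 k1.
    have := ler0n R k; have := ler0n R l => l0 k0.
    by rewrite ler_norml; apply/andP; split; lra.
  (* The squared modulus decays with constant 1/4; [e] bounds the modulus itself, hence the 1/8 in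
     its exponent. *)
  have cf : cf_sqr P (fun w => t * S w) <= e ^+ 2.
    have -> : (fun w => t * S w) = (fun w => \sum_i (t * v i) * X i w).
      by apply/funext => w; rewrite mulr_sumr; apply: eq_bigr => i _; rewrite mulrA.
    apply: le_trans (cf_sqr_linear mX indX K0 X1 X2 EX VX _) _.
      move=> i; apply: le_trans (vM i); apply: ler_wpM2r.
        by rewrite mulr_ge0// addr_ge0// mulr_ge0// exprn_ge0// ltW.
      by rewrite normrM mulrC ler_wpM2l.
    rewrite /e expr2 -expRD ler_expR.
    have -> : \sum_i (t * v i) ^+ 2 = t ^+ 2 * \sum_i v i ^+ 2.
      by rewrite mulr_sumr; apply: eq_bigr => i _; rewrite exprMn.
    have v0 : 0 <= \sum_i v i ^+ 2 by apply: sumr_ge0 => i _; exact: sqr_ge0.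
    have h := ler_wpM2r v0 t2; lra.
  pose a := t * s.
  have -> : Ex P (D k l) = cos a * mean_cos P (fun w => t * S w) + sin a * mean_sin P (fun w => t * S w).
    have mtS : measurable_fun setT (fun w => t * S w) by exact: measurable_funM.
    rewrite /mean_cos /mean_sin -!ExZ; [|exact: L1_sin|exact: L1_cos].
    rewrite -ExD; [|by apply: L1Z; exact: L1_cos|by apply: L1Z; exact: L1_sin].
    apply: eq_Ex => w; rewrite /D.
    have -> : (k%:R - l%:R) * th w = t * S w - a by rewrite /th /a /t; ring.
    by rewrite cosB; ring.
  have e0 : 0 <= e by exact: expR_ge0.
  have := cos2Dsin2 a; move: cf; rewrite /cf_sqr.
  set x := mean_cos _ _; set y := mean_sin _ _ => cf cs.
  (* Cauchy-Schwarz for [(x, y)] and the unit vector [(cos a, sin a)], by contradiction. *)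
  have [//|lt] := leP (cos a * x + sin a * y) e.
  have h1 : e ^+ 2 < (cos a * x + sin a * y) ^+ 2 by rewrite ltr_sqr ?nnegrE// ltW// (le_lt_trans e0 lt).
  have h2 := sqr_ge0 (cos a * y - sin a * x).
  have h3 : (cos a ^+ 2 + sin a ^+ 2) * (x ^+ 2 + y ^+ 2) =
     (cos a * x + sin a * y) ^+ 2 + (cos a * y - sin a * x) ^+ 2 by ring.
  rewrite cs in h3; lra.
have EAB : Ex P (fun w => A w ^+ 2 + B w ^+ 2) <= M%:R + M%:R ^+ 2 * e.
  rewrite (eq_Ex _ ABE) Ex_sum; last by move=> k; exact: L1_sum.
  apply: (@le_trans _ _ (\sum_(k < M) (1 + M%:R * e))); last first.
    by rewrite sumr_const card_ord -mulr_natl; lra.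
  apply: ler_sum => k _; rewrite Ex_sum//.
  apply: (le_trans (ler_sum _ (fun l _ => ED k l))).
  rewrite big_split /= sumr_const card_ord mulr_natl lerD2r.
  rewrite (bigD1 k)//= eqxx big1 ?addr0// => l lk.
  by rewrite eq_sym (negbTE lk).
pose f w := 4 / M%:R ^+ 2 * (A w ^+ 2 + B w ^+ 2).
have c0 : 0 <= 4 / M%:R ^+ 2 :> R by rewrite divr_ge0// sqr_ge0.
apply: (@le_trans _ _ (Ex P f)%:E).
  apply: prob_le.
  - apply: measurable_le_set => //; apply: measurableT_comp => //.
    exact: measurable_funB.
  - exact: L1Z.
  - by move=> w; rewrite mulr_ge0// addr_ge0 ?sqr_ge0.
  - move=> w /= Sw.
    (* All phases lie within 1/2 of 0, so that every cosine is at least 7/8 and their sum exceeds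
       [M / 2]. *)
    have thw : `|M%:R * th w| <= 2^-1.
      rewrite /th mulrA normrM gtr0_norm ?mulr_gt0// -ler_pdivlMl ?mulr_gt0//.
      by apply: (le_trans Sw); rewrite le_eqVlt; apply/orP; left; apply/eqP; field;
        rewrite !gt_eqF.
    have Aw : M%:R / 2 <= A w.
      have -> : M%:R / 2 = \sum_(k < M) (2^-1 : R) by rewrite sumr_const card_ord mulr_natl.
      apply: ler_sum => k _; apply: le_trans (cos_ge _).
      have : (k%:R * th w) ^+ 2 <= 1 / 4.
        have -> : 1 / 4 = (2^-1) ^+ 2 :> R by field.
        rewrite -real_normK ?num_real// ler_sqr ?nnegrE// ?invr_ge0//.
        apply: le_trans thw; rewrite !normrM !normr_nat ler_wpM2r// ler_nat.
        by rewrite ltnW.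
      by lra.
    have A2 : (M%:R / 2) ^+ 2 <= A w ^+ 2 + B w ^+ 2.
      apply: (@le_trans _ _ (A w ^+ 2)); last by rewrite lerDl sqr_ge0.
      by rewrite ler_sqr ?nnegrE ?divr_ge0// (le_trans _ Aw)// divr_ge0.
    have := ler_wpM2l c0 A2; apply: le_trans; rewrite le_eqVlt; apply/orP; left; apply/eqP.
    by field; rewrite gt_eqF.
rewrite lee_fin ExZ//; apply: (le_trans (ler_wpM2l c0 EAB)).
rewrite le_eqVlt; apply/orP; left; apply/eqP; field.
by rewrite gt_eqF.
Qed.

End AntiConcentration.

(** * The max-margin direction *)

Section Vectors.
Context {R : realType} {d : nat}.
Implicit Types u v w : 'I_d -> R.

(** Vectors are plain functions here, so that linear combinations can be written directly; [tnth]
    turns the tuples of the model into such functions. *)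
Definition dot u v : R := \sum_j u j * v j.
Definition nrm u : R := Num.sqrt (dot u u).

Lemma dotC u v : dot u v = dot v u.
Proof. by apply: eq_bigr => j _; rewrite mulrC. Qed.

Lemma dot_comb (a b : R) u v w :
  dot (fun j => a * u j + b * v j) w = a * dot u w + b * dot v w.
Proof.
by rewrite /dot !mulr_sumr -big_split; apply: eq_bigr => j _ /=; ring.
Qed.

Lemma dot_combr (a b : R) u v w :
  dot w (fun j => a * u j + b * v j) = a * dot w u + b * dot w v.
Proof. by rewrite dotC dot_comb !(dotC w). Qed.

Lemma dotZl (a : R) u v : dot (fun j => a * u j) v = a * dot u v.
Proof. by rewrite /dot mulr_sumr; apply: eq_bigr => j _; rewrite mulrA. Qed.

Lemma dotDl u v w : dot (fun j => u j + v j) w = dot u w + dot v w.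
Proof. by rewrite /dot -big_split; apply: eq_bigr => j _ /=; rewrite mulrDl. Qed.

Lemma dotDr u v w : dot w (fun j => u j + v j) = dot w u + dot w v.
Proof. by rewrite dotC dotDl !(dotC w). Qed.

Lemma dotBl u v w : dot (fun j => u j - v j) w = dot u w - dot v w.
Proof. by rewrite /dot -sumrB; apply: eq_bigr => j _ /=; rewrite mulrBl. Qed.

Lemma dot_suml (I : finType) (Q : pred I) (z : I -> 'I_d -> R) w :
  dot (fun j => \sum_(i | Q i) z i j) w = \sum_(i | Q i) dot (z i) w.
Proof.
by rewrite /dot exchange_big; apply: eq_bigr => j _; rewrite mulr_suml.
Qed.

Lemma dot_sqr_ge0 u : 0 <= dot u u.
Proof. by apply: sumr_ge0 => j _; rewrite -expr2 sqr_ge0. Qed.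

Lemma nrm_ge0 u : 0 <= nrm u. Proof. exact: sqrtr_ge0. Qed.

Lemma nrm_sqr u : nrm u ^+ 2 = dot u u.
Proof. by rewrite sqr_sqrtr// dot_sqr_ge0. Qed.

Lemma nrm_sumE u : nrm u = Num.sqrt (\sum_j u j ^+ 2).
Proof. by rewrite /nrm /dot; congr Num.sqrt; apply: eq_bigr => j _; rewrite expr2. Qed.

Lemma dot_sqr_eq0 u : dot u u = 0 -> forall j, u j = 0.
Proof.
move=> /eqP; rewrite psumr_eq0; last by move=> j _; rewrite -expr2 sqr_ge0.
by move=> /allP u0 j; have := u0 j (mem_index_enum j); rewrite -expr2 sqrf_eq0 => /eqP.
Qed.

Lemma dot_le u v : dot u v <= nrm u * nrm v.
Proof.
have [u0|u0] := eqVneq (nrm u) 0.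
  have : dot u u = 0 by rewrite -nrm_sqr u0 expr0n.
  move=> /dot_sqr_eq0 uj; rewrite u0 mul0r le_eqVlt; apply/orP; left; apply/eqP.
  by apply: big1 => j _; rewrite uj mul0r.
have [v0|v0] := eqVneq (nrm v) 0.
  have : dot v v = 0 by rewrite -nrm_sqr v0 expr0n.
  move=> /dot_sqr_eq0 vj; rewrite v0 mulr0 le_eqVlt; apply/orP; left; apply/eqP.
  by apply: big1 => j _; rewrite vj mulr0.
have u1 : 0 < nrm u by rewrite lt_def u0 nrm_ge0.
have v1 : 0 < nrm v by rewrite lt_def v0 nrm_ge0.
have := dot_sqr_ge0 (fun j => nrm v * u j + (- nrm u) * v j).
rewrite dot_comb !dot_combr -!nrm_sqr (dotC v u).
set a := nrm u; set b := nrm v; set c := dot u v => h.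
have ab : 0 < 2 * (a * b) by rewrite mulr_gt0// mulr_gt0.
rewrite -(ler_pM2l ab); lra.
Qed.

Lemma norm_dot_le u v : `|dot u v| <= nrm u * nrm v.
Proof.
rewrite ler_norml dot_le andbT lerNl -[leLHS]mulN1r -dotZl.
apply: (le_trans (dot_le _ _)); rewrite le_eqVlt; apply/orP; left; apply/eqP.
by congr (_ * _); rewrite !nrm_sumE; congr Num.sqrt; apply: eq_bigr => j _; rewrite mulN1r sqrrN.
Qed.

Lemma nrmZ (a : R) u : nrm (fun j => a * u j) = `|a| * nrm u.
Proof.
rewrite !nrm_sumE -sqrtr_sqr -sqrtrM ?sqr_ge0// mulr_sumr; congr Num.sqrt.
by apply: eq_bigr => j _; rewrite exprMn.
Qed.

Lemma nrmD u v : nrm (fun j => u j + v j) <= nrm u + nrm v.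
Proof.
rewrite -ler_sqr ?nnegrE ?addr_ge0 ?nrm_ge0//.
rewrite nrm_sqr dotDl !dotDr sqrrD !nrm_sqr (dotC v u).
by have := dot_le u v; rewrite mulr2n; lra.
Qed.

Lemma nrmB u v : nrm (fun j => u j - v j) <= nrm u + nrm v.
Proof.
apply: (le_trans (nrmD u (fun j => - v j))); rewrite lerD2l !nrm_sumE le_eqVlt.
apply/orP; left; apply/eqP; congr Num.sqrt; apply: eq_bigr => j _.
by rewrite sqrrN.
Qed.

End Vectors.

Section Means.
Context {R : realType} {d : nat} (I : finType).
Variables (z : I -> 'I_d -> R).

Definition count_of (Q : pred I) : R := \sum_(i | Q i) 1.
Definition mean_of (Q : pred I) : 'I_d -> R :=
  fun j => (count_of Q)^-1 * \sum_(i | Q i) z i j.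

Lemma dot_mean (Q : pred I) u : dot (mean_of Q) u = (count_of Q)^-1 * \sum_(i | Q i) dot (z i) u.
Proof. by rewrite /mean_of dotZl dot_suml. Qed.

Lemma mean_ge (Q : pred I) (F : I -> R) a : 0 < count_of Q ->
  (forall i, Q i -> a <= F i) -> a <= (count_of Q)^-1 * \sum_(i | Q i) F i.
Proof.
move=> Q0 aF; rewrite mulrC ler_pdivlMr// /count_of mulr_sumr.
by apply: ler_sum => i Qi; rewrite mulr1 aF.
Qed.

Lemma mean_le (Q : pred I) (F : I -> R) a : 0 < count_of Q ->
  (forall i, Q i -> F i <= a) -> (count_of Q)^-1 * \sum_(i | Q i) F i <= a.
Proof.
move=> Q0 aF; rewrite mulrC ler_pdivrMr// /count_of mulr_sumr.
by apply: ler_sum => i Qi; rewrite mulr1 aF.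
Qed.

Lemma mean_norm_le (Q : pred I) (F : I -> R) a : 0 < count_of Q ->
  (forall i, Q i -> `|F i| <= a) -> `|(count_of Q)^-1 * \sum_(i | Q i) F i| <= a.
Proof.
move=> Q0 aF; rewrite ler_norml mean_ge ?mean_le// => i /aF; rewrite ler_norml => /andP[] //.
Qed.

End Means.

Section MaxMargin.
Context {R : realType} {d : nat} (I : finType).
Variables (pos neg : pred I) (mu : 'I_d -> R) (z : I -> 'I_d -> R).
Variables (tau b0 kap : R) (beta : 'I_d -> R).

(* In the last clause, eliminating the intercept turns lower bounds A and -B on
   the noisy projections of the two classes into the margin (A - B)/(1 + tau). *)
Definition max_margin : Prop :=
  [/\ nrm beta <= 1,
      forall i, pos i -> tau * kap <= dot mu beta + dot (z i) beta + b0,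
      forall i, neg i -> kap <= dot mu beta - dot (z i) beta - b0 &
      forall u A B, nrm u <= 1 ->
        (forall i, pos i -> A <= dot mu u + dot (z i) u) ->
        (forall i, neg i -> - dot mu u + dot (z i) u <= B) ->
        A - B <= (1 + tau) * kap].

Hypothesis tau0 : 0 < tau.
Hypothesis mm : max_margin.
Hypotheses (N0 : 0 < count_of (R := R) pos) (Nm0 : 0 < count_of (R := R) neg).

Let p := mean_of z pos.
Let q := mean_of z neg.
Let m := dot mu beta.

Lemma margin_pos_ge : tau * kap <= m + dot p beta + b0.
Proof.
case: mm => _ H _ _; rewrite /p dot_mean.
suff h : tau * kap - m - b0 <= (count_of pos)^-1 * \sum_(i | pos i) dot (z i) beta by lra.
by apply: mean_ge => // i /H; rewrite /m => h; lra.
Qed.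

Lemma margin_neg_ge : kap <= m - dot q beta - b0.
Proof.
case: mm => _ _ H _; rewrite /q dot_mean.
suff h : (count_of neg)^-1 * \sum_(i | neg i) dot (z i) beta <= m - b0 - kap by lra.
by apply: mean_le => // i /H; rewrite /m => h; lra.
Qed.

Lemma norm_dot_beta u : `|dot u beta| <= nrm u.
Proof.
case: mm => b1 _ _ _; apply: (le_trans (norm_dot_le _ _)).
by rewrite -[leRHS]mulr1 ler_wpM2l// nrm_ge0.
Qed.

Section HighSignal.
Variable delta : R.
Hypothesis mu0 : 0 < nrm mu.
Hypothesis zmu : forall i, `|dot (z i) mu| <= delta * nrm mu.

Lemma margin_high : 2 * nrm mu - 2 * delta <= (1 + tau) * kap.
Proof.
case: mm => _ _ _ H.
set u := fun j => (nrm mu)^-1 * mu j.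
have E v : dot v u = (nrm mu)^-1 * dot v mu by rewrite dotC dotZl dotC.
have muE : (nrm mu)^-1 * dot mu mu = nrm mu by rewrite -nrm_sqr; field; rewrite gt_eqF.
have zE i : `|(nrm mu)^-1 * dot (z i) mu| <= delta.
  by rewrite normrM normfV (gtr0_norm mu0) ler_pdivrMl// mulrC.
have -> : 2 * nrm mu - 2 * delta = (nrm mu - delta) - (delta - nrm mu) by ring.
apply: (H u).
- by rewrite nrmZ normfV (gtr0_norm mu0) mulVf ?gt_eqF.
- by move=> i _; rewrite !E muE; have := zE i; rewrite ler_norml => /andP[]; lra.
- by move=> i _; rewrite !E muE; have := zE i; rewrite ler_norml => /andP[]; lra.
Qed.

Lemma high_scores :
  tau * kap - nrm p <= m + b0 /\ kap - nrm q <= m - b0.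
Proof.
have := margin_pos_ge; have := margin_neg_ge.
have := norm_dot_beta p; have := norm_dot_beta q.
rewrite !ler_norml => /andP[? ?] /andP[? ?] ? ?; split; lra.
Qed.

End HighSignal.

End MaxMargin.

Section WeakSignal.
Context {R : realType} {d : nat} (I : finType).
Variables (pos neg : pred I) (mu : 'I_d -> R) (z : I -> 'I_d -> R).
Variables (tau b0 kap : R) (beta : 'I_d -> R).
Hypothesis tau0 : 0 < tau.
Hypothesis mm : max_margin pos neg mu z tau b0 kap beta.
Hypotheses (N0 : 0 < count_of (R := R) pos) (Nm0 : 0 < count_of (R := R) neg).

Let p := mean_of z pos.
Let q := mean_of z neg.
Let m := dot mu beta.

(** [D] stands for [d] divided by the minority count, the common approximate value of [dot (z i) p]
    over the minority class. [s] is the square root of [rho], the scale on which [beta] is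
    located. *)
Variables (delta rho s D : R).
Hypothesis delta1 : 1 <= delta.
Hypotheses (s0 : 0 < s) (rhoE : rho = s ^+ 2).
Hypothesis zmu : forall i, `|dot (z i) mu| <= delta * nrm mu.
Hypothesis zneg : forall i, neg i -> `|dot (z i) p| <= delta * nrm p.
Hypothesis zpos : forall i, pos i -> `|dot (z i) p - D| <= 8 * delta ^+ 2 * rho.
Hypotheses (D1 : rho ^+ 2 / 2 <= D) (D2 : D <= 2 * rho ^+ 2).
Hypothesis delta_rho : 768 * delta ^+ 2 <= rho.
Hypothesis mu_rho : nrm mu <= rho / 8.
Hypothesis q1 : nrm q <= 1.

(** The two class means of the data differ by [2 mu + p - q]; [w] drops [q], whose norm is at most
    1. Adding the two averaged margin constraints bounds [(1 + tau) * kap] by the inner product of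
    this difference with [beta]. *)
Let w := fun j => 2 * mu j + p j.
Let W := nrm w.

Let rho0 : 0 < rho. Proof. by rewrite rhoE exprn_gt0. Qed.

Let rho1 : 768 <= rho.
Proof. by apply: le_trans delta_rho; have := delta1; nra. Qed.

Let dotp_w v : dot w v = 2 * dot mu v + dot p v.
Proof.
rewrite -[dot p v]mul1r -dot_comb; congr dot.
by apply/funext => j; rewrite /w mul1r.
Qed.

Let dotr_w v : dot v w = 2 * dot v mu + dot v p.
Proof. by rewrite dotC dotp_w !(dotC v). Qed.

(** [nrm p ^+ 2] is the average of [dot (z i) p] over the minority class, so the bound for single
    points is inherited. *)
Let pp_D : `|nrm p ^+ 2 - D| <= 8 * delta ^+ 2 * rho.
Proof.
rewrite nrm_sqr {1}/p dot_mean.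
have h1 : D - 8 * delta ^+ 2 * rho <= (count_of pos)^-1 * \sum_(i | pos i) dot (z i) p.
  by apply: mean_ge => // i /zpos; rewrite ler_norml => /andP[]; lra.
have h2 : (count_of pos)^-1 * \sum_(i | pos i) dot (z i) p <= D + 8 * delta ^+ 2 * rho.
  by apply: mean_le => // i /zpos; rewrite ler_norml => /andP[]; lra.
by rewrite ler_norml; apply/andP; split; lra.
Qed.

Let mup : `|dot mu p| <= delta * nrm mu.
Proof. by rewrite dotC dot_mean; exact: mean_norm_le. Qed.

Let delta_rho2 : 8 * delta ^+ 2 * rho <= rho ^+ 2 / 96.
Proof. by have := ler_wpM2r (ltW rho0) delta_rho; lra. Qed.

Let p_bounds : rho / 2 <= nrm p /\ nrm p <= 2 * rho.
Proof.
have := pp_D; rewrite ler_norml => /andP[h1 h2].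
have p0 := nrm_ge0 p.
have r0 := rho0; have h3 := delta_rho2.
have e1 : (rho / 2) ^+ 2 <= nrm p ^+ 2 by move: D1 D2; lra.
have e2 : nrm p ^+ 2 <= (2 * rho) ^+ 2 by move: D1 D2; lra.
by split; rewrite -ler_sqr// nnegrE; lra.
Qed.

Lemma weak_W_bounds : rho / 4 <= W /\ W <= 3 * rho.
Proof.
have [p1 p2] := p_bounds; have mu0 := nrm_ge0 mu.
have mu2 : nrm (fun j => 2 * mu j) = 2 * nrm mu by rewrite nrmZ ger0_norm.
split; last first.
  have := nrmD (fun j => 2 * mu j) p; rewrite mu2 -/w -/W; move: mu_rho; lra.
have pE : p = (fun j => w j - 2 * mu j) by apply/funext => j; rewrite /w; ring.
have := nrmB w (fun j => 2 * mu j); rewrite -pE mu2 -/W; move: mu_rho; lra.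
Qed.

Let W0 : 0 < W. Proof. by have [] := weak_W_bounds; have := rho0; lra. Qed.

Let W_sqr : W ^+ 2 = 4 * nrm mu ^+ 2 + 4 * dot mu p + nrm p ^+ 2.
Proof.
by rewrite [W ^+ 2]nrm_sqr dotp_w !dotr_w (dotC p mu) !nrm_sqr; ring.
Qed.

Lemma weak_margin_ge : W - 96 * delta ^+ 2 <= (1 + tau) * kap.
Proof.
case: mm => _ _ _ H.
set u := fun j => W^-1 * w j.
have E v : dot v u = W^-1 * dot v w by rewrite dotC dotZl dotC.
have mu0 := nrm_ge0 mu.
have [W1 W3] := weak_W_bounds; have [p1 p2] := p_bounds.
have := mup; rewrite ler_norml => /andP[mup1 mup2].
have := pp_D; rewrite ler_norml => /andP[pp1 pp2].
(* [A] and [B] still carry the factor [W]. Replacing [D] by [nrm p ^+ 2] doubles the error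
   [8 * delta ^+ 2 * rho]. *)
pose A := 2 * nrm mu ^+ 2 + dot mu p - 2 * (delta * nrm mu) + nrm p ^+ 2 - 16 * delta ^+ 2 * rho.
pose B := - (2 * nrm mu ^+ 2) - dot mu p + 2 * (delta * nrm mu) + delta * nrm p.
apply: (@le_trans _ _ (W^-1 * A - W^-1 * B)); last first.
  apply: (H u).
  - by rewrite nrmZ normfV (gtr0_norm W0) mulVf ?gt_eqF.
  - move=> i pi; rewrite !E -mulrDr ler_pM2l ?invr_gt0//.
    rewrite !dotr_w -nrm_sqr.
    have := zpos pi; rewrite ler_norml => /andP[z1 z2].
    have := zmu i; rewrite ler_norml => /andP[z3 z4].
    by rewrite /A; lra.
  - move=> i pi; rewrite !E -mulrN -mulrDr ler_pM2l ?invr_gt0//.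
    rewrite !dotr_w -nrm_sqr.
    have := zneg pi; rewrite ler_norml => /andP[z1 z2].
    have := zmu i; rewrite ler_norml => /andP[z3 z4].
    by rewrite /B; lra.
rewrite -mulrBr [leRHS]mulrC ler_pdivlMr//.
have d0 : 0 <= delta by move: delta1; lra.
have h1 : delta * nrm mu <= delta * (rho / 8) by apply: ler_wpM2l.
have h2 : delta * nrm p <= delta * (2 * rho) by apply: ler_wpM2l.
have h3 : delta * rho <= delta ^+ 2 * rho.
  by rewrite expr2 -mulrA; apply: ler_peMl => //; rewrite mulr_ge0// ltW.
have h4 : delta ^+ 2 * (rho / 4) <= delta ^+ 2 * W by apply: ler_wpM2l => //; exact: sqr_ge0.
(* [W ^+ 2 - (A - B)] is at most [24 * delta ^+ 2 * rho], and [rho <= 4 * W] turns 24 into 96. *)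
rewrite mulrBl -expr2 W_sqr /A /B; lra.
Qed.

Lemma weak_margin_le : (1 + tau) * kap <= dot w beta + 1.
Proof.
have h1 := margin_pos_ge mm N0; have h2 := margin_neg_ge mm Nm0.
have := norm_dot_beta mm q; rewrite ler_norml => /andP[h3 h4].
by rewrite dotp_w; move: h1 h2 h3 q1; rewrite -/p -/q; lra.
Qed.

Let w_beta : dot w beta <= W.
Proof. by have := norm_dot_beta mm w; rewrite ler_norml => /andP[]. Qed.

(* |beta - w/|w| |^2 <= 2 - 2 <w,beta>/|w|, and <w,beta> >= |w| - O(delta^2). *)
Lemma weak_direction : nrm (fun j => beta j - W^-1 * w j) <= 28 * delta / s.
Proof.
have d0 : 0 <= delta by move: delta1; lra.
have [W1 W3] := weak_W_bounds.
have h0 : 0 <= 28 * delta / s by rewrite divr_ge0 ?mulr_ge0 ?(ltW s0).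
rewrite -ler_sqr ?nnegrE ?nrm_ge0// nrm_sqr.
have -> : (fun j => beta j - W^-1 * w j) = (fun j => 1 * beta j + (- W^-1) * w j).
  by apply/funext => j; ring.
rewrite (dot_comb 1 (- W^-1) beta w) !(dot_combr 1 (- W^-1) beta w) (dotC beta w) -!nrm_sqr -/W.
case: mm => b1 _ _ _.
have b2 : nrm beta ^+ 2 <= 1 by have := nrm_ge0 beta; nra.
have h1 := weak_margin_ge; have h2 := weak_margin_le.
have h3 : W - 97 * delta ^+ 2 <= dot w beta by have := delta1; nra.
have iW : 0 < W^-1 by rewrite invr_gt0.
have WW : W^-1 * W = 1 by rewrite mulVf ?gt_eqF.
have h4 : 1 - W^-1 * (97 * delta ^+ 2) <= W^-1 * dot w beta.
  have := ler_wpM2l (ltW iW) h3; rewrite mulrBr WW; lra.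
(* The squared distance is at most [2 * 97 * delta ^+ 2 / W], hence at most
   [776 * delta ^+ 2 / rho]; 784 is the next square, that of 28. *)
have h5 : (28 * delta / s) ^+ 2 = 784 * delta ^+ 2 / rho.
  by rewrite rhoE; field; rewrite gt_eqF.
have h6 : W^-1 <= 4 / rho.
  by rewrite -(invrK 4) -invfM lef_pV2 ?posrE ?mulr_gt0 ?invr_gt0// mulrC.
have h7 := ler_wpM2l (sqr_ge0 delta) h6.
have h8 : W^-1 * (W^-1 * W ^+ 2) = 1 by field; rewrite gt_eqF.
have h9 : 0 <= delta ^+ 2 / rho by rewrite divr_ge0 ?sqr_ge0// ltW.
rewrite h5; lra.
Qed.

Lemma weak_mu_beta : `|m - W^-1 * (2 * nrm mu ^+ 2 + dot mu p)| <= nrm mu * (28 * delta / s).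
Proof.
have -> : m - W^-1 * (2 * nrm mu ^+ 2 + dot mu p) = dot mu (fun j => beta j - W^-1 * w j).
  have -> : (fun j => beta j - W^-1 * w j) = (fun j => 1 * beta j + (- W^-1) * w j).
    by apply/funext => j; ring.
  by rewrite (dot_combr 1 (- W^-1) beta w) dotr_w nrm_sqr /m; ring.
apply: (le_trans (norm_dot_le _ _)); apply: ler_wpM2l; first exact: nrm_ge0.
exact: weak_direction.
Qed.

Lemma weak_m_le : `|m| <= 4 * (2 * nrm mu ^+ 2 + delta * nrm mu) / rho + nrm mu * (28 * delta / s).
Proof.
have [W1 W3] := weak_W_bounds.
have h6 : W^-1 <= 4 / rho.
  by rewrite -(invrK 4) -invfM lef_pV2 ?posrE ?mulr_gt0 ?invr_gt0// mulrC.
have d0 : 0 <= delta by move: delta1; lra.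
have h0 : 0 <= 2 * nrm mu ^+ 2 + delta * nrm mu.
  by rewrite addr_ge0// mulr_ge0 ?sqr_ge0 ?nrm_ge0.
have mu0 := nrm_ge0 mu.
have h7 : `|W^-1 * (2 * nrm mu ^+ 2 + dot mu p)| <= 4 / rho * (2 * nrm mu ^+ 2 + delta * nrm mu).
  rewrite normrM normfV (gtr0_norm W0); apply: ler_pM => //.
    by rewrite invr_ge0 ltW.
  apply: (le_trans (ler_normD _ _)); rewrite ger0_norm ?mulr_ge0 ?sqr_ge0//.
  by rewrite lerD2l.
have := ler_normD (m - W^-1 * (2 * nrm mu ^+ 2 + dot mu p)) (W^-1 * (2 * nrm mu ^+ 2 + dot mu p)).
rewrite subrK => h9; apply: (le_trans h9); rewrite addrC.
apply: (le_trans (lerD h7 weak_mu_beta)); rewrite lerD2r; lra.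
Qed.

(** The main term is at least [nrm mu ^+ 2 / (3 * rho)], since [W <= 3 * rho] and
    [|dot mu p| <= nrm mu ^+ 2]. The constant 168 = 6 * 28 makes the error in the direction cost at
    most half of it. *)
Lemma weak_m_ge : delta <= nrm mu -> 168 * delta * s <= nrm mu ->
  nrm mu ^+ 2 / (6 * rho) <= m.
Proof.
move=> dmu smu.
have [W1 W3] := weak_W_bounds.
have := weak_mu_beta; rewrite ler_norml => /andP[h1 _].
have mu0 := nrm_ge0 mu.
have := mup; rewrite ler_norml => /andP[mup1 mup2].
have h2 : nrm mu ^+ 2 <= 2 * nrm mu ^+ 2 + dot mu p.
  by have := ler_wpM2r mu0 dmu; rewrite -expr2; lra.
have h3 : (3 * rho)^-1 <= W^-1 by rewrite lef_pV2 ?posrE ?mulr_gt0.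
have h4 : (3 * rho)^-1 * nrm mu ^+ 2 <= W^-1 * (2 * nrm mu ^+ 2 + dot mu p).
  by apply: ler_pM => //; rewrite ?sqr_ge0// invr_ge0 mulr_ge0// ltW.
have h5 : nrm mu * (28 * delta / s) <= nrm mu * (nrm mu / (6 * rho)).
  apply: ler_wpM2l => //; rewrite rhoE ler_pdivlMr ?mulr_gt0 ?exprn_gt0//.
  have -> : 28 * delta / s * (6 * s ^+ 2) = 168 * delta * s by field; rewrite gt_eqF.
  exact: smu.
have h6 : (3 * rho)^-1 * nrm mu ^+ 2 - nrm mu * (nrm mu / (6 * rho)) = nrm mu ^+ 2 / (6 * rho).
  by field; rewrite gt_eqF.
lra.
Qed.

(** As 768 = 8 * 96, the hypothesis [delta_rho] limits the loss in [weak_margin_ge] to half of the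
    lower bound [rho / 4] for [W]. *)
Lemma weak_kap_ge : rho / 8 <= (1 + tau) * kap.
Proof.
have [W1 W3] := weak_W_bounds; have := weak_margin_ge; have := delta_rho; lra.
Qed.

Lemma weak_kap_le : (1 + tau) * kap <= 4 * rho.
Proof.
have [W1 W3] := weak_W_bounds; have := weak_margin_le; have := w_beta; have := rho1; lra.
Qed.

(** Bounding [dot p beta] by [nrm p] could lose a multiple of [rho], as much as the margin itself.
    Instead [dot p beta] equals [dot w beta - 2 * m], at most [W - 2 * m], and [W] cancels against
    the lower bound for [(1 + tau) * kap]. *)
Lemma weak_pos_score_ge : 2 * m - 96 * delta ^+ 2 - kap <= m + b0.
Proof.
have h1 := margin_pos_ge mm N0; have h2 := weak_margin_ge; have := w_beta.
rewrite dotp_w -/m; move: h1; rewrite -/p -/m; lra.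
Qed.

(** The majority margin alone pushes the intercept down. With bounded [tau], [kap] is of order [rho]
    and outweighs [nrm mu], so minority test points fall on the wrong side. *)
Lemma weak_pos_score_le : m + b0 <= 2 * nrm mu - kap + 1.
Proof.
have h1 := margin_neg_ge mm Nm0; move: h1; rewrite -/q -/m.
have := norm_dot_beta mm q; have := norm_dot_beta mm mu; rewrite !ler_norml -/m => /andP[? ?] /andP[? ?].
move: q1; lra.
Qed.

Lemma weak_neg_score_ge : kap - 1 <= m - b0.
Proof.
have h1 := margin_neg_ge mm Nm0; move: h1; rewrite -/q -/m.
have := norm_dot_beta mm q; rewrite !ler_norml => /andP[? ?].
move: q1; lra.
Qed.

(** Only this part of [w/|w|] is sure to have small coordinates: those of [p] average minority
    noise, while [mu] may be concentrated on one coordinate. *)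
Let v := fun j => W^-1 * p j.

Lemma weak_main_part : 1 / 36 <= \sum_j v j ^+ 2.
Proof.
have [W1 W3] := weak_W_bounds; have [p1 p2] := p_bounds.
have -> : \sum_j v j ^+ 2 = (W^-1 * nrm p) ^+ 2.
  rewrite exprMn nrm_sqr /dot mulr_sumr; apply: eq_bigr => j _.
  by rewrite /v exprMn -expr2.
have : 1 / 6 <= W^-1 * nrm p.
  rewrite [leRHS]mulrC ler_pdivlMr//; lra.
nra.
Qed.

Lemma weak_main_part_coord j : (forall i, pos i -> `|z i j| <= delta) ->
  `|v j| <= 4 * delta / rho.
Proof.
move=> zj; have [W1 W3] := weak_W_bounds.
have pj : `|p j| <= delta by rewrite /p /mean_of; exact: mean_norm_le.
have h6 : W^-1 <= 4 / rho.
  by rewrite -(invrK 4) -invfM lef_pV2 ?posrE ?mulr_gt0 ?invr_gt0// mulrC.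
rewrite /v normrM normfV (gtr0_norm W0).
have -> : 4 * delta / rho = 4 / rho * delta by ring.
by apply: ler_pM => //; rewrite invr_ge0 ltW.
Qed.

Lemma weak_rest : nrm (fun j => beta j - v j) <= 28 * delta / s + 8 * nrm mu / rho.
Proof.
have [W1 W3] := weak_W_bounds.
have -> : (fun j => beta j - v j) = (fun j => (beta j - W^-1 * w j) + (2 / W) * mu j).
  by apply/funext => j; rewrite /v /w; field; rewrite gt_eqF.
apply: (le_trans (nrmD _ _)); apply: lerD; first exact: weak_direction.
rewrite nrmZ ger0_norm ?divr_ge0 ?(ltW W0)//.
have h6 : W^-1 <= 4 / rho.
  by rewrite -(invrK 4) -invfM lef_pV2 ?posrE ?mulr_gt0 ?invr_gt0// mulrC.
have := ler_wpM2r (nrm_ge0 mu) h6; lra.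
Qed.

End WeakSignal.

(** * Typical samples *)

Section Dataset.
Context {R : realType} {d n : nat}.
Variables (mu : d.-tuple R) (D : n.-tuple (d.-tuple R * R)).

Definition noise_of (i : 'I_n) : 'I_d -> R := tnth (noise mu (tnth D i)).
Definition is_pos (i : 'I_n) : bool := (tnth D i).2 == 1.
Definition is_neg (i : 'I_n) : bool := (tnth D i).2 == -1.
Definition noise_sum (Q : pred 'I_n) : 'I_d -> R :=
  fun j => \sum_(i | Q i) noise_of i j.

Lemma coord_noise i j :
  tnth (tnth D i).1 j = (tnth D i).2 * tnth mu j + noise_of i j.
Proof. by rewrite /noise_of tnth_mktuple; ring. Qed.

Lemma dot_coord i u : dot (tnth (tnth D i).1) u =
  (tnth D i).2 * dot (tnth mu) u + dot (noise_of i) u.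
Proof.
rewrite -dotZl -dotDl; congr dot; apply/funext => j; exact: coord_noise.
Qed.

Lemma svm_solution_max_margin tau f kap : 0 < tau ->
  svm_solution tau D f kap ->
  max_margin is_pos is_neg (tnth mu) noise_of tau f.2 kap (tnth f.1).
Proof.
move=> tau0 [[f1 Hf] Hopt].
have sE (g : d.-tuple R * R) i : score g (tnth D i).1 =
    (tnth D i).2 * dot (tnth mu) (tnth g.1) + dot (noise_of i) (tnth g.1) + g.2.
  by rewrite -dot_coord.
have DE i : tnth D i = ((tnth D i).1, (tnth D i).2) by case: (tnth D i).
split=> //.
- move=> i /eqP yi; have := Hf i; have := sE f i.
  rewrite [X in let: (_, _) := X in _]DE yi => -> [+ _] => /(_ erefl).
  by rewrite !mul1r.
- move=> i /eqP yi; have := Hf i; have := sE f i.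
  rewrite [X in let: (_, _) := X in _]DE yi => -> [_ +] => /(_ erefl).
  by lra.
- move=> u A B u1 HA HB.
  pose k' := (A - B) / (1 + tau).
  (* With this intercept a minority projection equal to [A] has margin exactly [tau * k'], and a
     majority one equal to [B] has margin exactly [k']. *)
  pose g : d.-tuple R * R := ([tuple u j | j < d], tau * k' - A).
  have t1 : 0 < 1 + tau by rewrite addr_gt0.
  have k'E : (1 + tau) * k' = A - B by rewrite /k' mulrC divfK// gt_eqF.
  have gu : tnth g.1 = u by apply/funext => j; rewrite tnth_mktuple.
  have : svm_feasible tau D g k'.
    split; first by rewrite /norm2 /dotp gu.
    move=> i; have := sE g i; rewrite gu.
    rewrite [X in let: (_, _) := X in _]DE => -> /=; split=> yi; rewrite yi.
      have := HA i; rewrite /is_pos yi eqxx => /(_ isT); lra.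
    have := HB i; rewrite /is_neg yi eqxx => /(_ isT); lra.
  by move=> /Hopt kk; rewrite -k'E ler_pM2l.
Qed.

(** On this event the analysis of the classifier is deterministic. The counts, class sums and norms
    are paid for by moments; [good_dot_mu], [good_coord] and [good_cross] by exponential tails and
    union bounds. *)
Record good_sample (p delta : R) : Prop := {
  good_pos_count : `|count_of is_pos - n%:R * p| <= n%:R * p / 2 ;
  good_neg_count : n%:R / 2 <= count_of (R := R) is_neg ;
  good_pos_sum : nrm (noise_sum is_pos) <= delta * Num.sqrt (n%:R * p * d%:R) ;
  good_neg_sum : nrm (noise_sum is_neg) <= delta * Num.sqrt (n%:R * d%:R) ;
  good_dot_mu : forall i, `|dot (noise_of i) (tnth mu)| <= delta * nrm (tnth mu) ;
  good_coord : forall i j, `|noise_of i j| <= delta ;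
  good_norm : forall i, is_pos i ->
    `|dot (noise_of i) (noise_of i) - d%:R| <= delta * Num.sqrt (n%:R * p * d%:R) ;
  (* The sum omits the i-th point, so that it is independent of its noise. *)
  good_cross : forall i,
    `|dot (noise_of i) (noise_sum (fun k => is_pos k && (k != i)))| <=
    delta * nrm (noise_sum (fun k => is_pos k && (k != i))) }.

Section Consequences.
Variables (p delta : R).
Hypothesis G : good_sample p delta.
Hypotheses (n0 : (0 < n)%N) (p0 : 0 < p).

Let Nb := n%:R * p.
Let n0' : (0 : R) < n%:R. Proof. by rewrite ltr0n. Qed.
Let Nb0 : 0 < Nb. Proof. by rewrite mulr_gt0. Qed.

Lemma good_pos_count_bounds : Nb / 2 <= count_of is_pos /\ count_of is_pos <= 2 * Nb.
Proof.
have := good_pos_count G; rewrite -/Nb ler_norml => /andP[? ?]; have := Nb0.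
by split; lra.
Qed.

Lemma good_pos_count_gt0 : 0 < count_of (R := R) is_pos.
Proof. by have [] := good_pos_count_bounds; have := Nb0; lra. Qed.

Lemma good_neg_count_gt0 : 0 < count_of (R := R) is_neg.
Proof. by have := good_neg_count G; have := n0'; lra. Qed.

Lemma good_two_class : two_class D.
Proof.
have h (Q : pred 'I_n) : 0 < count_of (R := R) Q -> exists i, Q i.
  move=> Q0; apply/existsP; apply: contraLR Q0; rewrite negb_exists => /forallP H.
  by rewrite /count_of big_pred0 ?ltxx// => i; exact/negbTE.
have [i /eqP yi] := h _ good_pos_count_gt0; have [k /eqP yk] := h _ good_neg_count_gt0.
by split; [exists i|exists k].
Qed.

Lemma nrm_mean_of (Q : pred 'I_n) : 0 < count_of (R := R) Q ->
  nrm (mean_of noise_of Q) = nrm (noise_sum Q) / count_of Q.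
Proof. by move=> Q0; rewrite nrmZ normfV gtr0_norm// mulrC. Qed.

Lemma good_pos_mean : nrm (mean_of noise_of is_pos) <= 2 * delta * Num.sqrt (d%:R / Nb).
Proof.
have [N1 N2] := good_pos_count_bounds.
have N0 := good_pos_count_gt0.
rewrite nrm_mean_of// ler_pdivrMr//; apply: (le_trans (good_pos_sum G)).
have -> : n%:R * p * d%:R = Nb ^+ 2 * (d%:R / Nb) by rewrite -/Nb; field; rewrite gt_eqF.
rewrite sqrtrM ?sqr_ge0// sqrtr_sqr gtr0_norm//.
have d0 : 0 <= delta * Num.sqrt (n%:R * p * d%:R) by apply: le_trans (good_pos_sum G); exact: nrm_ge0.
have h0 : 0 <= delta * Num.sqrt (d%:R / Nb).
  move: d0; rewrite (_ : n%:R * p * d%:R = Nb ^+ 2 * (d%:R / Nb)); last first.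
    by rewrite -/Nb; field; rewrite gt_eqF.
  rewrite sqrtrM ?sqr_ge0// sqrtr_sqr gtr0_norm// mulrCA pmulr_rge0//.
have := ler_wpM2l h0 N1; lra.
Qed.

Lemma good_neg_mean : nrm (mean_of noise_of is_neg) <= 2 * delta * Num.sqrt (d%:R / n%:R).
Proof.
have N1 := good_neg_count G.
have N0 := good_neg_count_gt0.
rewrite nrm_mean_of// ler_pdivrMr//; apply: (le_trans (good_neg_sum G)).
have E : n%:R * d%:R = n%:R ^+ 2 * (d%:R / n%:R) :> R by field; rewrite gt_eqF.
have d0 : 0 <= delta * Num.sqrt (n%:R * d%:R) by apply: le_trans (good_neg_sum G); exact: nrm_ge0.
move: d0; rewrite E sqrtrM ?sqr_ge0// sqrtr_sqr gtr0_norm// mulrCA pmulr_rge0// => h0.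
have := ler_wpM2l h0 N1; lra.
Qed.

Variable rho : R.
Hypotheses (rho0 : 0 < rho) (rhoE : rho ^+ 2 = d%:R / Nb).
Hypotheses (Nb1 : 1 <= Nb) (delta1 : 1 <= delta) (delta_rho : delta <= rho).

Let L := Nb * rho.

Let LE : Num.sqrt (n%:R * p * d%:R) = L.
Proof.
have -> : n%:R * p * d%:R = L ^+ 2.
  by rewrite /L exprMn rhoE -/Nb; field; rewrite gt_eqF.
by rewrite sqrtr_sqr gtr0_norm// mulr_gt0.
Qed.

Let dE : d%:R = L * rho.
Proof. by rewrite /L -mulrA -expr2 rhoE; field; rewrite gt_eqF. Qed.

Let L0 : 0 < L. Proof. by rewrite mulr_gt0. Qed.

Lemma good_zneg i : is_neg i ->
  `|dot (noise_of i) (mean_of noise_of is_pos)| <= delta * nrm (mean_of noise_of is_pos).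
Proof.
move=> ni; have N0 := good_pos_count_gt0.
have pi : is_pos i = false.
  by apply/negbTE; rewrite /is_pos (eqP ni) -subr_eq0 -opprD oppr_eq0 -(natrD _ 1 1) pnatr_eq0.
have E : noise_sum (fun k => is_pos k && (k != i)) = noise_sum is_pos.
  apply/funext => j; apply: eq_bigl => k; case: eqP => [->|]; first by rewrite pi.
  by rewrite andbT.
have := good_cross G i; rewrite E => h.
rewrite nrm_mean_of// /mean_of dotC dotZl normrM normfV (gtr0_norm N0) dotC.
rewrite mulrC mulrA ler_pM2r ?invr_gt0//.
Qed.

(** The class sum is the own noise plus the leave-one-out sum. The first contributes [d] up to
    [delta * L]; the second has norm at most [3 * delta * L], hence a product of at most
    [3 * delta ^+ 2 * L]. Dividing [4 * delta ^+ 2 * L] by a count of at least [Nb / 2] gives the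
    8. *)
Lemma good_zpos i : is_pos i ->
  `|dot (noise_of i) (mean_of noise_of is_pos) - d%:R / count_of is_pos| <= 8 * delta ^+ 2 * rho.
Proof.
move=> pi; have N0 := good_pos_count_gt0; have [N1 N2] := good_pos_count_bounds.
set S := noise_sum is_pos; set S' := noise_sum (fun k => is_pos k && (k != i)).
have SE : S = fun j => noise_of i j + S' j.
  by apply/funext => j; rewrite /S /S' /noise_sum (bigD1 i).
have S'E : S' = fun j => S j - noise_of i j.
  by apply/funext => j; rewrite SE; ring.
have nS : nrm S <= delta * L by have := good_pos_sum G; rewrite LE.
have zz : `|dot (noise_of i) (noise_of i) - d%:R| <= delta * L.
  by have := good_norm G pi; rewrite LE.
have d0 : 0 <= delta by exact: le_trans delta1.
have dL : delta * L <= d%:R by rewrite dE mulrC ler_wpM2l// ltW.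
have LL : d%:R <= L ^+ 2.
  rewrite dE expr2; apply: ler_wpM2l; first exact: ltW.
  by rewrite /L; apply: ler_peMl => //; exact: ltW.
have nz : nrm (noise_of i) <= 2 * L.
  have h : nrm (noise_of i) ^+ 2 <= (2 * L) ^+ 2.
    rewrite nrm_sqr; move: zz; rewrite ler_norml => /andP[_ h].
    by have := sqr_ge0 L; lra.
  by rewrite -ler_sqr// nnegrE ?nrm_ge0//; have := L0; lra.
have nS' : nrm S' <= 3 * delta * L.
  have h1 : nrm S' <= nrm S + nrm (noise_of i) by rewrite S'E; exact: nrmB.
  have h2 : L <= delta * L by apply: ler_peMl => //; exact: ltW.
  lra.
have c := good_cross G i; rewrite -/S' in c.
have c' : `|dot (noise_of i) S'| <= 3 * delta ^+ 2 * L.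
  by apply: (le_trans c); have := ler_wpM2l d0 nS'; lra.
have h : `|dot (noise_of i) S - d%:R| <= 4 * delta ^+ 2 * L.
  have -> : dot (noise_of i) S - d%:R = (dot (noise_of i) (noise_of i) - d%:R) + dot (noise_of i) S'.
    by rewrite {1}SE dotDr; ring.
  apply: (le_trans (ler_normD _ _)).
  have h2 : delta * L <= delta ^+ 2 * L.
    by rewrite expr2 -mulrA; apply: ler_peMl => //; rewrite mulr_ge0// ltW.
  lra.
have -> : dot (noise_of i) (mean_of noise_of is_pos) - d%:R / count_of is_pos =
    (dot (noise_of i) S - d%:R) / count_of is_pos.
  by rewrite /mean_of dotC dotZl (dotC _ (noise_of i)); ring.
rewrite normrM normfV (gtr0_norm N0) ler_pdivrMr//; apply: (le_trans h).
have h3 : 0 <= 8 * delta ^+ 2 * rho by rewrite !mulr_ge0 ?sqr_ge0// ltW.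
have := ler_wpM2l h3 N1; rewrite /L; lra.
Qed.

Lemma good_density : rho ^+ 2 / 2 <= d%:R / count_of is_pos /\
  d%:R / count_of is_pos <= 2 * rho ^+ 2.
Proof.
have N0 := good_pos_count_gt0; have [N1 N2] := good_pos_count_bounds.
have dE' : d%:R = Nb * rho ^+ 2 by rewrite rhoE; field; rewrite gt_eqF.
have r2 := sqr_ge0 rho.
split.
  rewrite ler_pdivlMr// dE'; have := ler_wpM2l r2 N2; lra.
rewrite ler_pdivrMr// dE'; have := ler_wpM2l r2 N1; lra.
Qed.

End Consequences.

End Dataset.

(** * Probability bounds for the good event *)

Section OuterBounds.
Context d (T : measurableType d) (R : realType) (P : probability T R).

(* Spares the measurability of unions of exceptional events. *)
Definition outer_le (A : set T) (e : R) : Prop :=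
  exists B, [/\ measurable B, A `<=` B & (P B <= e%:E)%E].

Lemma outer_le_measurable A e : measurable A -> (P A <= e%:E)%E -> outer_le A e.
Proof. by move=> mA Ae; exists A; split. Qed.

Lemma outer_leS A A' e e' : A `<=` A' -> e' <= e -> outer_le A' e' -> outer_le A e.
Proof.
move=> AA ee [B [mB AB Be]]; exists B; split=> //; first by move=> w /AA /AB.
by apply: (le_trans Be); rewrite lee_fin.
Qed.

Lemma outer_leU A A' e e' : outer_le A e -> outer_le A' e' -> outer_le (A `|` A') (e + e').
Proof.
move=> [B [mB AB Be]] [B' [mB' AB' Be']]; exists (B `|` B'); split.
- exact: measurableU.
- exact: setUSS.
- by apply: (le_trans (measureU2 _ mB mB')); rewrite EFinD leeD.
Qed.

Lemma outer_le_ex (I : finType) (A : I -> set T) (m : nat) e : #|I| = m ->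
  (forall i, outer_le (A i) e) ->
  outer_le [set w | exists i, A i w] (m%:R * e).
Proof.
move=> <- Ae.
have {}Ae (s : seq I) : outer_le [set w | exists2 i, i \in s & A i w] ((size s)%:R * e).
  elim: s => [|i s IH].
    exists set0; rewrite measure0 mul0r; split=> //.
    by move=> w /= [i]; rewrite in_nil.
  rewrite /= -natr1 addrC mulrDl mul1r.
  apply: outer_leS (lexx _) (outer_leU (Ae i) IH) => w /= [k].
  by rewrite inE => /orP[/eqP ->|ks] Aw; [left|right; exists k].
have := Ae (enum I); rewrite -cardE; apply: outer_leS => // w /= [i Ai].
by exists i; rewrite // mem_enum.
Qed.

Lemma outer_le_markov (f : T -> R) (t e : R) : L1 P f -> (forall w, 0 <= f w) -> 0 < t ->
  Ex P f <= e * t -> outer_le [set w | t < f w] e.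
Proof.
move=> f1 f0 t0 fe; exists [set w | (t <= f w)%R]; split.
- by apply: measurable_le_set => //; exact: L1_measurable f1.
- by move=> w /= /ltW.
- apply: (le_trans (markov_ge f1 f0 t0)).
  by rewrite lee_fin ler_pdivrMr.
Qed.

End OuterBounds.

Section Measurability.
Context d (T : measurableType d) (R : realType).

Lemma measurable_sqrtr (f : T -> R) : measurable_fun setT f ->
  measurable_fun setT (fun w => Num.sqrt (f w)).
Proof.
move=> mf; apply: (measurableT_comp (f := @Num.sqrt R)) => //.
by apply: continuous_measurable_fun; exact: sqrt_continuous.
Qed.

Lemma measurable_tnth_comp d' (T' : measurableType d') n (f : T -> n.-tuple T') i :
  measurable_fun setT f -> measurable_fun setT (fun w => tnth (f w) i).
Proof.
by move=> mf; apply: (measurableT_comp (f := fun t : n.-tuple T' => tnth t i)) => //; exact: measurable_tnth.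
Qed.

Lemma measurable_dot n (u v : T -> 'I_n -> R) :
  (forall j, measurable_fun setT (fun w => u w j)) ->
  (forall j, measurable_fun setT (fun w => v w j)) ->
  measurable_fun setT (fun w => dot (u w) (v w)).
Proof.
by move=> mu mv; apply: measurable_sum => j; exact: measurable_funM.
Qed.

Lemma measurable_nrm n (u : T -> 'I_n -> R) :
  (forall j, measurable_fun setT (fun w => u w j)) ->
  measurable_fun setT (fun w => nrm (u w)).
Proof. by move=> mu; apply: measurable_sqrtr; exact: measurable_dot. Qed.

Lemma measurable_eqr_nat (f : T -> R) (k : R) : measurable_fun setT f ->
  measurable_fun setT (fun w => (f w == k)%:R : R).
Proof.
move=> mf.
rewrite (_ : (fun w => (f w == k)%:R) = \1_[set k] \o f).
  apply: measurableT_comp => //; exact: measurable_indic.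
by apply/funext => w; rewrite /= indicE in_set1.
Qed.

End Measurability.

Section Mixture.
Context {R : realType} (d : nat).
Variables (p : R) (mu : d.-tuple R) (C : R) (Q : probability (d.-tuple R * R)%type R).
Hypothesis HQ : is_2subGMM p mu C Q.

(* The infimum defining the psi_2 norm need not be attained; hence the + 1. *)
Definition psi2_scale : R := `|C| + 1.
Let K := psi2_scale.

Lemma psi2_scale_gt0 : 0 < K.
Proof. by rewrite ltr_pwDr. Qed.

Let K0 := psi2_scale_gt0.

Definition noise_coord (j : 'I_d) (s : d.-tuple R * R) : R := tnth (noise mu s) j.

Lemma measurable_noise : measurable_fun setT (noise mu).
Proof.
apply/measurable_fun_tnthP => j /=.
rewrite (_ : _ \o _ = fun s : d.-tuple R * R => tnth s.1 j - s.2 * tnth mu j).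
  apply: measurable_funB; first exact: measurable_tnth_comp.
  exact: measurable_funM.
by apply/funext => s /=; rewrite tnth_mktuple.
Qed.

Lemma measurable_noise_coord j : measurable_fun setT (noise_coord j).
Proof. exact: (measurable_tnth_comp j measurable_noise). Qed.

Let mX := measurable_noise_coord.

Lemma noise_indep : mutually_independent Q noise_coord.
Proof. by case: HQ. Qed.

Lemma noise_exp j : L1 Q (fun s => expR (noise_coord j s ^+ 2 / K ^+ 2)) /\
  Ex Q (fun s => expR (noise_coord j s ^+ 2 / K ^+ 2)) <= 2.
Proof.
by apply: psi2_norm_exp_sqr; [exact: mX|case: HQ => _ _ _ _ _ _ /(_ j)].
Qed.

Let X1 j := (noise_exp j).1.
Let X2 j := (noise_exp j).2.

Lemma noise_mean0 j : Ex Q (noise_coord j) = 0.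
Proof.
have : ('E_Q[noise_coord j] = 0)%E by case: HQ => _ _ _ _ /(_ j).
by rewrite unlock /Ex /Rintegral => ->.
Qed.

Lemma noise_L1_sqr j : L1 Q (fun s => noise_coord j s ^+ 2).
Proof. exact: (subgaussian_L1_sqr K0 (mX j) (X1 j)). Qed.

Lemma noise_var1 j : Ex Q (fun s => noise_coord j s ^+ 2) = 1.
Proof.
have : ('V_Q[noise_coord j] = 1)%E by case: HQ => _ _ _ _ _ /(_ j).
have -> : 'V_Q[noise_coord j] = ('E_Q[fun s => (noise_coord j s ^+ 2)%R])%E.
  rewrite /variance unlock; congr expectation; apply/funext => s.
  have -> : ('E_Q[noise_coord j] = 0)%E by case: HQ => _ _ _ _ /(_ j).
  by rewrite fctE /= subr0 expr2.
by rewrite unlock /Ex /Rintegral => ->.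
Qed.

Lemma noise_linear_sqr (u : 'I_d -> R) :
  L1 Q (fun s => dot u (tnth (noise mu s)) ^+ 2) /\
  Ex Q (fun s => dot u (tnth (noise mu s)) ^+ 2) = nrm u ^+ 2.
Proof.
have [h1 h2] := Ex_linear_sqr mX noise_indep K0 X1 noise_mean0 noise_var1 u.
split=> //; rewrite nrm_sumE sqr_sqrtr//.
by apply: sumr_ge0 => j _; exact: sqr_ge0.
Qed.

Definition tail (t : R) : R := 2 * expR (1 - t / (2 * K)).

Lemma noise_tail (u : 'I_d -> R) t :
  (Q [set s | (t * nrm u < `|dot u (tnth (noise mu s))|)%R] <= (tail t)%:E)%E.
Proof.
have := linear_tail mX noise_indep K0 X1 X2 noise_mean0 u t.
by rewrite -nrm_sumE.
Qed.

Lemma noise_norm_dev :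
  L1 Q (fun s => (dot (tnth (noise mu s)) (tnth (noise mu s)) - d%:R) ^+ 2) /\
  Ex Q (fun s => (dot (tnth (noise mu s)) (tnth (noise mu s)) - d%:R) ^+ 2) <= 8 * K ^+ 4 * d%:R.
Proof.
have := Ex_norm_sqr_dev mX noise_indep K0 X1 X2 noise_var1.
by [].
Qed.

Lemma noise_anti_concentration (v : 'I_d -> R) (H s : R) (M : nat) :
  0 < H -> (0 < M)%N ->
  (forall i, `|v i| * (M%:R * H) * (8 * (1 + 8 * K ^+ 4)) <= 1) ->
  (Q [set x | (`|dot v (tnth (noise mu x)) - s| <= (2 * M%:R * H)^-1)%R] <=
   (4 / M%:R + 4 * expR (- (H ^+ 2 * nrm v ^+ 2 / 8)))%:E)%E.
Proof.
move=> H0 M0 vM.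
have := anti_concentration mX noise_indep K0 X1 X2 noise_mean0 noise_var1 s H0 M0 vM.
rewrite nrm_sumE sqr_sqrtr//.
by apply: sumr_ge0 => j _; exact: sqr_ge0.
Qed.

Definition label_is (y : R) (s : d.-tuple R * R) : R := (s.2 == y)%:R.

Lemma label_isE y : label_is y = \1_[set s | s.2 = y].
Proof.
apply/funext => s; rewrite /label_is indicE; congr ((nat_of_bool _)%:R).
by apply/idP/idP => [/eqP h|/set_mem /= ->//]; rewrite inE.
Qed.

Lemma measurable_label y : measurable [set s : d.-tuple R * R | s.2 = y].
Proof. by apply: measurable_eq_set. Qed.

Lemma label_L1 y : L1 Q (label_is y).
Proof. by rewrite label_isE; apply: L1_indic; exact: measurable_label. Qed.

Lemma label_pos_Ex : Ex Q (label_is 1) = p.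
Proof.
apply: EFin_inj; rewrite label_isE -Ex_indic; last exact: measurable_label.
by case: HQ.
Qed.

Lemma label_neg_Ex : Ex Q (label_is (-1)) = 1 - p.
Proof.
apply: EFin_inj; rewrite label_isE -Ex_indic; last exact: measurable_label.
by case: HQ.
Qed.

Lemma label_noise_Ex (y : R) (f : d.-tuple R -> R) : measurable_fun setT f ->
  L1 Q (fun s => f (noise mu s)) ->
  L1 Q (fun s => label_is y s * f (noise mu s)) /\
  Ex Q (fun s => label_is y s * f (noise mu s)) = Ex Q (label_is y) * Ex Q (fun s => f (noise mu s)).
Proof.
move=> mf f1.
have ind : independent Q (noise mu) snd by case: HQ.
have mg : measurable_fun setT (fun x : R => (x == y)%:R : R).
  exact: (@measurable_eqr_nat _ _ _ (fun x => x)).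
have [h1 h2] := indep_L1M measurable_noise measurable_snd ind mf mg f1 (label_L1 y).
split; first by apply: eq_L1 h1 => s /=; rewrite mulrC.
by rewrite mulrC -h2; apply: eq_Ex => s /=; rewrite mulrC.
Qed.

End Mixture.

Section Sample.
Context dd (T : measurableType dd) (R : realType) (P : probability T R) (d n : nat).
Variables (p : R) (mu : d.-tuple R) (C : R) (Q : probability (d.-tuple R * R)%type R).
Hypothesis HQ : is_2subGMM p mu C Q.
Variable X : T -> n.-tuple (d.-tuple R * R).
Hypothesis mX : measurable_fun setT X.
Hypothesis HX : iid_with_law P X Q.

Let Xi (i : 'I_n) w := tnth (X w) i.

Let mXi i : measurable_fun setT (Xi i).
Proof. exact: measurable_tnth_comp. Qed.

Let Xlaw i : has_law P (Xi i) Q.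
Proof. exact: (HX.2 i). Qed.

Let Xind : mutually_independent P Xi.
Proof. exact: HX.1. Qed.

Lemma iid_sum_sqr (f : d.-tuple R * R -> R) : measurable_fun setT f ->
  L1 Q f -> L1 Q (fun s => f s ^+ 2) -> Ex Q f = 0 ->
  L1 P (fun w => (\sum_i f (Xi i w)) ^+ 2) /\
  Ex P (fun w => (\sum_i f (Xi i w)) ^+ 2) = n%:R * Ex Q (fun s => f s ^+ 2).
Proof.
move=> mf f1 f2 f0.
have fL i : L1 P (f \o Xi i) by exact: (has_law_L1 (mXi i) (Xlaw i) f1).
have h i k : i != k -> L1 P (fun w => f (Xi i w) * f (Xi k w)) /\
    Ex P (fun w => f (Xi i w) * f (Xi k w)) = 0.
  move=> ik; have [h1 ->] := indep_L1M (mXi i) (mXi k) (independent_pair Xind ik) mf mf (fL i) (fL k).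
  by split=> //; rewrite (has_law_Ex (mXi i) (Xlaw i) f1) f0 mul0r.
have [| | |h1 h2] := @Ex_sqr_sum _ _ _ P _ (fun i w => f (Xi i w)).
- by move=> i; exact: (has_law_L1 (mXi i) (Xlaw i) f2).
- by move=> i k /h[].
- by move=> i k /h[].
split=> //; rewrite h2 (eq_bigr (fun=> Ex Q (fun s => f s ^+ 2))).
  by rewrite sumr_const card_ord mulr_natl.
by move=> i _; exact: (has_law_Ex (mXi i) (Xlaw i) f2).
Qed.

Let count_sumE (y : R) w :
  count_of (fun i => (tnth (X w) i).2 == y) = \sum_i label_is y (Xi i w).
Proof.
by rewrite /count_of big_mkcond; apply: eq_bigr => i _; rewrite /label_is /Xi; case: eqP.
Qed.

Lemma outer_count (y b t : R) : Ex Q (label_is y) = b -> 0 < t ->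
  outer_le P [set w | t < `|count_of (fun i => (tnth (X w) i).2 == y) - n%:R * b|]
    (n%:R * b / t ^+ 2).
Proof.
move=> bE t0.
pose f (s : d.-tuple R * R) : R := label_is y s - b.
have lL := label_L1 Q y.
have mf : measurable_fun setT f by apply: measurable_funB => //; exact: (L1_measurable lL).
have fL : L1 Q f by apply: L1B => //; exact: L1_cst.
have f0 : Ex Q f = 0 by rewrite ExB ?bE ?Ex_cst ?subrr//; exact: L1_cst.
have f2E s : f s ^+ 2 = (1 - 2 * b) * label_is y s + b ^+ 2.
  by rewrite /f /label_is; case: eqP => _ /=; ring.
have f2L : L1 Q (fun s => f s ^+ 2).
  suff : L1 Q (fun s => (1 - 2 * b) * label_is y s + b ^+ 2) by apply: eq_L1 => s; rewrite f2E.
  by apply: L1D; [exact: L1Z|exact: L1_cst].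
have Ef2 : Ex Q (fun s => f s ^+ 2) <= b.
  rewrite (eq_Ex _ f2E) ExD; [|exact: L1Z|exact: L1_cst].
  by rewrite ExZ// bE Ex_cst; have := sqr_ge0 b; lra.
have [h1 h2] := iid_sum_sqr mf fL f2L f0.
apply: outer_leS (lexx _) (outer_le_markov h1 _ _ _) => [w|w||]; last 3 first.
- exact: sqr_ge0.
- exact: (exprn_gt0 2 t0).
- by rewrite h2 divfK ?gt_eqF ?exprn_gt0// ler_wpM2l.
move=> /=; rewrite count_sumE => h.
have -> : \sum_i f (Xi i w) = \sum_i label_is y (Xi i w) - n%:R * b.
  by rewrite sumrB sumr_const card_ord mulr_natl.
by rewrite -(real_normK (num_real (_ - _))) ltr_sqr ?nnegrE// ltW.
Qed.

Let noise_sumE (y : R) w j : noise_sum mu (X w) (fun i => (tnth (X w) i).2 == y) j =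
  \sum_i label_is y (Xi i w) * noise_coord mu j (Xi i w).
Proof.
rewrite /noise_sum big_mkcond; apply: eq_bigr => i _; rewrite /label_is /Xi.
by case: eqP => _; rewrite (mul1r, mul0r).
Qed.

(** Label times noise coordinate is centred with second moment [b], by independence of label and
    noise, so the squared norm has mean [n * b * d]. The slack [c] allows 1 in place of [1 - p] for
    the majority class. *)
Lemma outer_noise_sum (y b c delta : R) : Ex Q (label_is y) = b -> b <= c -> 0 < n%:R * c * d%:R ->
  0 < delta ->
  outer_le P [set w | delta * Num.sqrt (n%:R * c * d%:R) <
      nrm (noise_sum mu (X w) (fun i => (tnth (X w) i).2 == y))] (delta ^- 2).
Proof.
move=> bE bc ncd delta0.
pose f j s := label_is y s * noise_coord mu j s.
have mtn j : measurable_fun setT (fun t : d.-tuple R => tnth t j) by exact: measurable_tnth.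
have nL j : L1 Q (noise_coord mu j).
  exact: (subgaussian_L1 (psi2_scale_gt0 C) (measurable_noise_coord mu j) (noise_exp HQ j).1).
have fL j : L1 Q (f j) /\ Ex Q (f j) = 0.
  have [h1 h2] := label_noise_Ex HQ y (mtn j) (nL j).
  by split=> //; rewrite /f h2 (noise_mean0 HQ) mulr0.
have f2E j s : f j s ^+ 2 = label_is y s * noise_coord mu j s ^+ 2.
  by rewrite /f exprMn; congr (_ * _); rewrite /label_is; case: eqP => _; rewrite ?expr1n ?expr0n.
have f2L j : L1 Q (fun s => f j s ^+ 2) /\ Ex Q (fun s => f j s ^+ 2) = b.
  have m2 : measurable_fun setT (fun t : d.-tuple R => tnth t j ^+ 2) by exact: measurable_funX.
  have [h1 h2] := label_noise_Ex HQ y m2 (noise_L1_sqr HQ j).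
  split; first by apply: eq_L1 h1 => s; rewrite f2E.
  by rewrite (eq_Ex _ (f2E j)) h2 bE (noise_var1 HQ) mulr1.
have mf j : measurable_fun setT (f j) by exact: (L1_measurable (fL j).1).
have S j := iid_sum_sqr (mf j) (fL j).1 (f2L j).1 (fL j).2.
pose F w := \sum_j (\sum_i f j (Xi i w)) ^+ 2.
have FL : L1 P F by apply: L1_sum => j; exact: (S j).1.
have FE : Ex P F = n%:R * b * d%:R.
  rewrite Ex_sum; last by move=> j; exact: (S j).1.
  rewrite (eq_bigr (fun=> n%:R * b)); last by move=> j _; rewrite (S j).2 (f2L j).2.
  by rewrite sumr_const card_ord mulr_natr.
apply: outer_leS (lexx _) (outer_le_markov (t := delta ^+ 2 * (n%:R * c * d%:R)) FL _ _ _)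
  => [w|w||]; last 3 first.
- by apply: sumr_ge0 => j _; exact: sqr_ge0.
- by rewrite mulr_gt0// exprn_gt0.
- rewrite mulrA mulVf ?gt_eqF ?exprn_gt0// mul1r FE.
  by rewrite ler_wpM2r// ler_wpM2l.
move=> /= h.
have -> : F w = nrm (noise_sum mu (X w) (fun i => (tnth (X w) i).2 == y)) ^+ 2.
  by rewrite nrm_sqr; apply: eq_bigr => j _; rewrite noise_sumE expr2.
rewrite -[X in _ * X](sqr_sqrtr (ltW ncd)) -exprMn ltr_sqr ?nnegrE ?nrm_ge0//.
by rewrite mulr_ge0 ?sqrtr_ge0// ltW.
Qed.

Lemma outer_tail (u : 'I_d -> R) (delta : R) :
  outer_le P [set w | exists i, delta * nrm u < `|dot (noise_of mu (X w) i) u|]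
    (n%:R * tail C delta).
Proof.
apply: (outer_le_ex (card_ord n)) => i.
have mS : measurable [set s : d.-tuple R * R | delta * nrm u < `|dot u (tnth (noise mu s))|].
  apply: measurable_lt_set => //; apply: measurableT_comp => //.
  by apply: measurable_dot => j //; exact: measurable_noise_coord.
apply: outer_leS (lexx _) (outer_le_measurable (A := Xi i @^-1` [set s : d.-tuple R * R |
    delta * nrm u < `|dot u (tnth (noise mu s))|]) _ _).
- by move=> w /=; rewrite dotC.
- by rewrite -[X in measurable X]setTI; exact: mXi.
- rewrite Xlaw//; exact: (noise_tail HQ u delta).
Qed.

Lemma outer_coord (delta : R) :
  outer_le P [set w | exists i j, delta < `|noise_of mu (X w) i j|]
    (d%:R * (n%:R * tail C delta)).
Proof.
have := outer_le_ex (P := P) (A := fun (j : 'I_d) w => exists i : 'I_n, delta < `|noise_of mu (X w) i j|)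
  (e := n%:R * tail C delta) (card_ord d).
move=> h; apply: outer_leS (lexx _) (h _); first by move=> w /= [i [j H]]; exists j, i.
move=> j; apply: outer_leS (lexx _) (outer_tail (fun k => (k == j)%:R) delta).
have dj (v : 'I_d -> R) : dot v (fun k => (k == j)%:R) = v j.
  rewrite /dot (bigD1 j)//= eqxx mulr1 big1 ?addr0// => k /negbTE ->.
  by rewrite mulr0.
move=> w /= [i H]; exists i; rewrite dj.
by rewrite /nrm dj eqxx sqrtr1 mulr1.
Qed.

(** Markov for the sum of squared deviations over minority points, whose mean is of order
    [n * p * d]. One inequality covers all these points, at the price of the factor [n * p] under
    the root, which [good_zpos] can afford. *)
Lemma outer_norm (delta : R) : 0 < p -> 0 < n%:R * p * d%:R -> 0 < delta ->
  outer_le P [set w | exists2 i, is_pos (X w) i & delta * Num.sqrt (n%:R * p * d%:R) <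
      `|dot (noise_of mu (X w) i) (noise_of mu (X w) i) - d%:R|]
    (8 * psi2_scale C ^+ 4 / delta ^+ 2).
Proof.
move=> p0 npd delta0.
pose g (t : d.-tuple R) := (dot (tnth t) (tnth t) - d%:R) ^+ 2.
have mg : measurable_fun setT g.
  apply: measurable_funX; apply: measurable_funB => //.
  by apply: measurable_dot => j; exact: measurable_tnth.
have [g1 g2] := noise_norm_dev HQ.
have [h1 h2] := label_noise_Ex HQ 1 mg g1.
pose f s := label_is 1 s * g (noise mu s).
have f0 s : 0 <= f s by rewrite mulr_ge0// ?sqr_ge0// /label_is ler0n.
have fL i : L1 P (f \o Xi i) by exact: (has_law_L1 (mXi i) (Xlaw i) h1).
have FL : L1 P (fun w => \sum_i f (Xi i w)) by exact: L1_sum.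
have FE : Ex P (fun w => \sum_i f (Xi i w)) <= n%:R * p * d%:R * (8 * psi2_scale C ^+ 4).
  rewrite Ex_sum//.
  apply: (@le_trans _ _ (\sum_(i < n) (p * (8 * psi2_scale C ^+ 4 * d%:R)))).
    apply: ler_sum => i _; rewrite (has_law_Ex (mXi i) (Xlaw i) h1) h2 (label_pos_Ex HQ).
    by rewrite ler_wpM2l// ltW.
  by rewrite sumr_const card_ord -mulr_natl; lra.
apply: outer_leS (lexx _) (outer_le_markov (t := delta ^+ 2 * (n%:R * p * d%:R)) FL _ _ _)
  => [w|w||]; last 3 first.
- exact: sumr_ge0.
- by rewrite mulr_gt0// exprn_gt0.
- rewrite mulrA divfK ?gt_eqF ?exprn_gt0//; lra.
move=> /= [i pi h]; rewrite (bigD1 i)//=.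
apply: (@lt_le_trans _ _ (f (Xi i w))); last by rewrite lerDl sumr_ge0.
have -> : f (Xi i w) = (dot (noise_of mu (X w) i) (noise_of mu (X w) i) - d%:R) ^+ 2.
  by rewrite /f /label_is /Xi (eqP pi) eqxx mul1r.
rewrite -[X in _ * X](sqr_sqrtr (ltW npd)) -exprMn -(real_normK (num_real (_ - _))).
by rewrite ltr_sqr ?nnegrE// mulr_ge0 ?sqrtr_ge0// ltW.
Qed.

(** The sum [V] skips point [i], so it is unchanged when that point is overwritten and is
    independent of its noise. With [V] frozen, the tail bound for linear forms applies, and a union
    bound over [i] concludes. *)
Lemma outer_cross (delta : R) :
  outer_le P [set w | exists i,
     delta * nrm (noise_sum mu (X w) (fun k => is_pos (X w) k && (k != i))) <
     `|dot (noise_of mu (X w) i) (noise_sum mu (X w) (fun k => is_pos (X w) k && (k != i)))|]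
    (n%:R * tail C delta).
Proof.
apply: (outer_le_ex (card_ord n)) => i.
pose s0 : d.-tuple R * R := point.
pose Y w := replace i s0 [tuple Xi k w | k < n].
have mY : measurable_fun setT Y.
  exact: (measurableT_comp (measurable_replace i s0) (measurable_mktuple mXi)).
have ind : independent P Y (Xi i) by exact: leave_one_out.
pose V (D : n.-tuple (d.-tuple R * R)) := noise_sum mu D (fun k => is_pos D k && (k != i)).
have VE w : V (Y w) = V (X w).
  have E k : k != i -> tnth (Y w) k = tnth (X w) k.
    by move=> /negbTE ki; rewrite !tnth_mktuple ki.
  apply/funext => j; rewrite /V /noise_sum.
  apply: eq_big => k; last by move=> /andP[_ ki]; rewrite /noise_of E.
  by rewrite /is_pos; case: (boolP (k != i)) => [/E ->//|]; rewrite !andbF.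
have mV j : measurable_fun setT (fun D => V D j).
  rewrite (_ : (fun D => V D j) = fun D => \sum_(k < n | k != i) (label_is 1 (tnth D k) * noise_coord mu j (tnth D k))).
    apply: measurable_sum_cond => k; apply: measurable_funM.
      apply: measurable_eqr_nat; apply: measurableT_comp => //; exact: measurable_tnth.
    by apply: (measurableT_comp (measurable_noise_coord mu j)); exact: measurable_tnth.
  apply/funext => D; rewrite /V /noise_sum [LHS]big_mkcond [RHS]big_mkcond.
  apply: eq_bigr => k _; rewrite /label_is /is_pos.
  by case: eqP => _; case: (k != i); rewrite /= ?mul1r ?mul0r.
pose S : set (n.-tuple (d.-tuple R * R) * (d.-tuple R * R)) :=
  [set x | delta * nrm (V x.1) < `|dot (V x.1) (tnth (noise mu x.2))|].
have mV1 j : measurable_fun setT (fun x : n.-tuple (d.-tuple R * R) * (d.-tuple R * R) => V x.1 j).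
  exact: (measurableT_comp (mV j)).
have mS : measurable S.
  apply: measurable_lt_set.
    by apply: measurable_funM => //; exact: measurable_nrm.
  apply: measurableT_comp => //; apply: measurable_dot => // j.
  exact: (measurableT_comp (measurable_noise_coord mu j)).
have mYX : measurable_fun setT (fun w => (Y w, Xi i w)) by exact: measurable_fun_pair.
apply: outer_leS (lexx _) (outer_le_measurable (A := [set w | S (Y w, Xi i w)]) _ _).
- by move=> w; rewrite /S /= VE dotC.
- by rewrite -[X in measurable X]setTI; exact: mYX.
- apply: (independent_le mY (mXi i) ind mS) => D.
  rewrite (_ : Xi i @^-1` _ = Xi i @^-1` [set s | delta * nrm (V D) < `|dot (V D) (tnth (noise mu s))|]); last first.
    by apply/seteqP; split => w /=; rewrite /xsection /= in_setE.
  rewrite Xlaw; first exact: (noise_tail HQ _ _).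
  apply: measurable_lt_set => //; apply: measurableT_comp => //.
  by apply: measurable_dot => j //; exact: measurable_noise_coord.
Qed.

Lemma outer_good_sample (delta : R) : (0 < n)%N -> (0 < d)%N -> 0 < p -> p <= 4^-1 -> 0 < delta ->
  outer_le P [set w | ~ good_sample mu (X w) p delta]
   (4 / (n%:R * p) + (16 / n%:R + (2 / delta ^+ 2 + (8 * psi2_scale C ^+ 4 / delta ^+ 2 +
     (d%:R + 2) * n%:R * tail C delta)))).
Proof.
move=> n0 d0 p0 p4 delta0.
have n0' : (0 : R) < n%:R by rewrite ltr0n.
have d0' : (0 : R) < d%:R by rewrite ltr0n.
have np0 : 0 < n%:R * p by rewrite mulr_gt0.
have O1 := outer_count (label_pos_Ex HQ) (divr_gt0 np0 (ltr0Sn R 1)).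
have O2 := outer_count (label_neg_Ex HQ) (divr_gt0 n0' (ltr0Sn R 3)).
have O3 := outer_noise_sum (label_pos_Ex HQ) (lexx p) (mulr_gt0 np0 d0') delta0.
have c1 : 1 - p <= 1 by lra.
have nd0 : 0 < n%:R * 1 * d%:R :> R by rewrite mulr1 mulr_gt0.
have O4 := outer_noise_sum (label_neg_Ex HQ) c1 nd0 delta0.
have O5 := outer_norm p0 (mulr_gt0 np0 d0') delta0.
have O6 := outer_tail (tnth mu) delta.
have O7 := outer_coord delta.
have O8 := outer_cross delta.
have := outer_leU O1 (outer_leU O2 (outer_leU O3 (outer_leU O4 (outer_leU O5 (outer_leU O6 (outer_leU O7 O8)))))).
apply: outer_leS; last first.
  have t0 : 0 <= n%:R * tail C delta by rewrite mulr_ge0// mulr_ge0// expR_ge0.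
  have e1 : n%:R * p / (n%:R * p / 2) ^+ 2 = 4 / (n%:R * p) by field; rewrite !gt_eqF.
  have e2 : n%:R * (1 - p) / (n%:R / 4) ^+ 2 = 16 * (1 - p) / n%:R by field; rewrite !gt_eqF.
  have e3 : 16 * (1 - p) / n%:R <= 16 / n%:R.
    by rewrite ler_pM2r ?invr_gt0//; lra.
  rewrite e1 e2; lra.
move=> w /= ng; apply: contrapT => H; apply: ng.
move: H => /not_orP[H1 /not_orP[H2 /not_orP[H3 /not_orP[H4 /not_orP[H5 /not_orP[H6 /not_orP[H7 H8]]]]]]].
split.
- by rewrite leNgt; apply/negP.
(* With [p <= 1/4] the expected majority count is at least [3n/4]; a deviation of [n/4] leaves
   [n/2]. *)
- move/negP: H2; rewrite -leNgt ler_norml => /andP[h _].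
  have h2 : n%:R * (3 / 4) <= n%:R * (1 - p) by rewrite ler_pM2l//; lra.
  by move: h; rewrite /is_neg; lra.
- by rewrite leNgt; apply/negP.
- by rewrite leNgt; apply/negP; rewrite -[n%:R in X in ~ X]mulr1.
- by move=> i; rewrite leNgt; apply/negP => h; apply: H6; exists i.
- by move=> i j; rewrite leNgt; apply/negP => h; apply: H7; exists i, j.
- by move=> i pi; rewrite leNgt; apply/negP => h; apply: H5; exists i.
- by move=> i; rewrite leNgt; apply/negP => h; apply: H8; exists i.
Qed.

End Sample.

(** * Test errors in a fixed dimension *)

Section TestErrors.
Context dd (T : measurableType dd) (R : realType) (P : probability T R) (d n : nat).
Variables (p : R) (mu : d.-tuple R) (C : R) (Q : probability (d.-tuple R * R)%type R).
Hypothesis HQ : is_2subGMM p mu C Q.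
Variable X : {RV P >-> n.-tuple (d.-tuple R * R)}.
Variable Y : {RV P >-> (d.-tuple R * R)%type}.
Hypothesis HX : iid_with_law P X Q.
Hypothesis HY : has_law P Y Q.
Hypothesis XY : independent P X Y.
Variable g : {mfun n.-tuple (d.-tuple R * R)%type >-> (d.-tuple R * R)%type}.
Hypotheses (p0 : 0 < p) (p1 : p < 1).

Let mX : measurable_fun setT X. Proof. by []. Qed.
Let mY : measurable_fun setT Y. Proof. by []. Qed.

(** Bad events are stated on the space of data sets, where the deterministic facts about a trained
    classifier apply to each point. *)
Definition data_law : probability (n.-tuple (d.-tuple R * R)) R := distribution P X.

Lemma iid_data_law : iid_with_law data_law (fun D : n.-tuple (d.-tuple R * R) => D) Q.
Proof.
case: HX => ind law; split.
  move=> J A mA; have := ind J A mA.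
  by rewrite /data_law /distribution /= /pushforward.
by move=> i A mA; exact: law.
Qed.

(** Over the measurable cover of the bad data sets the sections of [S] are emptied, at cost [e1];
    every other section has mass at most [e2], and independence integrates this bound. *)
Lemma split_test_le (S : set (n.-tuple (d.-tuple R * R) * (d.-tuple R * R)))
    (bad : set (n.-tuple (d.-tuple R * R))) (e1 e2 : R) :
  measurable S -> outer_le data_law bad e1 -> 0 <= e2 ->
  (forall D, ~ bad D -> (Q [set s | S (D, s)] <= e2%:E)%E) ->
  (P [set w | S (X w, Y w)] <= (e1 + e2)%:E)%E.
Proof.
move=> mS [B [mB badB Be]] e20 SQ.
have mXB : measurable (X @^-1` B) by rewrite -[X in measurable X]setTI; exact: mX.
have mXY : measurable_fun setT (fun w => (X w, Y w)) by exact: measurable_fun_pair.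
pose S' : set (n.-tuple (d.-tuple R * R) * (d.-tuple R * R)) := S `&` ((~` B) `*` setT).
have mS' : measurable S'.
  by apply: measurableI => //; apply: measurableX => //; exact: measurableC.
have mS1 : measurable [set w | S' (X w, Y w)].
  by rewrite -[X in measurable X]setTI; exact: (mXY measurableT _ mS').
have mS0 : measurable [set w | S (X w, Y w)].
  by rewrite -[X in measurable X]setTI; exact: (mXY measurableT _ mS).
apply: (@le_trans _ _ (P (X @^-1` B `|` [set w | S' (X w, Y w)]))).
  apply: le_measure; rewrite ?inE//; first exact: measurableU.
  move=> w Sw; have [Bw|Bw] := pselect (B (X w)); first by left.
  by right; split.
apply: (le_trans (measureU2 _ mXB mS1)); rewrite EFinD; apply: leeD; first exact: Be.
apply: (independent_le mX mY XY mS') => D.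
have mSD (U : set (n.-tuple (d.-tuple R * R) * (d.-tuple R * R))) :
    measurable U -> measurable (xsection U D) by exact: measurable_xsection.
rewrite HY; last exact: mSD.
have [BD|BD] := pselect (B D).
  rewrite (_ : xsection S' D = set0) ?measure0 ?lee_fin//.
  by apply/seteqP; split => s //; rewrite /xsection /= in_setE => -[_ []].
apply: le_trans (SQ D _); last by move=> /badB.
apply: le_measure; rewrite ?inE; [exact: mSD| |].
  by have := mSD _ mS; congr measurable; apply/seteqP; split=> s; rewrite /xsection /= in_setE.
by move=> s; rewrite /xsection /= in_setE => -[].
Qed.

(** The test label is independent of the test noise and of the training data, so conditioning on it
    does not affect an event in these two. Both errors thus become unconditional probabilities over
    the same noise. *)
Lemma cond_label (S : set (n.-tuple (d.-tuple R * R) * d.-tuple R)) (y q : R) :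
  measurable S -> Q [set s | s.2 = y] = q%:E -> 0 < q ->
  (fine (P ([set w | S (X w, noise mu (Y w))] `&` [set w | (Y w).2 = y])) /
   fine (P [set w | (Y w).2 = y])) = fine (P [set w | S (X w, noise mu (Y w))]).
Proof.
move=> mS Qy q0.
have mYy : measurable [set s : d.-tuple R * R | s.2 = y] by exact: measurable_label.
have -> : P [set w | (Y w).2 = y] = q%:E by rewrite -Qy -HY.
have mN : measurable_fun setT (fun x : n.-tuple (d.-tuple R * R) * (d.-tuple R * R) => (x.1, noise mu x.2)).
  by apply: measurable_fun_pair => //; exact: (measurableT_comp (measurable_noise mu)).
pose S1 : set (n.-tuple (d.-tuple R * R) * (d.-tuple R * R)) := [set x | S (x.1, noise mu x.2)].
pose S2 : set (n.-tuple (d.-tuple R * R) * (d.-tuple R * R)) := S1 `&` (setT `*` [set s | s.2 = y]).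
have mS1 : measurable S1 by rewrite -[X in measurable X]setTI; exact: (mN measurableT _ mS).
have mS2 : measurable S2 by apply: measurableI => //; exact: measurableX.
have E1 := independent_xsection mX mY XY mS1.
have E2 := independent_xsection mX mY XY mS2.
have S2E D : P (Y @^-1` xsection S2 D) = (q%:E * P (Y @^-1` xsection S1 D))%E.
  rewrite !HY; [|exact: measurable_xsection|exact: measurable_xsection].
  have := gmm_noise_label HQ (A := xsection S D) (B := [set y]).
  rewrite -Qy muleC => h.
  rewrite (_ : xsection S2 D = noise mu @^-1` xsection S D `&` snd @^-1` [set y]); last first.
    by apply/seteqP; split => s; rewrite /xsection /= !in_setE => -[h1 h2]; split=> //; case: h2.
  rewrite (_ : xsection S1 D = noise mu @^-1` xsection S D); last first.
    by apply/seteqP; split => s; rewrite /xsection /= !in_setE.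
  by rewrite h//; exact: measurable_xsection.
have mP1 : measurable_fun setT (fun w => P (Y @^-1` xsection S1 (X w))).
  rewrite (_ : (fun w => _) = (distribution P Y \o xsection S1) \o X)//.
  by apply: measurableT_comp => //; exact: measurable_fun_xsection.
have E : P ([set w | S (X w, noise mu (Y w))] `&` [set w | (Y w).2 = y]) =
    (q%:E * P [set w | S (X w, noise mu (Y w))])%E.
  transitivity (P [set w | S2 (X w, Y w)]).
    by congr (P _); apply/seteqP; split => w /= [h1 h2]; split=> //; case: h2.
  rewrite E2; under eq_integral do rewrite S2E.
  rewrite ge0_integralZl//=; first by rewrite -E1.
  by rewrite lee_fin ltW.
rewrite E fineM//=; last first.
  apply: fin_num_measure; rewrite -[X in measurable X]setTI.
  have mXY : measurable_fun setT (fun w => (X w, Y w)) by exact: measurable_fun_pair.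
  exact: (mXY measurableT _ mS1).
by rewrite mulrAC divff ?gt_eqF// mul1r.
Qed.

Let beta (D : n.-tuple (d.-tuple R * R)) : 'I_d -> R := tnth (g D).1.
Let b0 (D : n.-tuple (d.-tuple R * R)) : R := (g D).2.
Let m (D : n.-tuple (d.-tuple R * R)) : R := dot (tnth mu) (beta D).

Let mg : measurable_fun setT g. Proof. by []. Qed.
Let mbeta j : measurable_fun setT (fun D => beta D j).
Proof. by apply: measurable_tnth_comp; exact: (measurableT_comp measurable_fst mg). Qed.
Let mb0 : measurable_fun setT b0.
Proof. exact: (measurableT_comp measurable_snd mg). Qed.
Let mm : measurable_fun setT m.
Proof. by apply: measurable_dot => // j; exact: measurable_cst. Qed.

Let proj (x : n.-tuple (d.-tuple R * R) * d.-tuple R) : R := dot (tnth x.2) (beta x.1) + b0 x.1.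

Let mproj : measurable_fun setT proj.
Proof.
apply: measurable_funD; last exact: (measurableT_comp mb0).
apply: measurable_dot => j; first exact: measurable_tnth_comp.
exact: (measurableT_comp (mbeta j)).
Qed.

Let mm1 : measurable_fun setT (fun x : n.-tuple (d.-tuple R * R) * d.-tuple R => m x.1).
Proof. exact: (measurableT_comp mm). Qed.

Let Spos : set (n.-tuple (d.-tuple R * R) * d.-tuple R) := [set x | m x.1 + proj x <= 0].
Let Sneg : set (n.-tuple (d.-tuple R * R) * d.-tuple R) := [set x | 0 < - m x.1 + proj x].

Let mSpos : measurable Spos.
Proof. by apply: measurable_le_set => //; exact: measurable_funD. Qed.

Let mSneg : measurable Sneg.
Proof.
apply: measurable_lt_set => //; apply: measurable_funD => //.
exact: measurableT_comp.
Qed.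

Let scoreE w y : (Y w).2 = y -> score (g (X w)) (Y w).1 =
  y * m (X w) + proj (X w, noise mu (Y w)).
Proof.
move=> Yy; rewrite /score /proj /= addrA; congr (_ + _).
rewrite /m -dotZl -dotDl; apply: eq_bigr => j _.
by rewrite /noise tnth_mktuple Yy /beta /=; ring.
Qed.

Lemma err_posE : err_pos P (g \o X) Y = fine (P [set w | Spos (X w, noise mu (Y w))]).
Proof.
rewrite /err_pos /cond_prob -(@cond_label _ 1 p)//; last by case: HQ.
congr (fine (P _) / _); apply/seteqP; split => w /= [h1 h2]; split=> //; move: h1; rewrite (scoreE h2);
  by rewrite /Spos /= mul1r.
Qed.

Lemma err_negE : err_neg P (g \o X) Y = fine (P [set w | Sneg (X w, noise mu (Y w))]).
Proof.
rewrite /err_neg /cond_prob -(@cond_label _ (-1) (1 - p))//; [|by case: HQ|by rewrite subr_gt0].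
congr (fine (P _) / _); apply/seteqP; split => w /= [h1 h2]; split=> //; move: h1; rewrite (scoreE h2);
  by rewrite /Sneg /= mulN1r.
Qed.

Let lift (S : set (n.-tuple (d.-tuple R * R) * d.-tuple R)) :
  set (n.-tuple (d.-tuple R * R) * (d.-tuple R * R)) := [set x | S (x.1, noise mu x.2)].

Let mlift S : measurable S -> measurable (lift S).
Proof.
move=> mS; rewrite -[X in measurable X]setTI.
have mN : measurable_fun setT (fun x : n.-tuple (d.-tuple R * R) * (d.-tuple R * R) => (x.1, noise mu x.2)).
  by apply: measurable_fun_pair => //; exact: (measurableT_comp (measurable_noise mu)).
exact: (mN measurableT _ mS).
Qed.

Let mevent S : measurable S -> measurable [set w | S (X w, noise mu (Y w))].
Proof.
move=> /mlift mS; rewrite -[X in measurable X]setTI.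
have mXY : measurable_fun setT (fun w => (X w, Y w)) by exact: measurable_fun_pair.
exact: (mXY measurableT _ mS).
Qed.

Let le_fine A (e : R) : measurable A -> (P A <= e%:E)%E -> fine (P A) <= e.
Proof. by move=> mA h; rewrite -lee_fin -prob_finite. Qed.

Lemma noise_large (u : 'I_d -> R) (L : R) : 0 < L -> nrm u <= 1 ->
  (Q [set s | (L <= `|dot (tnth (noise mu s)) u|)%R] <= (L ^- 2)%:E)%E.
Proof.
move=> L0 u1; have [h1 h2] := noise_linear_sqr HQ u.
have := markov_ge h1 (fun w => sqr_ge0 _) (exprn_gt0 2 L0).
rewrite h2 => h; apply: (@le_trans _ _ (nrm u ^+ 2 / L ^+ 2)%:E); last first.
  rewrite lee_fin ler_pdivrMr ?exprn_gt0// mulVf ?gt_eqF ?exprn_gt0//.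
  by rewrite expr_le1// nrm_ge0.
have E a : (L ^+ 2 <= a ^+ 2) = (L <= `|a|).
  by rewrite -(real_normK (num_real a)) ler_sqr ?nnegrE// ltW.
by move: h; congr (is_true (Q _ <= _)%E); apply/seteqP; split=> s /=; rewrite dotC E.
Qed.

Lemma err_pos_le1 : err_pos P (g \o X) Y <= 1.
Proof. by rewrite err_posE; apply: le_fine; [exact: mevent|apply: probability_le1; exact: mevent]. Qed.

Lemma err_pos_le (L e : R) : 0 < L ->
  outer_le data_law [set D | ~ (nrm (beta D) <= 1 /\ L <= m D + b0 D)] e ->
  err_pos P (g \o X) Y <= e + L ^- 2.
Proof.
move=> L0 he; rewrite err_posE; apply: le_fine; first exact: mevent.
have L2 : 0 <= L ^- 2 by rewrite invr_ge0 exprn_ge0// ltW.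
apply: (split_test_le (mlift mSpos) he L2) => D /=.
move=> /contrapT[b1 Lm]; apply: le_trans (noise_large L0 b1).
apply: le_measure; rewrite ?inE.
- by have := measurable_xsection D (mlift mSpos); congr measurable; apply/seteqP; split=> s; rewrite /xsection /= in_setE.
- apply: measurable_le_set => //; apply: measurableT_comp => //.
  by apply: measurable_dot => j //; exact: measurable_noise_coord.
- move=> s; rewrite /lift /Spos /proj /= => h.
  by rewrite ler_normr; apply/orP; right; lra.
Qed.

Lemma err_neg_le (L e : R) : 0 < L ->
  outer_le data_law [set D | ~ (nrm (beta D) <= 1 /\ L <= m D - b0 D)] e ->
  err_neg P (g \o X) Y <= e + L ^- 2.
Proof.
move=> L0 he; rewrite err_negE; apply: le_fine; first exact: mevent.
have L2 : 0 <= L ^- 2 by rewrite invr_ge0 exprn_ge0// ltW.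
apply: (split_test_le (mlift mSneg) he L2) => D /=.
move=> /contrapT[b1 Lm]; apply: le_trans (noise_large L0 b1).
apply: le_measure; rewrite ?inE.
- by have := measurable_xsection D (mlift mSneg); congr measurable; apply/seteqP; split=> s; rewrite /xsection /= in_setE.
- apply: measurable_le_set => //; apply: measurableT_comp => //.
  by apply: measurable_dot => j //; exact: measurable_noise_coord.
- move=> s; rewrite /lift /Sneg /proj /= => h.
  by rewrite ler_normr; apply/orP; left; lra.
Qed.

Let measurable_compl A : measurable A -> 1 - fine (P A) = fine (P (~` A)).
Proof.
move=> mA; apply: EFin_inj; rewrite EFinB -!prob_finite//; last exact: measurableC.
by rewrite probability_setC.
Qed.

Lemma err_pos_ge (L e : R) : 0 < L ->
  outer_le data_law [set D | ~ (nrm (beta D) <= 1 /\ m D + b0 D <= - L)] e ->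
  1 - (e + L ^- 2) <= err_pos P (g \o X) Y.
Proof.
move=> L0 he; rewrite lerBlDr addrC -lerBlDr err_posE measurable_compl; last exact: mevent.
apply: le_fine; first by apply: measurableC; exact: mevent.
have L2 : 0 <= L ^- 2 by rewrite invr_ge0 exprn_ge0// ltW.
have mC : measurable (~` Spos) by exact: measurableC.
apply: (split_test_le (mlift mC) he L2) => D /=.
move=> /contrapT[b1 Lm]; apply: le_trans (noise_large L0 b1).
apply: le_measure; rewrite ?inE.
- by have := measurable_xsection D (mlift mC); congr measurable; apply/seteqP; split=> s; rewrite /xsection /= in_setE.
- apply: measurable_le_set => //; apply: measurableT_comp => //.
  by apply: measurable_dot => j //; exact: measurable_noise_coord.
- move=> s; rewrite /lift /Spos /proj /= => /negP; rewrite -ltNge => h.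
  by rewrite ler_normr; apply/orP; left; lra.
Qed.

(** For the same noise, the minority score is [m + proj] and the majority score is [- m + proj]. If
    both are on the correct side then [|proj| <= |m|]; otherwise at least one error occurs. Hence
    the two errors sum to at least 1 minus the probability of this window, whatever the
    intercept. *)
Lemma err_bal_ge (eta e : R) : 0 <= eta ->
  outer_le data_law [set D | ~ (Q [set s | (`|dot (tnth (noise mu s)) (beta D) + b0 D| <= `|m D|)%R] <= eta%:E)%E] e ->
  2^-1 - 2^-1 * (e + eta) <= err_bal P (g \o X) Y.
Proof.
move=> eta0 he.
pose Sw : set (n.-tuple (d.-tuple R * R) * d.-tuple R) := [set x | `|proj x| <= `|m x.1|].
have mSw : measurable Sw by apply: measurable_le_set; exact: measurableT_comp.
have hw : (P [set w | Sw (X w, noise mu (Y w))] <= (e + eta)%:E)%E.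
  by apply: (split_test_le (mlift mSw) he eta0) => D /= /contrapT.
suff : 1 - (e + eta) <= err_pos P (g \o X) Y + err_neg P (g \o X) Y by rewrite /err_bal; lra.
rewrite err_posE err_negE.
set A1 := [set w | Spos _]; set A2 := [set w | Sneg _].
have mA1 : measurable A1 by exact: mevent.
have mA2 : measurable A2 by exact: mevent.
have mA3 : measurable [set w | Sw (X w, noise mu (Y w))] by exact: mevent.
have : (P setT <= P (A1 `|` A2 `|` [set w | Sw (X w, noise mu (Y w))]))%E.
  apply: le_measure; rewrite ?inE//.
    by apply: measurableU => //; exact: measurableU.
  move=> w _; rewrite /A1 /A2 /Spos /Sneg /Sw /=.
  case: (leP (m (X w) + proj (X w, noise mu (Y w))) 0) => h1; first by left; left.
  case: (ltP 0 (- m (X w) + proj (X w, noise mu (Y w)))) => h2; first by left; right.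
  right; rewrite ler_normr; apply/orP; left; rewrite ler_norml; apply/andP; split; lra.
rewrite probability_setT => h.
have {}h := le_trans h (measureU2 _ (measurableU _ _ mA1 mA2) mA3).
have {}h : (1 <= P A1 + P A2 + (e + eta)%:E)%E.
  exact: le_trans h (leeD (measureU2 _ mA1 mA2) hw).
rewrite (prob_finite P mA1) (prob_finite P mA2) -!EFinD lee_fin in h.
lra.
Qed.

End TestErrors.

Section FixedDimension.
Context dd (T : measurableType dd) (R : realType) (P : probability T R) (d n : nat).
Variables (p : R) (mu : d.-tuple R) (C : R) (Q : probability (d.-tuple R * R)%type R).
Hypothesis HQ : is_2subGMM p mu C Q.
Variable X : {RV P >-> n.-tuple (d.-tuple R * R)}.
Variable Y : {RV P >-> (d.-tuple R * R)%type}.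
Hypothesis HX : iid_with_law P X Q.
Hypothesis HY : has_law P Y Q.
Hypothesis XY : independent P X Y.
Variable g : {mfun n.-tuple (d.-tuple R * R)%type >-> (d.-tuple R * R)%type}.
Variable tau : R.
Hypothesis tau0 : 0 < tau.
Hypothesis Hg : is_svm tau g.
Hypotheses (n0 : (0 < n)%N) (d0 : (0 < d)%N) (p0 : 0 < p) (p4 : p <= 4^-1).

Let p1 : p < 1. Proof. by apply: le_lt_trans p4 _; lra. Qed.

Variable delta : R.
Hypothesis delta1 : 1 <= delta.

Definition bad_prob : R :=
  4 / (n%:R * p) + (16 / n%:R + (2 / delta ^+ 2 + (8 * psi2_scale C ^+ 4 / delta ^+ 2 +
     (d%:R + 2) * n%:R * tail C delta))).

Let e := bad_prob.
Let delta0 : 0 < delta. Proof. exact: lt_le_trans delta1. Qed.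

Let good_event : outer_le (data_law X) [set D | ~ good_sample mu D p delta] e.
Proof.
exact: (outer_good_sample HQ (X := fun D : n.-tuple (d.-tuple R * R) => D) _ (iid_data_law HX)).
Qed.

Let beta (D : n.-tuple (d.-tuple R * R)) : 'I_d -> R := tnth (g D).1.
Let b0 (D : n.-tuple (d.-tuple R * R)) : R := (g D).2.
Let m (D : n.-tuple (d.-tuple R * R)) : R := dot (tnth mu) (beta D).

Let good_margin D : good_sample mu D p delta -> exists kap,
  max_margin (is_pos D) (is_neg D) (tnth mu) (noise_of mu D) tau (b0 D) kap (beta D).
Proof.
move=> G; have [kap sol] := Hg (good_two_class G n0 p0).
by exists kap; exact: svm_solution_max_margin.
Qed.

Let good_outer (A : set (n.-tuple (d.-tuple R * R))) :
  (forall D, good_sample mu D p delta -> A D) -> outer_le (data_law X) [set D | ~ A D] e.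
Proof.
move=> GA; apply: outer_leS (lexx _) good_event => D /= nA G; exact: nA (GA _ G).
Qed.

Let mun := nrm (tnth mu).

Lemma high_signal_errors (L : R) : 0 < L -> 1 <= tau -> 0 < mun ->
  L <= mun - delta - 2 * delta * Num.sqrt (d%:R / (n%:R * p)) ->
  L <= (mun - delta) / tau - 2 * delta * Num.sqrt (d%:R / n%:R) ->
  err_pos P (g \o X) Y <= e + L ^- 2 /\ err_neg P (g \o X) Y <= e + L ^- 2.
Proof.
move=> L0 tau1 mu0 L1 L2.
have H D : good_sample mu D p delta ->
    [/\ nrm (beta D) <= 1, L <= m D + b0 D & L <= m D - b0 D].
  move=> G; have [kap mm] := good_margin G.
  have N0 := good_pos_count_gt0 G n0 p0; have Nm0 := good_neg_count_gt0 G n0.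
  have h1 := margin_high mm mu0 (good_dot_mu G).
  have [h2 h3] := high_scores mm N0 Nm0.
  have hp := good_pos_mean G n0 p0; have hq := good_neg_mean G n0.
  have r0 : 0 <= 2 * delta * Num.sqrt (d%:R / (n%:R * p)).
    by rewrite mulr_ge0 ?sqrtr_ge0// mulr_ge0// ltW.
  have md : 0 <= mun - delta by lra.
  (* From [tau >= 1] comes [2 * tau >= 1 + tau], so the minority class gets at least half of the
     total margin. *)
  have tk : mun - delta <= tau * kap.
    have t1 : 0 < 1 + tau by lra.
    rewrite -(ler_pM2l t1) mulrCA; have := ler_wpM2l (ltW tau0) h1.
    by have := ler_wpM2r md tau1; rewrite -/mun; lra.
  have k1 : (mun - delta) / tau <= kap by rewrite ler_pdivrMr// [leRHS]mulrC.
  split; first by case: mm.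
    by rewrite /m; lra.
  by rewrite /m; lra.
split.
  by apply: (err_pos_le HQ HY XY p0 L0); apply: good_outer => D /H[].
by apply: (err_neg_le HQ HY XY p1 L0); apply: good_outer => D /H[].
Qed.

Variables (rho s : R).
Hypotheses (s0 : 0 < s) (rhoE : rho = s ^+ 2) (rho2 : rho ^+ 2 = d%:R / (n%:R * p)).
Hypotheses (np1 : 1 <= n%:R * p) (delta_rho : 768 * delta ^+ 2 <= rho).
Hypothesis mu_rho : mun <= rho / 8.
Hypothesis q1 : 2 * delta * Num.sqrt (d%:R / n%:R) <= 1.

Let rho0 : 0 < rho. Proof. by rewrite rhoE exprn_gt0. Qed.
Let drho : delta <= rho.
Proof. by apply: le_trans delta_rho; have := delta1; nra. Qed.

Section WeakConsequences.
Variable D : n.-tuple (d.-tuple R * R).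
Hypothesis G : good_sample mu D p delta.

Let N0 := good_pos_count_gt0 G n0 p0.
Let Nm0 := good_neg_count_gt0 G n0.
Let zneg := good_zneg G n0 p0.
Let zpos := good_zpos G n0 p0 rho0 rho2 np1 delta1 drho.
Let D1 := (good_density G n0 p0 rho2).1.
Let D2 := (good_density G n0 p0 rho2).2.
Let qD : nrm (mean_of (noise_of mu D) (is_neg D)) <= 1.
Proof. exact: le_trans (good_neg_mean G n0) q1. Qed.
Let zmu := good_dot_mu G.

(** The minority score is at least [2 * m - 96 * delta ^+ 2 - kap], which asks for small [kap],
    hence large [tau]; the majority score is at least [kap - 1], which asks for [tau] small against
    [rho]. The two hypotheses on [L] express these demands. *)
Lemma sample_weak_good_tau (L : R) : delta <= mun -> 168 * delta * s <= mun ->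
  L <= mun ^+ 2 / (3 * rho) - 96 * delta ^+ 2 - 4 * rho / tau ->
  L <= (rho / 8) / (1 + tau) - 1 ->
  [/\ nrm (beta D) <= 1, L <= m D + b0 D & L <= m D - b0 D].
Proof.
move=> dm sm L1 L2; have [kap mm] := good_margin G.
have t1 : 0 < 1 + tau by rewrite addr_gt0.
have h1 := weak_m_ge mm N0 Nm0 delta1 s0 rhoE zmu zneg zpos D1 D2 delta_rho mu_rho qD dm sm.
have h2 := weak_pos_score_ge mm N0 delta1 s0 rhoE zmu zneg zpos D1 D2 delta_rho mu_rho.
have h3 := weak_neg_score_ge mm Nm0 qD.
have h4 := weak_kap_ge mm N0 delta1 s0 rhoE zmu zneg zpos D1 D2 delta_rho mu_rho.
have h5 := weak_kap_le mm N0 Nm0 delta1 s0 rhoE zpos D1 D2 delta_rho mu_rho qD.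
have k1 : rho / 8 / (1 + tau) <= kap by rewrite ler_pdivrMr// [leRHS]mulrC.
have k0 : 0 <= kap by apply: le_trans k1; rewrite !divr_ge0// ltW.
have k2 : kap <= 4 * rho / tau.
  rewrite ler_pdivlMr//; move: h5; lra.
have e6 : 2 * (mun ^+ 2 / (6 * rho)) = mun ^+ 2 / (3 * rho) by field; rewrite gt_eqF.
split; first by case: mm.
  by rewrite /m; move: h1 h2; rewrite -/mun; lra.
by rewrite /m; lra.
Qed.

Lemma sample_weak_bounded_tau (L : R) :
  L <= (rho / 8) / (1 + tau) - 2 * mun - 1 ->
  [/\ nrm (beta D) <= 1, m D + b0 D <= - L & L <= m D - b0 D].
Proof.
move=> L1; have [kap mm] := good_margin G.
have t1 : 0 < 1 + tau by rewrite addr_gt0.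
have h2 := weak_pos_score_le mm Nm0 qD.
have h3 := weak_neg_score_ge mm Nm0 qD.
have h4 := weak_kap_ge mm N0 delta1 s0 rhoE zmu zneg zpos D1 D2 delta_rho mu_rho.
have k1 : rho / 8 / (1 + tau) <= kap by rewrite ler_pdivrMr// [leRHS]mulrC.
have mu0 := nrm_ge0 (tnth mu).
split; first by case: mm.
  by rewrite /m; move: h2; rewrite -/mun; lra.
by rewrite /m; move: mu0; rewrite -/mun; lra.
Qed.

Lemma noise_large_sqr (u : 'I_d -> R) (h r : R) : 0 < h -> nrm u <= r ->
  (Q [set x | (h <= `|dot (tnth (noise mu x)) u|)%R] <= (r ^+ 2 / h ^+ 2)%:E)%E.
Proof.
move=> h0 ur; have [h1 h2] := noise_linear_sqr HQ u.
have := markov_ge h1 (fun w => sqr_ge0 _) (exprn_gt0 2 h0).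
rewrite h2 => H; apply: (@le_trans _ _ (nrm u ^+ 2 / h ^+ 2)%:E); last first.
  rewrite lee_fin ler_pM2r ?invr_gt0 ?exprn_gt0// ler_sqr ?nnegrE ?nrm_ge0//.
  exact: le_trans (nrm_ge0 _) ur.
have E a : (h ^+ 2 <= a ^+ 2) = (h <= `|a|).
  by rewrite -(real_normK (num_real a)) ler_sqr ?nnegrE// ltW.
by move: H; congr (is_true (Q _ <= _)%E); apply/seteqP; split=> x /=; rewrite dotC E.
Qed.

(** The noise is projected on [v] and on [beta - v] separately. The second projection is below [h]
    except for a Chebyshev term; the first must then lie within [h + |m|] of [- b0], which
    anti-concentration makes unlikely. *)
Lemma sample_low_signal (H h : R) (M : nat) : 0 < H -> (0 < M)%N -> 0 < h ->
  h + (4 * (2 * mun ^+ 2 + delta * mun) / rho + mun * (28 * delta / s)) <= (2 * M%:R * H)^-1 ->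
  4 * delta / rho * (M%:R * H) * (8 * (1 + 8 * psi2_scale C ^+ 4)) <= 1 ->
  (Q [set x | (`|dot (tnth (noise mu x)) (beta D) + b0 D| <= `|m D|)%R] <=
   (4 / M%:R + 4 * expR (- (H ^+ 2 / 288)) + (28 * delta / s + 8 * mun / rho) ^+ 2 / h ^+ 2)%:E)%E.
Proof.
move=> H0 M0 h0 hm hv; have [kap mm] := good_margin G.
have mle := weak_m_le mm N0 Nm0 delta1 s0 rhoE zmu zneg zpos D1 D2 delta_rho mu_rho qD.
pose v (j : 'I_d) := (nrm (fun k => 2 * tnth mu k + mean_of (noise_of mu D) (is_pos D) k))^-1 *
  mean_of (noise_of mu D) (is_pos D) j.
have rle : nrm (fun j => beta D j - v j) <= 28 * delta / s + 8 * mun / rho :=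
  weak_rest mm N0 Nm0 delta1 s0 rhoE zmu zneg zpos D1 D2 delta_rho mu_rho qD.
have vge : 1 / 36 <= \sum_j v j ^+ 2 :=
  weak_main_part N0 s0 rhoE zpos D1 D2 delta_rho mu_rho.
have vle j : `|v j| <= 4 * delta / rho :=
  weak_main_part_coord N0 s0 rhoE zpos D1 D2 delta_rho mu_rho (fun i _ => good_coord G i j).
have vM j : `|v j| * (M%:R * H) * (8 * (1 + 8 * psi2_scale C ^+ 4)) <= 1.
  apply: le_trans hv; apply: ler_wpM2r.
    by rewrite mulr_ge0// addr_ge0// mulr_ge0// exprn_ge0// ltW// psi2_scale_gt0.
  by apply: ler_wpM2r; [rewrite mulr_ge0// ltW|exact: vle].
have anti := noise_anti_concentration HQ (- b0 D) H0 M0 vM.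
have rest := noise_large_sqr h0 rle.
set A := [set x | _] in anti; set B := [set x | _] in rest.
have mdot (u : 'I_d -> R) : measurable_fun setT (fun x : d.-tuple R * R => dot (tnth (noise mu x)) u).
  by apply: measurable_dot => j //; exact: measurable_noise_coord.
have mA : measurable A.
  apply: measurable_le_set => //; apply: measurableT_comp => //; apply: measurable_funB => //.
  by apply: measurable_dot => j //; exact: measurable_noise_coord.
have mB : measurable B.
  by apply: measurable_le_set => //; apply: measurableT_comp => //.
apply: (@le_trans _ _ (Q (A `|` B))).
  apply: le_measure; rewrite ?inE; [|exact: measurableU|].
    apply: measurable_le_set => //; apply: measurableT_comp => //.
    by apply: measurable_funD.
  move=> x; rewrite /A /B /= => hx.
  case: (leP h `|dot (tnth (noise mu x)) (fun j => beta D j - v j)|) => hr; first by right.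
  left; apply: le_trans hm.
  have -> : dot v (tnth (noise mu x)) - - b0 D =
      (dot (tnth (noise mu x)) (beta D) + b0 D) - dot (tnth (noise mu x)) (fun j => beta D j - v j).
    rewrite (dotC _ (fun j => beta D j - v j)) dotBl (dotC v) (dotC (beta D)); ring.
  apply: (le_trans (ler_normB _ _)); rewrite addrC; apply: lerD; first exact: ltW.
  exact: le_trans hx mle.
apply: (le_trans (measureU2 _ mA mB)); rewrite EFinD; apply: leeD; last exact: rest.
(* 288 = 8 * 36, where 1/36 is the lower bound for the squared norm of [v]. *)
apply: (le_trans anti); rewrite lee_fin lerD2l ler_pM2l// ler_expR lerN2.
have : 1 / 36 <= nrm v ^+ 2 by rewrite nrm_sumE sqr_sqrtr// sumr_ge0// => j _; exact: sqr_ge0.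
by move=> /(ler_wpM2l (sqr_ge0 H)) h'; lra.
Qed.

End WeakConsequences.

Lemma moderate_signal_errors (L : R) : 0 < L -> delta <= mun -> 168 * delta * s <= mun ->
  L <= mun ^+ 2 / (3 * rho) - 96 * delta ^+ 2 - 4 * rho / tau ->
  L <= (rho / 8) / (1 + tau) - 1 ->
  err_pos P (g \o X) Y <= e + L ^- 2 /\ err_neg P (g \o X) Y <= e + L ^- 2.
Proof.
move=> L0 dm sm L1 L2; split.
  apply: (err_pos_le HQ HY XY p0 L0); apply: good_outer => D G.
  by have [] := sample_weak_good_tau G dm sm L1 L2.
apply: (err_neg_le HQ HY XY p1 L0); apply: good_outer => D G.
by have [] := sample_weak_good_tau G dm sm L1 L2.
Qed.

Lemma bounded_tau_errors (L : R) : 0 < L ->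
  L <= (rho / 8) / (1 + tau) - 2 * mun - 1 ->
  1 - (e + L ^- 2) <= err_pos P (g \o X) Y /\ err_neg P (g \o X) Y <= e + L ^- 2.
Proof.
move=> L0 L1; split.
  apply: (err_pos_ge HQ HY XY p0 L0); apply: good_outer => D G.
  by have [] := sample_weak_bounded_tau G L1.
apply: (err_neg_le HQ HY XY p1 L0); apply: good_outer => D G.
by have [] := sample_weak_bounded_tau G L1.
Qed.

Lemma low_signal_error (H h : R) (M : nat) : 0 < H -> (0 < M)%N -> 0 < h ->
  h + (4 * (2 * mun ^+ 2 + delta * mun) / rho + mun * (28 * delta / s)) <= (2 * M%:R * H)^-1 ->
  4 * delta / rho * (M%:R * H) * (8 * (1 + 8 * psi2_scale C ^+ 4)) <= 1 ->
  2^-1 - 2^-1 * (e + (4 / M%:R + 4 * expR (- (H ^+ 2 / 288)) +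
    (28 * delta / s + 8 * mun / rho) ^+ 2 / h ^+ 2)) <= err_bal P (g \o X) Y.
Proof.
move=> H0 M0 h0 hm hv; apply: (err_bal_ge HQ HY XY p0 p1).
  apply: addr_ge0; last by rewrite divr_ge0 ?sqr_ge0.
  by apply: addr_ge0; [rewrite divr_ge0|rewrite mulr_ge0 ?expR_ge0].
by apply: good_outer => D G; exact: sample_low_signal.
Qed.

End FixedDimension.

(** * Asymptotics *)

Section Orders.
Context {R : realType}.
Implicit Types (u v : nat -> R) (x y : R).

(** Being two-sided, the relation is stable under products, inverses and roots, so each asymptotic
    condition comes down to the sign of an exponent. *)
Definition has_order u x : Prop := exists c, exists2 c', 0 < c &
  \forall d \near \oo, c * d%:R `^ x <= u d <= c' * d%:R `^ x.

Lemma near_natr_gt0 : \forall d \near \oo, 0 < d%:R :> R.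
Proof. by exists 1%N => // d /=; rewrite ltr0n. Qed.

Lemma has_order_powR x : has_order (fun d => d%:R `^ x) x.
Proof. by exists 1, 1 => //; near=> d; rewrite mul1r lexx. Unshelve. all: by end_near. Qed.

Lemma has_order_eq u v x : (\forall d \near \oo, u d = v d) -> has_order u x -> has_order v x.
Proof.
move=> uv [c [c' c0 H]]; exists c, c' => //; near=> d.
by rewrite -(near uv d)//; near: d.
Unshelve. all: by end_near. Qed.

Lemma has_order_gt0 u x : has_order u x -> \forall d \near \oo, 0 < u d.
Proof.
move=> [c [c' c0 H]]; near=> d.
have /andP[h _] : c * d%:R `^ x <= u d <= c' * d%:R `^ x by near: d.
apply: lt_le_trans h; rewrite mulr_gt0// powR_gt0//; near: d; exact: near_natr_gt0.
Unshelve. all: by end_near. Qed.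

Lemma has_orderZ (k : R) u x : 0 < k -> has_order u x -> has_order (fun d => k * u d) x.
Proof.
move=> k0 [c [c' c0 H]]; exists (k * c), (k * c'); first exact: mulr_gt0.
near=> d; rewrite -!mulrA !ler_pM2l//; near: d; exact: H.
Unshelve. all: by end_near. Qed.

Lemma has_orderM u v x y : has_order u x -> has_order v y -> has_order (fun d => u d * v d) (x + y).
Proof.
move=> [c [c' c0 H]] [b [b' b0 H']]; exists (c * b), (c' * b'); first exact: mulr_gt0.
near=> d; have d0 : 0 < d%:R :> R by near: d; exact: near_natr_gt0.
have /andP[h1 h2] : c * d%:R `^ x <= u d <= c' * d%:R `^ x by near: d.
have /andP[h3 h4] : b * d%:R `^ y <= v d <= b' * d%:R `^ y by near: d.
have X0 : 0 <= c * d%:R `^ x by rewrite mulr_ge0 ?powR_ge0// ltW.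
have Y0 : 0 <= b * d%:R `^ y by rewrite mulr_ge0 ?powR_ge0// ltW.
rewrite powRD; last by rewrite (gt_eqF d0) implybT.
rewrite !(mulrACA _ _ (_ `^ _)); apply/andP; split; apply: ler_pM => //.
  exact: le_trans h1.
exact: le_trans h3.
Unshelve. all: by end_near. Qed.

Lemma has_orderV u x : has_order u x -> has_order (fun d => (u d)^-1) (- x).
Proof.
(* The definition does not state the sign of [c']; its enlargement is positive and can be
   inverted. *)
move=> [c [c' c0 H]]; exists (`|c'| + 1)^-1, c^-1; first by rewrite invr_gt0 ltr_pwDr.
near=> d; have d0 : 0 < d%:R :> R by near: d; exact: near_natr_gt0.
have /andP[h1 h2] : c * d%:R `^ x <= u d <= c' * d%:R `^ x by near: d.
have X0 : 0 < d%:R `^ x by rewrite powR_gt0.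
have u0 : 0 < u d by apply: lt_le_trans h1; rewrite mulr_gt0.
rewrite powRN -!invfM !lef_pV2 ?posrE ?mulr_gt0 ?ltr_pwDr// h1 andbT.
apply: (le_trans h2); rewrite ler_pM2r//; apply: (le_trans (ler_norm _)).
by rewrite lerDl.
Unshelve. all: by end_near. Qed.

Lemma has_order_sqrt u x : has_order u x -> has_order (fun d => Num.sqrt (u d)) (x / 2).
Proof.
move=> [c [c' c0 H]]; exists (Num.sqrt c), (Num.sqrt c'); first by rewrite sqrtr_gt0.
near=> d; have /andP[h1 h2] : c * d%:R `^ x <= u d <= c' * d%:R `^ x by near: d.
have E : d%:R `^ (x / 2) = Num.sqrt (d%:R `^ x) by rewrite powRrM powR12_sqrt// powR_ge0.
have d0 : 0 < d%:R :> R by near: d; exact: near_natr_gt0.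
have X0 : 0 < d%:R `^ x by rewrite powR_gt0.
have u0 : 0 <= c' * d%:R `^ x.
  by apply: le_trans h2; apply: le_trans h1; rewrite mulr_ge0// ltW.
have c'0 : 0 <= c' by rewrite -(pmulr_lge0 _ X0).
by rewrite E -!sqrtrM ?(ltW c0)// !ler_wsqrtr.
Unshelve. all: by end_near. Qed.

Lemma has_order_sqr u x : has_order u x -> has_order (fun d => u d ^+ 2) (x + x).
Proof. by move=> ux; apply: has_order_eq (has_orderM ux ux); near=> d; rewrite expr2. Unshelve. all: by end_near. Qed.

Lemma has_order_large u x (L : R) : has_order u x -> 0 < x -> \forall d \near \oo, L <= u d.
Proof.
move=> [c [c' c0 H]] x0; pose K : R := `|L| / c.
have K0 : 0 <= K by rewrite divr_ge0// ltW.
near=> d; have /andP[h1 _] : c * d%:R `^ x <= u d <= c' * d%:R `^ x by near: d.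
apply: le_trans h1; apply: (le_trans (ler_norm L)).
rewrite mulrC -ler_pdivrMr// -/K.
have -> : K = (K `^ x^-1) `^ x by rewrite -powRrM mulVf ?gt_eqF// powRr1.
apply: ge0_ler_powR; rewrite ?nnegrE ?powR_ge0//; first exact: ltW.
by near: d; exact: nbhs_infty_ger.
Unshelve. all: by end_near. Qed.

Lemma has_order_small u x (eta : R) : has_order u x -> x < 0 -> 0 < eta -> \forall d \near \oo, u d <= eta.
Proof.
move=> ux x0 eta0; have ux0 := has_order_gt0 ux.
have := @has_order_large _ _ eta^-1 (has_orderV ux); rewrite oppr_gt0 => /(_ x0) H.
near=> d; have u0 : 0 < u d by near: d.
rewrite -lef_pV2 ?posrE//; near: d; exact: H.
Unshelve. all: by end_near. Qed.

(* [expR y >= y^m/m!] turns exponential decay into decay faster than any power. *)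
Lemma poly_tail_small (C eps z eta : R) u : 0 < eps -> has_order u z -> 0 < eta ->
  \forall d \near \oo, u d * (2 * expR (1 - d%:R `^ eps / (2 * (`|C| + 1)))) <= eta.
Proof.
move=> eps0 uz eta0; set K := `|C| + 1.
have K0 : 0 < K by rewrite ltr_pwDr.
have [m mz] : exists m : nat, z < m.+1%:R * eps.
  exists (Num.bound `|z / eps|); rewrite -ltr_pdivrMr//.
  by apply: (le_lt_trans (ler_norm _)); apply: (lt_trans (archi_boundP (normr_ge0 _))); rewrite ltr_nat.
pose c : R := 2 * expR 1 * (m.+1)`!%:R * (2 * K) ^+ m.+1.
have c0 : 0 < c by rewrite !mulr_gt0 ?expR_gt0 ?exprn_gt0 ?mulr_gt0// ltr0n fact_gt0.
have O : has_order (fun d => c * (u d * d%:R `^ (- (m.+1%:R * eps)))) (z - m.+1%:R * eps).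
  by apply: has_orderZ => //; apply: has_orderM => //; exact: has_order_powR.
have S := has_order_small O _ eta0.
have u0 := has_order_gt0 uz.
near=> d; have d0 : 0 < d%:R :> R by near: d; exact: near_natr_gt0.
have ud : 0 < u d by near: d.
apply: (@le_trans _ _ (c * (u d * d%:R `^ (- (m.+1%:R * eps))))); last first.
  by near: d; apply: S; rewrite subr_lt0.
rewrite [leRHS]mulrCA ler_pM2l//.
set t := d%:R `^ eps; have t0 : 0 < t by rewrite powR_gt0.
have tE : d%:R `^ (- (m.+1%:R * eps)) = (t ^+ m.+1)^-1.
  by rewrite powRN mulrC powRrM powR_mulrn// ltW.
rewrite tE expRD expRN.
have y1 : 0 <= t / (2 * K) by rewrite divr_ge0 ?mulr_ge0// ltW.
have h' := expR_ge1Dxn m y1.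
have f0 : (0 : R) < (m.+1)`!%:R by rewrite ltr0n fact_gt0.
have y0 : 0 < (t / (2 * K)) ^+ m.+1 / (m.+1)`!%:R by rewrite divr_gt0// exprn_gt0// divr_gt0// mulr_gt0.
have h2 : (t / (2 * K)) ^+ m.+1 / (m.+1)`!%:R <= expR (t / (2 * K)).
  by apply: le_trans h'; rewrite lerDr.
have h3 : (expR (t / (2 * K)))^-1 <= (2 * K) ^+ m.+1 * (m.+1)`!%:R / t ^+ m.+1.
  have -> : (2 * K) ^+ m.+1 * (m.+1)`!%:R / t ^+ m.+1 = ((t / (2 * K)) ^+ m.+1 / (m.+1)`!%:R)^-1.
    by rewrite expr_div_n !invfM !invrK; ring.
  by rewrite lef_pV2 ?posrE// expR_gt0.
have e1 : 0 < 2 * expR (1 : R) by rewrite mulr_gt0// expR_gt0.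
rewrite mulrA; apply: (le_trans (ler_wpM2l (ltW e1) h3)).
rewrite /c le_eqVlt; apply/orP; left; apply/eqP; ring.
Unshelve. all: by end_near. Qed.

End Orders.

(** * Numerical conditions for the bounds in fixed dimension *)

Section Arithmetic.
Context {R : realType}.
Implicit Types L tau delta mun rho s q h : R.

Lemma weak_conditions delta mun rho q : 0 < rho ->
  delta ^+ 2 * rho^-1 <= 768^-1 -> mun * rho^-1 <= 8^-1 -> delta * q <= 2^-1 ->
  [/\ 768 * delta ^+ 2 <= rho, mun <= rho / 8 & 2 * delta * q <= 1].
Proof.
by move=> r0; rewrite !ler_pdivrMr// => h1 h2 h3; split; lra.
Qed.

Lemma moderate_conditions L tau delta mun rho s :
  0 < L -> 0 < tau -> 0 < mun -> 0 < rho ->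
  12 * L <= mun ^+ 2 * rho^-1 -> delta * mun^-1 <= 1 -> delta * s * mun^-1 <= 168^-1 ->
  delta ^+ 2 * (mun ^+ 2 * rho^-1)^-1 <= 1152^-1 -> 16 * (L + 1) <= rho ->
  rho ^+ 2 * (mun ^+ 2)^-1 <= 48^-1 * tau -> tau <= (16 * (L + 1))^-1 * rho ->
  [/\ delta <= mun, 168 * delta * s <= mun,
      L <= mun ^+ 2 / (3 * rho) - 96 * delta ^+ 2 - 4 * rho / tau &
      L <= rho / 8 / (1 + tau) - 1].
Proof.
move=> L0 tau0 mu0 r0 m1 m2 m3 m5 m9 t1 t2.
have A0 : 0 < mun ^+ 2 * rho^-1 by rewrite divr_gt0// exprn_gt0.
rewrite ler_pdivrMr// mul1r in m2; rewrite ler_pdivrMr// in m3; rewrite ler_pdivrMr// in m5.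
split=> //; first by lra.
- have -> : mun ^+ 2 / (3 * rho) = (mun ^+ 2 * rho^-1) / 3 by rewrite invfM; ring.
  suff h : 4 * rho / tau <= (mun ^+ 2 * rho^-1) / 12 by lra.
  rewrite ler_pdivrMr//.
  have h := ler_wpM2l (ltW A0) t1.
  have E : mun ^+ 2 * rho^-1 * (rho ^+ 2 * (mun ^+ 2)^-1) = rho.
    by field; rewrite !gt_eqF.
  by rewrite E in h; lra.
- suff h : L + 1 <= rho / 8 / (1 + tau) by lra.
  rewrite ler_pdivlMr ?addr_gt0//; move: t2; rewrite [leRHS]mulrC ler_pdivlMr ?mulr_gt0 ?addr_gt0//.
  lra.
Qed.

Lemma bounded_tau_conditions L tau mun rho (k : R) :
  0 < tau -> 0 < mun -> 0 < rho -> 0 < k -> tau <= k ->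
  mun * rho^-1 <= (32 * (1 + k))^-1 -> 16 * (1 + k) * (L + 1) <= rho ->
  mun * rho^-1 <= 8^-1 /\ L <= rho / 8 / (1 + tau) - 2 * mun - 1.
Proof.
move=> tau0 mu0 r0 k0 tk m7 m9.
have kk : 0 < 1 + k by rewrite addr_gt0.
rewrite ler_pdivrMr// in m7.
have m7' : mun * (32 * (1 + k)) <= rho.
  by rewrite -ler_pdivlMr ?mulr_gt0// mulrC.
split; first by rewrite ler_pdivrMr//; have h := mulr_gt0 mu0 k0; lra.
have h1 : rho / 8 / (1 + k) <= rho / 8 / (1 + tau).
  apply: ler_wpM2l; first by rewrite divr_ge0// ltW.
  by rewrite lef_pV2 ?posrE ?addr_gt0// lerD2l.
suff h2 : L + 2 * mun + 1 <= rho / 8 / (1 + k) by lra.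
by rewrite ler_pdivlMr//; lra.
Qed.

Lemma high_conditions L tau delta mun rho q :
  0 < L -> 0 < tau -> 0 < mun -> 2 * L <= mun -> delta * mun^-1 <= 4^-1 ->
  delta * rho * mun^-1 <= 8^-1 -> delta * q <= 2^-1 ->
  tau <= (2 * (L + 1))^-1 * mun ->
  L <= mun - delta - 2 * delta * rho /\ L <= (mun - delta) / tau - 2 * delta * q.
Proof.
move=> L0 tau0 mu0 m1 m2 m3 m4 m5.
rewrite ler_pdivrMr// in m2; rewrite ler_pdivrMr// in m3.
split; first by lra.
suff : L + 1 <= (mun - delta) / tau by lra.
by rewrite ler_pdivlMr//; move: m5; rewrite [leRHS]mulrC ler_pdivlMr ?mulr_gt0 ?addr_gt0//; lra.
Qed.

Lemma low_conditions delta mun rho s h (M H K8 : R) (B := M * H * K8) :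
  8 * (mun ^+ 2 * rho^-1) <= h / 4 -> 4 * (delta * mun * rho^-1) <= h / 4 ->
  28 * (delta * mun * s^-1) <= h / 4 -> 4 * B * (delta * rho^-1) <= 1 -> 0 <= h ->
  h + (4 * (2 * mun ^+ 2 + delta * mun) / rho + mun * (28 * delta / s)) <= 2 * h /\
  4 * delta / rho * (M * H) * K8 <= 1.
Proof. by rewrite /B => m9 m10 m11 m12 h0; split; lra. Qed.

(** Since 28 + 8 <= 64, the sum is at most [q * h]; capping [q] at 1 gives [q ^+ 2 <= q <= eta]. *)
Lemma low_rest_small delta mun rho s h (eta : R) (q := Num.min 1 eta) :
  0 < s -> 0 < rho -> 0 <= mun -> 0 <= delta -> 0 < h -> 0 < eta ->
  delta * s^-1 <= q * h / 64 -> mun * rho^-1 <= q * h / 64 ->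
  (28 * delta / s + 8 * mun / rho) ^+ 2 / h ^+ 2 <= eta.
Proof.
move=> s0 r0 mu0 d0 h0 eta0 m13 m14.
have q00 : 0 <= q by rewrite le_min ler01 ltW.
have q11 : q <= 1 by rewrite ge_min lexx.
have q12 : q <= eta by rewrite ge_min lexx orbT.
have qh : 0 <= q * h by rewrite mulr_ge0// ltW.
have l1 : 28 * delta / s + 8 * mun / rho <= q * h by lra.
have l0 : 0 <= 28 * delta / s + 8 * mun / rho.
  by rewrite addr_ge0// divr_ge0// ?mulr_ge0// ltW.
rewrite ler_pdivrMr ?exprn_gt0//; apply: (@le_trans _ _ ((q * h) ^+ 2)).
  by rewrite ler_sqr ?nnegrE.
rewrite exprMn ler_pM2r ?exprn_gt0//; apply: le_trans q12.
by rewrite expr2; apply: ler_piMl.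
Qed.

(** [H] and [M] depend on [eta] only and are fixed before [d] grows. The smallness of coordinates
    required by the anti-concentration bound then holds eventually, as [delta / rho] tends to 0. *)
Lemma low_frequencies (eta : R) : 0 < eta ->
  exists H, exists2 M : nat, 0 < H /\ (0 < M)%N &
    4 / M%:R + 4 * expR (- (H ^+ 2 / 288)) <= eta.
Proof.
move=> eta0.
(* As [H >= 1], [H ^+ 2 / 288] is at least [H / 288 = 1 + 8 / eta], and [expR x >= 1 + x]
   suffices. *)
pose H : R := 288 * (1 + 8 / eta).
have He : 0 < 8 / eta by rewrite divr_gt0.
have H1 : 1 <= H by rewrite /H; lra.
have H0 : 0 < H by lra.
exists H, (Num.bound (8 / eta)).+1; first by [].
have hH : 4 * expR (- (H ^+ 2 / 288)) <= eta / 2.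
  have h1 : 8 / eta <= expR (H ^+ 2 / 288).
    apply: le_trans (expR_ge1Dx _).
    have : H * 1 <= H ^+ 2 by rewrite expr2 ler_pM2l.
    by rewrite /H; lra.
  rewrite expRN -ler_pdivlMl// -[leRHS]invrK lef_pV2 ?posrE ?expR_gt0//; last first.
    by rewrite invr_gt0 mulr_gt0// divr_gt0.
  apply: le_trans h1; rewrite le_eqVlt; apply/orP; left; apply/eqP.
  by field; rewrite gt_eqF.
have hM : 4 / (Num.bound (8 / eta)).+1%:R <= eta / 2.
  rewrite ler_pdivrMr ?ltr0n// -ler_pdivrMl ?divr_gt0//.
  have -> : (eta / 2)^-1 * 4 = 8 / eta by field; rewrite gt_eqF.
  by apply: ltW; apply: (lt_trans (archi_boundP (ltW He))); rewrite ltr_nat.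
by rewrite [leRHS]splitr lerD.
Qed.

End Arithmetic.

Section Asymptotics.
Context (R : realType) (a b c C : R).
Hypotheses (ha : 0 < a) (hb : 0 < b) (hc : 0 < c) (hac : a - c < 1).
Context (pi : nat -> R) (mu : forall d : nat, d.-tuple R) (n : nat -> nat).
Hypothesis himb : imbalanced a b c pi mu n.
Context (Q : forall d : nat, probability (d.-tuple R * R)%type R).
Hypothesis hQ : forall d : nat, (0 < d)%N -> is_2subGMM (pi d) (mu d) C (Q d).
Context (disp : nat -> measure_display) (Omega : forall d : nat, measurableType (disp d)).
Context (P : forall d : nat, probability (Omega d) R).
Context (data : forall d : nat, {RV (P d) >-> (n d).-tuple (d.-tuple R * R)%type}).
Context (test : forall d : nat, {RV (P d) >-> (d.-tuple R * R)%type}).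
Hypothesis hdata : forall d : nat, (0 < d)%N -> iid_with_law (P d) (data d) (Q d).
Hypothesis htest : forall d : nat, (0 < d)%N -> has_law (P d) (test d) (Q d).
Hypothesis hindep : forall d : nat, (0 < d)%N -> independent (P d) (data d) (test d).
Context (tau : nat -> R).
Hypothesis htau : forall d : nat, (0 < d)%N -> 0 < tau d.
Context (train : forall d : nat,
    {mfun (n d).-tuple (d.-tuple R * R)%type >-> (d.-tuple R * R)%type}).
Hypothesis hsvm : forall d : nat, (0 < d)%N -> is_svm (tau d) (train d).

Ltac exponents := have := ha; have := hb; have := hc; have := hac; lra.

Let Errp d := err_pos (P d) (train d \o data d) (test d).
Let Errm d := err_neg (P d) (train d \o data d) (test d).
Let Errb d := err_bal (P d) (train d \o data d) (test d).

Let mun d := nrm (tnth (mu d)).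
Let np d := (n d)%:R * pi d.
Let rho d := Num.sqrt (d%:R / np d).
Let s d := Num.sqrt (rho d).
Let noise_neg d : R := Num.sqrt (d%:R / (n d)%:R).

Let ord_d : has_order (fun d => d%:R : R) 1.
Proof.
by apply: has_order_eq (has_order_powR 1); near=> d; rewrite powRr1.
Unshelve. all: by end_near. Qed.

Let ord_n : has_order (fun d => (n d)%:R : R) (c + 1).
Proof.
case: himb => _ _ [k k0 nk].
exists (k / 2), (2 * k); first by rewrite divr_gt0.
have L : \forall d \near \oo, 2 / k <= d%:R `^ (c + 1).
  by apply: has_order_large (has_order_powR _) _; exponents.
near=> d; have d0 : (0 < d)%N by near: d; exists 1%N.
have := nk d d0; rewrite ltr_norml => /andP[h1 h2].
have : 2 / k <= d%:R `^ (c + 1) by near: d.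
rewrite ler_pdivrMr// => h3; apply/andP; split; lra.
Unshelve. all: by end_near. Qed.

Let ord_pi : has_order pi (- a).
Proof.
case: himb => -[k k0 pik] _ _.
apply: has_order_eq (has_orderZ k0 (has_order_powR _)); near=> d.
by rewrite pik//; near: d; exists 1%N.
Unshelve. all: by end_near. Qed.

Let ord_mun : has_order mun (b / 2).
Proof.
case: himb => _ [k k0 muk] _.
have := has_order_sqrt (has_orderZ k0 (has_order_powR b)).
apply: has_order_eq; near=> d; rewrite -muk; last by near: d; exists 1%N.
by rewrite sqrtr_sqr ger0_norm// sqrtr_ge0.
Unshelve. all: by end_near. Qed.

Let ord_np : has_order np (c + 1 - a).
Proof. exact: has_orderM ord_n ord_pi. Qed.

Let ord_rho : has_order rho ((a - c) / 2).
Proof.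
have := has_order_sqrt (has_orderM ord_d (has_orderV ord_np)).
by rewrite (_ : (1 - (c + 1 - a)) / 2 = (a - c) / 2)//; ring.
Qed.

Let ord_s : has_order s ((a - c) / 4).
Proof.
by have := has_order_sqrt ord_rho; rewrite (_ : (a - c) / 2 / 2 = (a - c) / 4)//; field.
Qed.

Let ord_noise_neg : has_order noise_neg (- (c / 2)).
Proof.
have := has_order_sqrt (has_orderM ord_d (has_orderV ord_n)).
by rewrite (_ : (1 - (c + 1)) / 2 = - (c / 2))//; field.
Qed.

Let near_basic : \forall d \near \oo,
  [/\ (0 < d)%N, (0 < n d)%N, 0 < pi d & pi d <= 4^-1].
Proof.
have N0 := has_order_gt0 ord_n.
have p0 := has_order_gt0 ord_pi.
have p4 : \forall d \near \oo, pi d <= 4^-1 by apply: has_order_small ord_pi _ _; exponents.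
near=> d; split.
- by near: d; exists 1%N.
- by rewrite -(ltr0n R); near: d.
- by near: d.
- by near: d.
Unshelve. all: by end_near. Qed.

Let delta (eps : R) (d : nat) : R := d%:R `^ eps.

Let ord_delta eps : has_order (delta eps) eps.
Proof. exact: has_order_powR. Qed.

Let bad_small (eps eta : R) : 0 < eps -> 0 < eta ->
  \forall d \near \oo, bad_prob d (n d) (pi d) C (delta eps d) <= eta.
Proof.
move=> eps0 eta0; have e5 : 0 < eta / 5 by rewrite divr_gt0.
have b1 : \forall d \near \oo, 4 * (np d)^-1 <= eta / 5.
  by apply: has_order_small (has_orderZ _ (has_orderV ord_np)) _ e5; exponents.
have b2 : \forall d \near \oo, 16 * ((n d)%:R)^-1 <= eta / 5.
  by apply: has_order_small (has_orderZ _ (has_orderV ord_n)) _ e5; exponents.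
have od := has_orderV (has_order_sqr (ord_delta eps)).
have b3 : \forall d \near \oo, 2 * (delta eps d ^+ 2)^-1 <= eta / 5.
  by apply: has_order_small (has_orderZ _ od) _ e5; exponents.
have b4 : \forall d \near \oo, 8 * psi2_scale C ^+ 4 * (delta eps d ^+ 2)^-1 <= eta / 5.
  apply: has_order_small (has_orderZ _ od) _ e5; last by exponents.
  by rewrite mulr_gt0// exprn_gt0// psi2_scale_gt0.
have o3 : has_order (fun d => 3 * (d%:R * (n d)%:R)) (1 + (c + 1)).
  by apply: has_orderZ => //; exact: has_orderM.
have b5 := poly_tail_small C eps0 o3 e5.
near=> d; rewrite /bad_prob.
have d1 : 1 <= d%:R :> R by near: d; exact: nbhs_infty_ger.
have h1 : 4 * (np d)^-1 <= eta / 5 by near: d.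
have h2 : 16 * ((n d)%:R)^-1 <= eta / 5 by near: d.
have h3 : 2 * (delta eps d ^+ 2)^-1 <= eta / 5 by near: d.
have h4 : 8 * psi2_scale C ^+ 4 * (delta eps d ^+ 2)^-1 <= eta / 5 by near: d.
have h5 : 3 * (d%:R * (n d)%:R) * (2 * expR (1 - d%:R `^ eps / (2 * (`|C| + 1)))) <= eta / 5 by near: d.
have h6 : (d%:R + 2) * (n d)%:R * tail C (delta eps d) <= eta / 5.
  apply: le_trans h5; rewrite /tail /psi2_scale /delta; apply: ler_wpM2r.
    by rewrite mulr_ge0// expR_ge0.
  rewrite mulrA; apply: ler_wpM2r => //; lra.
move: h1; rewrite /np; lra.
Unshelve. all: by end_near. Qed.

Let inv_sqr_small (eta : R) : 0 < eta -> exists2 L : R, 0 < L & L ^- 2 <= eta / 2.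
Proof.
move=> eta0; exists (1 + 2 / eta); first by rewrite addr_gt0// divr_gt0.
have h : 0 < 2 / eta by rewrite divr_gt0.
have -> : eta / 2 = (2 / eta)^-1 by rewrite invf_div.
rewrite lef_pV2 ?posrE ?exprn_gt0 ?addr_gt0//; nra.
Qed.

Let cvg_bounds (F : nat -> R) : (forall d, (0 < d)%N -> 0 <= F d) ->
  (forall eta : R, 0 < eta -> \forall d \near \oo, F d <= eta) -> F @ \oo --> (0 : R).
Proof.
move=> F0 H; apply/cvgr0Pnorm_le => eta eta0.
have h := H _ eta0; near=> d; rewrite ger0_norm; first by near: d.
by apply: F0; near: d; exists 1%N.
Unshelve. all: by end_near. Qed.

Let delta_ge1 eps : 0 < eps -> \forall d \near \oo, 1 <= delta eps d.
Proof. by move=> eps0; apply: has_order_large (ord_delta eps) eps0. Qed.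

Let errp_ge0 d : 0 <= Errp d.
Proof. by rewrite /Errp /err_pos /cond_prob divr_ge0// fine_ge0. Qed.

Let errm_ge0 d : 0 <= Errm d.
Proof. by rewrite /Errm /err_neg /cond_prob divr_ge0// fine_ge0. Qed.

Let cvg_errors : (forall L eta : R, 0 < L -> 0 < eta -> \forall d \near \oo,
    Errp d <= eta + L ^- 2 /\ Errm d <= eta + L ^- 2) ->
  Errp @ \oo --> (0 : R) /\ Errm @ \oo --> (0 : R).
Proof.
move=> H; split; apply: cvg_bounds => // eta eta0.
  have [L L0 Le] := inv_sqr_small eta0.
  have e2 : 0 < eta / 2 by rewrite divr_gt0.
  have h := H _ _ L0 e2; near=> d.
  have [h1 _] : Errp d <= eta / 2 + L ^- 2 /\ Errm d <= eta / 2 + L ^- 2 by near: d.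
  lra.
have [L L0 Le] := inv_sqr_small eta0.
have e2 : 0 < eta / 2 by rewrite divr_gt0.
have h := H _ _ L0 e2; near=> d.
have [_ h1] : Errp d <= eta / 2 + L ^- 2 /\ Errm d <= eta / 2 + L ^- 2 by near: d.
lra.
Unshelve. all: by end_near. Qed.

Let tau_small u x (eta : R) : has_order u x -> tau =o_\oo (fun d : nat => d%:R `^ x) ->
  0 < eta -> \forall d \near \oo, tau d <= eta * u d.
Proof.
move=> [k [k' k0 H]] /eqoP o eta0.
have ek : 0 < eta * k by rewrite mulr_gt0.
have h := o _ ek; near=> d.
have /andP[h1 _] : k * d%:R `^ x <= u d <= k' * d%:R `^ x by near: d.
have : `|tau d| <= eta * k * `|d%:R `^ x| by near: d.
rewrite (ger0_norm (powR_ge0 _ _)) => h2.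
apply: (le_trans (ler_norm _)); apply: (le_trans h2).
by rewrite -mulrA ler_pM2l.
Unshelve. all: by end_near. Qed.

Let tau_large u x (eta : R) : has_order u x -> (fun d : nat => d%:R `^ x) =o_\oo tau ->
  0 < eta -> \forall d \near \oo, u d <= eta * tau d.
Proof.
move=> [k [k' k0 H]] /eqoP o eta0.
have k'0 : 0 < `|k'| + 1 by rewrite ltr_pwDr.
have ek : 0 < eta / (`|k'| + 1) by rewrite divr_gt0.
have h := o _ ek; near=> d.
have /andP[_ h1] : k * d%:R `^ x <= u d <= k' * d%:R `^ x by near: d.
have : `|d%:R `^ x| <= eta / (`|k'| + 1) * `|tau d| by near: d.
have t0 : 0 < tau d by apply: htau; near: d; exists 1%N.
rewrite (ger0_norm (powR_ge0 _ _)) (gtr0_norm t0) => h2.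
apply: (le_trans h1); apply: (@le_trans _ _ ((`|k'| + 1) * d%:R `^ x)).
  by apply: ler_wpM2r; [exact: powR_ge0|apply: (le_trans (ler_norm _)); rewrite lerDl].
have := ler_wpM2l (ltW k'0) h2.
by rewrite mulrA mulrCA divff ?gt_eqF// mulr1.
Unshelve. all: by end_near. Qed.

Let near_rho : \forall d \near \oo, [/\ 0 < rho d, 0 < s d, rho d = s d ^+ 2 &
  rho d ^+ 2 = d%:R / np d].
Proof.
have r0 := has_order_gt0 ord_rho; have s0 := has_order_gt0 ord_s.
have np0 := has_order_gt0 ord_np.
near=> d; have r0' : 0 < rho d by near: d.
split=> //; first by near: d.
  by rewrite /s sqr_sqrtr// ltW.
rewrite /rho sqr_sqrtr// divr_ge0//; apply: ltW; near: d; exact: np0.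
Unshelve. all: by end_near. Qed.

Lemma high_signal : a - c < b -> (forall d : nat, (0 < d)%N -> 1 <= tau d) ->
  tau =o_\oo (fun d : nat => d%:R `^ (b / 2)) ->
  Errp @ \oo --> (0 : R) /\ Errm @ \oo --> (0 : R).
Proof.
move=> acb tau1 tauo; apply: cvg_errors => L eta L0 eta0.
(* In this order the bounds make [delta], [delta * rho] negligible against [|mu|], and
   [delta * noise_neg] tend to 0. *)
pose eps := Num.min (Num.min (b / 4) ((b - (a - c)) / 4)) (c / 4).
have [eps0 [eps1 [eps2 eps3]]] :
    0 < eps /\ (eps <= b / 4 /\ (eps <= (b - (a - c)) / 4 /\ eps <= c / 4)).
  rewrite /eps !lt_min !ge_min !lexx ?orbT; do !split => //.
  by apply/andP; split; [apply/andP; split|]; exponents.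
have t0 : 0 < (2 * (L + 1))^-1 by rewrite invr_gt0 mulr_gt0// addr_gt0.
have M1 : \forall d \near \oo, 2 * L <= mun d.
  by apply: has_order_large ord_mun _; exponents.
have M2 : \forall d \near \oo, delta eps d * (mun d)^-1 <= 4^-1.
  by apply: has_order_small (has_orderM (ord_delta eps) (has_orderV ord_mun)) _ _; exponents.
have M3 : \forall d \near \oo, delta eps d * rho d * (mun d)^-1 <= 8^-1.
  apply: has_order_small (has_orderM (has_orderM (ord_delta eps) ord_rho) (has_orderV ord_mun)) _ _;
    exponents.
have M4 : \forall d \near \oo, delta eps d * noise_neg d <= 2^-1.
  by apply: has_order_small (has_orderM (ord_delta eps) ord_noise_neg) _ _; exponents.
have M5 := tau_small ord_mun tauo t0.
have M6 := has_order_gt0 ord_mun.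
have B := bad_small eps0 eta0.
have D1 := delta_ge1 eps0.
near=> d.
have [d0 n0 p0 p4] : [/\ (0 < d)%N, (0 < n d)%N, 0 < pi d & pi d <= 4^-1] by near: d.
have mu0 : 0 < mun d by near: d.
have d1 : 1 <= delta eps d by near: d.
have bd : bad_prob d (n d) (pi d) C (delta eps d) <= eta by near: d.
have tau0 := htau d0.
have [c1 c2] : L <= mun d - delta eps d - 2 * delta eps d * rho d /\
    L <= (mun d - delta eps d) / tau d - 2 * delta eps d * noise_neg d.
  by apply: high_conditions => //; near: d.
have [h1 h2] := high_signal_errors (hQ d0) (hdata d0) (htest d0) (hindep d0)
  tau0 (hsvm d0) n0 d0 p0 p4 d1 L0 (tau1 d d0) mu0 c1 c2.
by split; [apply: le_trans h1 _|apply: le_trans h2 _]; rewrite lerD2r.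
Unshelve. all: by end_near. Qed.

Let near_weak (eps : R) : 0 < a - c -> b < a - c -> 0 < eps -> eps <= c / 4 -> eps <= (a - c) / 8 ->
  \forall d \near \oo, [/\ 1 <= np d, 768 * delta eps d ^+ 2 <= rho d, mun d <= rho d / 8 &
    2 * delta eps d * noise_neg d <= 1].
Proof.
move=> al0 bac eps0 eps3 eps4.
have od2 := has_order_sqr (ord_delta eps).
have M4 : \forall d \near \oo, delta eps d * noise_neg d <= 2^-1.
  by apply: has_order_small (has_orderM (ord_delta eps) ord_noise_neg) _ _; exponents.
have M6 : \forall d \near \oo, delta eps d ^+ 2 * (rho d)^-1 <= 768^-1.
  by apply: has_order_small (has_orderM od2 (has_orderV ord_rho)) _ _; exponents.
have M7 : \forall d \near \oo, mun d * (rho d)^-1 <= 8^-1.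
  by apply: has_order_small (has_orderM ord_mun (has_orderV ord_rho)) _ _; exponents.
have M8 : \forall d \near \oo, 1 <= np d by apply: has_order_large ord_np _; exponents.
near=> d.
have [r0 _ _ _] : [/\ 0 < rho d, 0 < s d, rho d = s d ^+ 2 & rho d ^+ 2 = d%:R / np d] by near: d.
have [] : [/\ 768 * delta eps d ^+ 2 <= rho d, mun d <= rho d / 8 & 2 * delta eps d * noise_neg d <= 1].
  by apply: weak_conditions => //; near: d.
by split=> //; near: d.
Unshelve. all: by end_near. Qed.

Lemma moderate_signal : b < a - c -> a - c < 2 * b ->
  (fun d : nat => d%:R `^ (a - b - c)) =o_\oo tau ->
  tau =o_\oo (fun d : nat => d%:R `^ ((a - c) / 2)) ->
  Errp @ \oo --> (0 : R) /\ Errm @ \oo --> (0 : R).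
Proof.
move=> bac acb tau1 tau2; apply: cvg_errors => L eta L0 eta0.
have al0 : 0 < a - c by exponents.
(* The second bound makes [delta * s] negligible against [|mu|] and [delta^2] against
   [|mu|^2 / rho]; the last makes [delta^2] negligible against [rho]. *)
pose eps := Num.min (Num.min (b / 4) ((2 * b - (a - c)) / 8)) (Num.min (c / 4) ((a - c) / 8)).
have [eps0 [eps1 [eps2 [eps3 eps4]]]] : 0 < eps /\ (eps <= b / 4 /\
    (eps <= (2 * b - (a - c)) / 8 /\ (eps <= c / 4 /\ eps <= (a - c) / 8))).
  rewrite /eps !lt_min !ge_min !lexx ?orbT; do !split => //.
  by apply/andP; split; apply/andP; split; exponents.
have od2 := has_order_sqr (ord_delta eps).
have oA := has_orderM (has_order_sqr ord_mun) (has_orderV ord_rho).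
have oT : has_order (fun d => rho d ^+ 2 * (mun d ^+ 2)^-1) (a - b - c).
  have := has_orderM (has_order_sqr ord_rho) (has_orderV (has_order_sqr ord_mun)).
  by rewrite (_ : (a - c) / 2 + (a - c) / 2 - (b / 2 + b / 2) = a - b - c)//; field.
have t0 : 0 < (16 * (L + 1))^-1 by rewrite invr_gt0 mulr_gt0// addr_gt0.
have e48 : 0 < 48^-1 :> R by rewrite invr_gt0.
have M1 : \forall d \near \oo, 12 * L <= mun d ^+ 2 * (rho d)^-1.
  by apply: has_order_large oA _; exponents.
have M2 : \forall d \near \oo, delta eps d * (mun d)^-1 <= 1.
  by apply: has_order_small (has_orderM (ord_delta eps) (has_orderV ord_mun)) _ _; exponents.
have M3 : \forall d \near \oo, delta eps d * s d * (mun d)^-1 <= 168^-1.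
  apply: has_order_small (has_orderM (has_orderM (ord_delta eps) ord_s) (has_orderV ord_mun)) _ _;
    exponents.
have M5 : \forall d \near \oo, delta eps d ^+ 2 * (mun d ^+ 2 * (rho d)^-1)^-1 <= 1152^-1.
  by apply: has_order_small (has_orderM od2 (has_orderV oA)) _ _; exponents.
have M9 : \forall d \near \oo, 16 * (L + 1) <= rho d by apply: has_order_large ord_rho _; exponents.
have T1 := tau_large oT tau1 e48.
have T2 := tau_small ord_rho tau2 t0.
have mun0 := has_order_gt0 ord_mun.
have B := bad_small eps0 eta0.
have D1 := delta_ge1 eps0.
have W := near_weak al0 bac eps0 eps3 eps4.
near=> d.
have [d0 n0 p0 p4] : [/\ (0 < d)%N, (0 < n d)%N, 0 < pi d & pi d <= 4^-1] by near: d.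
have [r0 s0 rE r2] : [/\ 0 < rho d, 0 < s d, rho d = s d ^+ 2 & rho d ^+ 2 = d%:R / np d] by near: d.
have [m8 dr mr q1] : [/\ 1 <= np d, 768 * delta eps d ^+ 2 <= rho d, mun d <= rho d / 8 &
    2 * delta eps d * noise_neg d <= 1] by near: d.
have mu0 : 0 < mun d by near: d.
have d1 : 1 <= delta eps d by near: d.
have bd : bad_prob d (n d) (pi d) C (delta eps d) <= eta by near: d.
have tau0 := htau d0.
have [c1 c2 c3 c4] : [/\ delta eps d <= mun d, 168 * delta eps d * s d <= mun d,
      L <= mun d ^+ 2 / (3 * rho d) - 96 * delta eps d ^+ 2 - 4 * rho d / tau d &
      L <= rho d / 8 / (1 + tau d) - 1].
  by apply: moderate_conditions => //; near: d.
have [h1 h2] := moderate_signal_errors (hQ d0) (hdata d0) (htest d0) (hindep d0)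
  tau0 (hsvm d0) n0 d0 p0 p4 d1 s0 rE r2 m8 dr mr q1 L0 c1 c2 c3 c4.
by split; [apply: le_trans h1 _|apply: le_trans h2 _]; rewrite lerD2r.
Unshelve. all: by end_near. Qed.

Lemma moderate_signal_bounded_tau : b < a - c ->
  tau =O_\oo (fun=> 1 : R) ->
  Errp @ \oo --> (1 : R) /\ Errm @ \oo --> (0 : R).
Proof.
move=> bac /eqO_exP[k [k0 tauk]].
have al0 : 0 < a - c by exponents.
have H (L eta : R) : 0 < L -> 0 < eta -> \forall d \near \oo,
    1 - Errp d <= eta + L ^- 2 /\ Errm d <= eta + L ^- 2.
  move=> L0 eta0.
  pose eps := Num.min (c / 4) ((a - c) / 8).
  have [eps0 [eps3 eps4]] : 0 < eps /\ (eps <= c / 4 /\ eps <= (a - c) / 8).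
    rewrite /eps !lt_min !ge_min !lexx ?orbT; do !split => //.
    by apply/andP; split; exponents.
  have k1 : 0 < (32 * (1 + k))^-1 by rewrite invr_gt0 mulr_gt0// addr_gt0.
  have M7 : \forall d \near \oo, mun d * (rho d)^-1 <= (32 * (1 + k))^-1.
    by apply: has_order_small (has_orderM ord_mun (has_orderV ord_rho)) _ k1; exponents.
  have M9 : \forall d \near \oo, 16 * (1 + k) * (L + 1) <= rho d.
    by apply: has_order_large ord_rho _; exponents.
  have mun0 := has_order_gt0 ord_mun.
  have B := bad_small eps0 eta0.
  have D1 := delta_ge1 eps0.
  have W := near_weak al0 bac eps0 eps3 eps4.
  near=> d.
  have [d0 n0 p0 p4] : [/\ (0 < d)%N, (0 < n d)%N, 0 < pi d & pi d <= 4^-1] by near: d.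
  have [r0 s0 rE r2] : [/\ 0 < rho d, 0 < s d, rho d = s d ^+ 2 & rho d ^+ 2 = d%:R / np d] by near: d.
  have [m8 dr mr q1] : [/\ 1 <= np d, 768 * delta eps d ^+ 2 <= rho d, mun d <= rho d / 8 &
      2 * delta eps d * noise_neg d <= 1] by near: d.
  have mu0 : 0 < mun d by near: d.
  have tk : `|tau d| <= k * `|1 : R| by near: d.
  have {}tk : tau d <= k by rewrite normr1 mulr1 in tk; apply: le_trans tk; exact: ler_norm.
  have d1 : 1 <= delta eps d by near: d.
  have bd : bad_prob d (n d) (pi d) C (delta eps d) <= eta by near: d.
  have tau0 := htau d0.
  have [_ c1] : mun d * (rho d)^-1 <= 8^-1 /\ L <= rho d / 8 / (1 + tau d) - 2 * mun d - 1.
    by apply: (bounded_tau_conditions (k := k)) => //; near: d.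
  have [h1 h2] := bounded_tau_errors (hQ d0) (hdata d0) (htest d0) (hindep d0)
    tau0 (hsvm d0) n0 d0 p0 p4 d1 s0 rE r2 m8 dr mr q1 L0 c1.
  split; last by apply: le_trans h2 _; rewrite lerD2r.
  rewrite lerBlDr addrC -lerBlDr; apply: le_trans h1.
  by rewrite lerD2l lerN2 lerD2r.
split; last first.
  apply: cvg_bounds => // eta eta0.
  have [L L0 Le] := inv_sqr_small eta0.
  have e2 : 0 < eta / 2 by rewrite divr_gt0.
  have h := H _ _ L0 e2; near=> d.
  have [_ h1] : 1 - Errp d <= eta / 2 + L ^- 2 /\ Errm d <= eta / 2 + L ^- 2 by near: d.
  lra.
apply/cvgrPdist_le => eta eta0.
have [L L0 Le] := inv_sqr_small eta0.
have e2 : 0 < eta / 2 by rewrite divr_gt0.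
have h := H _ _ L0 e2; near=> d.
have [d0 n0 p0 p4] : [/\ (0 < d)%N, (0 < n d)%N, 0 < pi d & pi d <= 4^-1] by near: d.
have [h1 _] : 1 - Errp d <= eta / 2 + L ^- 2 /\ Errm d <= eta / 2 + L ^- 2 by near: d.
have le1 : Errp d <= 1 by apply: (err_pos_le1 (hQ d0)) => //; [exact: htest|exact: hindep].
by rewrite ger0_norm ?subr_ge0//; lra.
Unshelve. all: by end_near. Qed.

Lemma low_signal : 2 * b < a - c ->
  exists2 e : nat -> R, e @ \oo --> (0 : R) & forall d : nat, 2^-1 - e d <= Errb d.
Proof.
(* The witness is the deficit below 1/2 itself: the inequality holds for every [d], and only its
   convergence to 0 remains. *)
move=> bac2; exists (fun d => Num.max 0 (2^-1 - Errb d)); last first.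
  by move=> d; rewrite lerBlDr -lerBlDl le_max lexx orbT.
apply: cvg_bounds => [d _|eta eta0]; first by rewrite le_max lexx.
have al0 : 0 < a - c by exponents.
have bac : b < a - c by exponents.
(* The last bound makes [delta * |mu|] negligible against [s], so that an error in the direction of
   [beta] cannot create signal. *)
pose eps := Num.min (Num.min (c / 4) ((a - c) / 8)) ((a - c - 2 * b) / 8).
have [eps0 [eps3 [eps4 eps5]]] : 0 < eps /\
    (eps <= c / 4 /\ (eps <= (a - c) / 8 /\ eps <= (a - c - 2 * b) / 8)).
  rewrite /eps !lt_min !ge_min !lexx ?orbT; do !split => //.
  by apply/andP; split; [apply/andP; split|]; exponents.
have e4 : 0 < eta / 4 by rewrite divr_gt0.
have [H [M [H0 M0] hHM]] := low_frequencies e4.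
have M0' : (0 : R) < M%:R by rewrite ltr0n.
(* Half of the small-ball radius: one half is for the projection on [beta - v], the other for
   [dot mu beta]. *)
pose h : R := (4 * M%:R * H)^-1.
have h0 : 0 < h by rewrite invr_gt0 !mulr_gt0.
have h2 : (2 * M%:R * H)^-1 = 2 * h by rewrite /h; field; rewrite !gt_eqF.
pose K8 : R := 8 * (1 + 8 * psi2_scale C ^+ 4).
have K80 : 0 < 4 * (M%:R * H * K8).
  by rewrite /K8 !mulr_gt0// addr_gt0// mulr_gt0// exprn_gt0// psi2_scale_gt0.
have h40 : 0 < h / 4 by rewrite divr_gt0.
have q0 : 0 < Num.min 1 (eta / 4) * h / 64.
  by rewrite divr_gt0// mulr_gt0// lt_min ltr01 e4.
have M9 : \forall d \near \oo, 8 * (mun d ^+ 2 * (rho d)^-1) <= h / 4.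
  apply: has_order_small (has_orderZ _ (has_orderM (has_order_sqr ord_mun) (has_orderV ord_rho))) _ h40;
    exponents.
have M10 : \forall d \near \oo, 4 * (delta eps d * mun d * (rho d)^-1) <= h / 4.
  apply: has_order_small (has_orderZ _ (has_orderM (has_orderM (ord_delta eps) ord_mun) (has_orderV ord_rho))) _ h40;
    exponents.
have M11 : \forall d \near \oo, 28 * (delta eps d * mun d * (s d)^-1) <= h / 4.
  apply: has_order_small (has_orderZ _ (has_orderM (has_orderM (ord_delta eps) ord_mun) (has_orderV ord_s))) _ h40;
    exponents.
have M12 : \forall d \near \oo, 4 * (M%:R * H * K8) * (delta eps d * (rho d)^-1) <= 1.
  apply: has_order_small (has_orderZ K80 (has_orderM (ord_delta eps) (has_orderV ord_rho))) _ ltr01.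
  exponents.
have M13 : \forall d \near \oo, delta eps d * (s d)^-1 <= Num.min 1 (eta / 4) * h / 64.
  by apply: has_order_small (has_orderM (ord_delta eps) (has_orderV ord_s)) _ q0; exponents.
have M14 : \forall d \near \oo, mun d * (rho d)^-1 <= Num.min 1 (eta / 4) * h / 64.
  by apply: has_order_small (has_orderM ord_mun (has_orderV ord_rho)) _ q0; exponents.
have mun0 := has_order_gt0 ord_mun.
have B := bad_small eps0 e4.
have D1 := delta_ge1 eps0.
have W := near_weak al0 bac eps0 eps3 eps4.
near=> d.
have [d0 n0 p0 p4] : [/\ (0 < d)%N, (0 < n d)%N, 0 < pi d & pi d <= 4^-1] by near: d.
have [r0 s0 rE r2] : [/\ 0 < rho d, 0 < s d, rho d = s d ^+ 2 & rho d ^+ 2 = d%:R / np d] by near: d.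
have [m8 dr mr q1] : [/\ 1 <= np d, 768 * delta eps d ^+ 2 <= rho d, mun d <= rho d / 8 &
    2 * delta eps d * noise_neg d <= 1] by near: d.
have mu0 : 0 < mun d by near: d.
have d1 : 1 <= delta eps d by near: d.
have bd : bad_prob d (n d) (pi d) C (delta eps d) <= eta / 4 by near: d.
have tau0 := htau d0.
have [c1 c2] : h + (4 * (2 * mun d ^+ 2 + delta eps d * mun d) / rho d +
      mun d * (28 * delta eps d / s d)) <= 2 * h /\
    4 * delta eps d / rho d * (M%:R * H) * K8 <= 1.
  by apply: low_conditions; [near: d..|exact: ltW].
rewrite -h2 in c1.
have rest : (28 * delta eps d / s d + 8 * mun d / rho d) ^+ 2 / h ^+ 2 <= eta / 4.
  apply: low_rest_small => //; [exact: ltW|exact: le_trans ler01 d1|near: d..]; [exact: M13|exact: M14].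
have low := low_signal_error (hQ d0) (hdata d0) (htest d0) (hindep d0)
    tau0 (hsvm d0) n0 d0 p0 p4 d1 s0 rE r2 m8 dr mr q1 H0 M0 h0 c1 c2.
rewrite ge_max ltW//= lerBlDr -lerBlDl.
apply: le_trans low; rewrite lerD2l lerN2.
apply: (le_trans (ler_wpM2l _ (lerD bd (lerD hHM rest)))); first by rewrite invr_ge0.
by lra.
Unshelve. all: by end_near. Qed.

End Asymptotics.

Theorem theorem5p5 (R : realType) (a b c C : R)
  (ha : 0 < a) (hb : 0 < b) (hc : 0 < c) (hac : a - c < 1)
  (pi : nat -> R) (mu : forall d : nat, d.-tuple R) (n : nat -> nat)
  (himb : imbalanced a b c pi mu n)
  (Q : forall d : nat, probability (d.-tuple R * R)%type R)
  (hQ : forall d : nat, (0 < d)%N -> is_2subGMM (pi d) (mu d) C (Q d))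
  (disp : nat -> measure_display)
  (Omega : forall d : nat, measurableType (disp d))
  (P : forall d : nat, probability (Omega d) R)
  (data : forall d : nat, {RV (P d) >-> (n d).-tuple (d.-tuple R * R)%type})
  (test : forall d : nat, {RV (P d) >-> (d.-tuple R * R)%type})
  (hdata : forall d : nat, (0 < d)%N -> iid_with_law (P d) (data d) (Q d))
  (htest : forall d : nat, (0 < d)%N -> has_law (P d) (test d) (Q d))
  (hindep : forall d : nat, (0 < d)%N -> independent (P d) (data d) (test d))
  (tau : nat -> R) (htau : forall d : nat, (0 < d)%N -> 0 < tau d)
  (train : forall d : nat,
    {mfun (n d).-tuple (d.-tuple R * R)%type >-> (d.-tuple R * R)%type})
  (hsvm : forall d : nat, (0 < d)%N -> is_svm (tau d) (train d)) :
  let Errp d := err_pos (P d) (train d \o data d) (test d) in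
  let Errm d := err_neg (P d) (train d \o data d) (test d) in
  let Errb d := err_bal (P d) (train d \o data d) (test d) in
  [/\ (* high signal *)
      a - c < b ->
      (forall d : nat, (0 < d)%N -> 1 <= tau d) ->
      tau =o_\oo (fun d : nat => d%:R `^ (b / 2)) ->
      Errp @ \oo --> (0 : R) /\ Errm @ \oo --> (0 : R),
      (* moderate signal *)
      b < a - c -> a - c < 2 * b ->
      ((fun d : nat => d%:R `^ (a - b - c)) =o_\oo tau ->
       tau =o_\oo (fun d : nat => d%:R `^ ((a - c) / 2)) ->
       Errp @ \oo --> (0 : R) /\ Errm @ \oo --> (0 : R)) /\
      (tau =O_\oo (fun=> 1 : R) ->
       (fun=> 1 : R) =O_\oo tau ->
       Errp @ \oo --> (1 : R) /\ Errm @ \oo --> (0 : R)) &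
      (* low signal *)
      2 * b < a - c ->
      exists2 e : nat -> R, e @ \oo --> (0 : R) & forall d : nat, 2^-1 - e d <= Errb d].
Proof.
move=> Errp Errm Errb; split.
- exact: (high_signal ha hb hc hac himb hQ hdata htest hindep htau hsvm).
- move=> bac acb; split.
    exact: (moderate_signal ha hb hc hac himb hQ hdata htest hindep htau hsvm).
  by move=> tauO _; exact: (moderate_signal_bounded_tau ha hb hc hac himb hQ hdata htest hindep htau hsvm bac tauO).
- exact: (low_signal ha hb hc hac himb hQ hdata htest hindep htau hsvm).
Qed.
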